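(* Let $H$ be a Hilbert space and $E$ a linear operator in $H$. The following are equivalent. (i) $E$ generates a $C_0$-semigroup $\mathcal T$ which is similar to a semigroup of isometries (i.e. $(RT(t)R^{-1})_{t\ge0}$ consists of isometries for some invertible $R\in\mathcal L(H)$). (ii) $\sigma(E)\subseteq\{z\in\mathbb C:\operatorname{Re}z\le0\}$ and there exist $\alpha,\beta>0$ such that either $$\alpha\|h\|^2\le\limsup_{\varepsilon\to0^+}\varepsilon\int_{-\infty}^\infty\|(\varepsilon+i\xi-E)^{-1}h\|^2\,d\xi\le\beta\|h\|^2\quad\text{for all }h\in H,$$ or the same holds with $\liminf$ in place of $\limsup$.
   Context: $E$ is not assumed a priori to be densely defined; $\rho(E)$ is the set of $\lambda\in\mathbb C$ for which $(\lambda-E)^{-1}$ exists and is bounded on $H$, and $\sigma(E)=\mathbb C\setminus\rho(E)$. *)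

(* Defs.v *)
From mathcomp Require Import all_boot all_order all_algebra.
From mathcomp Require Import all_classical all_reals all_analysis.
From mathcomp Require Export complex.
Import Order.TTheory GRing.Theory Num.Theory numFieldNormedType.Exports.

Set Implicit Arguments. Unset Strict Implicit. Unset Printing Implicit Defensive.

Local Open Scope classical_set_scope.
Local Open Scope ring_scope.

Section Hilbert.
Variable R : realType.
Local Notation C := R[i].
Variables (H : lmodType C) (ip : H -> H -> C).

Definition hnorm (x : H) : R := Num.sqrt (complex.Re (ip x x)).

Record is_hilbert : Prop := {
  ip_linear_l : forall (a : C) (x y z : H), ip (a *: x + y) z = a * ip x z + ip y z;
  ip_conj_sym : forall x y : H, ip y x = (ip x y)^*;
  ip_ge0 : forall x : H, 0 <= ip x x;
  ip_definite : forall x : H, ip x x = 0 -> x = 0;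
  ip_complete : forall u : nat -> H,
    (forall e : R, 0 < e -> exists N : nat, forall m n : nat,
        (N <= m)%N -> (N <= n)%N -> hnorm (u m - u n) < e) ->
    exists l : H, forall e : R, 0 < e -> exists N : nat, forall n : nat,
        (N <= n)%N -> hnorm (u n - l) < e }.

Definition linear_operator (D : set H) (A : H -> H) : Prop :=
  [/\ D 0,
      (forall x y, D x -> D y -> D (x + y)),
      (forall (a : C) x, D x -> D (a *: x)),
      (forall x y, D x -> D y -> A (x + y) = A x + A y) &
      (forall (a : C) x, D x -> A (a *: x) = a *: A x)].

Definition bounded_op (A : H -> H) : Prop :=
  [/\ (forall x y, A (x + y) = A x + A y),
      (forall (a : C) x, A (a *: x) = a *: A x) &
      exists M : R, forall x, hnorm (A x) <= M * hnorm x].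

Definition in_resolvent_set (D : set H) (E : H -> H) (lam : C) : Prop :=
  exists Rl : H -> H, [/\ bounded_op Rl,
    (forall h, D (Rl h) /\ lam *: Rl h - E (Rl h) = h) &
    (forall x, D x -> Rl (lam *: x - E x) = x)].

(* (lam - E)^{-1} h  (the unique solution y in D of lam y - E y = h when lam \in rho(E)) *)
Definition resolvent (D : set H) (E : H -> H) (lam : C) (h : H) : H :=
  xget 0 [set y | D y /\ lam *: y - E y = h].

Definition C0_semigroup (T : R -> H -> H) : Prop :=
  [/\ (forall t, 0 <= t -> bounded_op (T t)),
      (forall x, T 0 x = x),
      (forall s t x, 0 <= s -> 0 <= t -> T (s + t) x = T s (T t x)) &
      (forall x, hnorm (T t x - x) @[t --> 0^'+] --> 0)].

Definition generates (D : set H) (E : H -> H) (T : R -> H -> H) : Prop :=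
  C0_semigroup T /\
  forall x y, (D x /\ E x = y) <->
    hnorm ((t^-1)%:C%C *: (T t x - x) - y) @[t --> 0^'+] --> 0.

Definition similar_to_isometries (T : R -> H -> H) : Prop :=
  exists Rm Rinv : H -> H, [/\ bounded_op Rm, bounded_op Rinv,
    (forall x, Rm (Rinv x) = x), (forall x, Rinv (Rm x) = x) &
    (forall t x, 0 <= t -> hnorm (Rm (T t (Rinv x))) = hnorm x)].

Definition res_integral (D : set H) (E : H -> H) (h : H) (eps : R) : \bar R :=
  (eps%:E * \int[lebesgue_measure]_(xi in setT)
       ((hnorm (resolvent D E (Complex eps xi) h)) ^+ 2)%:E)%E.

End Hilbert.

(* Main.v *)
(** From integral bounds to isometries: put V = (1 + E)(1 - E)^-1.  For lambda = eps + i xi the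
    vectors (lambda - E)^-1 h and (lambda - E)^-1 V h differ, in squared norm, by a relative error
    O(sqrt eps) plus an integrable tail O(eps^(-1/2) / (1 + xi^2)); after multiplication by eps and
    integration, limsup and liminf take the same value at h and at V h.  Hence the powers of V are
    bounded above and below, a Banach limit of <V^n x, V^n y> is an equivalent inner product for
    which V is isometric, and for it E is skew with 1 - E onto, so E generates isometries.  Two
    equivalent inner products are related by an invertible operator, a positive square root.

    Conversely, in the norm that makes the semigroup isometric E is skew, so that
    eps |(lambda - E)^-1 h|^2 = Re <(lambda - E)^-1 h, h> is the real part of a holomorphic function
    of lambda.  By the Cauchy-Riemann equations its integral over vertical lines does not depend on
    eps, and for large eps it is compared with the Poisson kernel. *)
Require Import Defs.
From mathcomp Require Import all_boot all_order all_algebra.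
From mathcomp Require Import all_classical all_reals all_analysis.
From mathcomp Require Import complex.
From mathcomp Require Import measurable_realfun ring lra.
Import Order.TTheory GRing.Theory Num.Theory numFieldNormedType.Exports.
Import ComplexField.Normc.

Set Implicit Arguments. Unset Strict Implicit. Unset Printing Implicit Defensive.

Local Open Scope classical_set_scope.
Local Open Scope ring_scope.

(** * Inner product and norm convergence *)

(** A limsup or liminf of quadratic forms need not be quadratic, so the limit of the scaled
    integrals cannot itself serve as an inner product, although it is invariant under [V]. Only its
    size is exploited; the quadratic form comes from averaging over the powers of [V]. The choice of
    [V] makes (lambda - E)^-1 h and (lambda - E)^-1 V h explicit combinations of the same two
    vectors, x = (1 - E)^-1 h and (lambda - E)^-1 x.

    Only the right half-plane is known to lie in the resolvent set, so the semigroup is isometric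
    and may fail to be unitary, and density of the domain has to be derived. No vector-valued
    integral occurs: the semigroup is a limit of implicit Euler steps, resolvents of a given
    semigroup are limits of solutions of difference equations, and integrals over the line are
    limits of real integrals over segments. The numerical constants are not sharp; they absorb a
    crude comparison at large abscissa and an approximation of [h] from the domain. *)

Section RealSequences.
Variable R : realType.

Lemma cvg0Ml (c : R) (u : nat -> R) : u n @[n --> \oo] --> 0 -> c * u n @[n --> \oo] --> 0.
Proof. by move=> hu; rewrite -(mulr0 c); apply: cvgM => //; exact: cvg_cst. Qed.

Lemma cvg0Mr (c : R) (u : nat -> R) : u n @[n --> \oo] --> 0 -> u n * c @[n --> \oo] --> 0.
Proof. by move=> hu; under eq_fun do rewrite mulrC; exact: cvg0Ml. Qed.

Lemma cvg_ler (u v : nat -> R) (x y : R) : (forall n, u n <= v n) ->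
  u n @[n --> \oo] --> x -> v n @[n --> \oo] --> y -> x <= y.
Proof.
move=> h hu hv; rewrite -(cvg_lim (@Rhausdorff R) hu) -(cvg_lim (@Rhausdorff R) hv).
by apply: ler_lim; [exact: (cvgP _ hu)|exact: (cvgP _ hv)|near=> n; exact: h].
Unshelve. all: by end_near. Qed.

End RealSequences.

Section InnerProduct.
Variables (R : realType) (H : lmodType R[i]) (ip : H -> H -> R[i]).
Hypothesis hH : is_hilbert ip.
Local Notation N := (hnorm ip).

(** Nearly every estimate uses only this symmetric real bilinear form; [ipE] recovers the complex
    product from it. *)
Definition real_ip (x y : H) : R := complex.Re (ip x y).
Local Notation rip := real_ip.

Lemma conjE (z : R[i]) : z^* = conjc z. Proof. by []. Qed.

Lemma ipDl x y z : ip (x + y) z = ip x z + ip y z.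
Proof. by have := ip_linear_l hH 1 x y z; rewrite scale1r mul1r. Qed.
Lemma ip0l z : ip 0 z = 0.
Proof. by apply: (addrI (ip 0 z)); rewrite -ipDl !addr0. Qed.
Lemma ipZl a x z : ip (a *: x) z = a * ip x z.
Proof. by have := ip_linear_l hH a x 0 z; rewrite !addr0 ip0l addr0. Qed.
Lemma ipNl x z : ip (- x) z = - ip x z.
Proof. by rewrite -scaleN1r ipZl mulN1r. Qed.
Lemma ipBl x y z : ip (x - y) z = ip x z - ip y z.
Proof. by rewrite ipDl ipNl. Qed.
Lemma ipDr x y z : ip z (x + y) = ip z x + ip z y.
Proof. by rewrite (ip_conj_sym hH) ipDl rmorphD /= -!(ip_conj_sym hH). Qed.
Lemma ipNr x z : ip z (- x) = - ip z x.
Proof. by rewrite (ip_conj_sym hH) ipNl rmorphN /= -!(ip_conj_sym hH). Qed.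
Lemma ipZr a x z : ip z (a *: x) = a^* * ip z x.
Proof. by rewrite (ip_conj_sym hH) ipZl rmorphM /= -!(ip_conj_sym hH). Qed.

Lemma ip_ext x y : (forall z, ip x z = ip y z) -> x = y.
Proof.
move=> h; apply/eqP; rewrite -subr_eq0; apply/eqP/(ip_definite hH).
by rewrite ipBl h subrr.
Qed.

Lemma ripC x y : rip x y = rip y x.
Proof. by rewrite /rip (ip_conj_sym hH); case: (ip y x). Qed.
Lemma ripDl x y z : rip (x + y) z = rip x z + rip y z.
Proof. by rewrite /rip ipDl; case: (ip x z) (ip y z) => [a b] []. Qed.
Lemma ripNl x z : rip (- x) z = - rip x z.
Proof. by rewrite /rip ipNl; case: (ip x z). Qed.
Lemma ripBl x y z : rip (x - y) z = rip x z - rip y z.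
Proof. by rewrite ripDl ripNl. Qed.
Lemma ripDr x y z : rip z (x + y) = rip z x + rip z y.
Proof. by rewrite ![rip z _]ripC ripDl. Qed.
Lemma ripNr x z : rip z (- x) = - rip z x.
Proof. by rewrite ![rip z _]ripC ripNl. Qed.
Lemma ripBr x y z : rip z (x - y) = rip z x - rip z y.
Proof. by rewrite ripDr ripNr. Qed.
Lemma ripZl (a : R) x z : rip (a%:C%C *: x) z = a * rip x z.
Proof. by rewrite /rip ipZl; case: (ip x z) => u v /=; rewrite mul0r subr0. Qed.
Lemma ripZr (a : R) x z : rip z (a%:C%C *: x) = a * rip z x.
Proof. by rewrite ripC ripZl ripC. Qed.
Lemma rip0l z : rip 0 z = 0. Proof. by rewrite /rip ip0l. Qed.
Lemma rip0r z : rip z 0 = 0. Proof. by rewrite ripC rip0l. Qed.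
Lemma ripii x y : rip ('i%C *: x) ('i%C *: y) = rip x y.
Proof.
rewrite /rip ipZl ipZr conjE /=; case: (ip x y) => a b /=; ring.
Qed.
Lemma ripil x y : rip ('i%C *: x) y = - rip x ('i%C *: y).
Proof. by rewrite /rip ipZl ipZr conjE /=; case: (ip x y) => a b /=; ring. Qed.
Lemma ipE x y : ip x y = Complex (rip x y) (rip x ('i%C *: y)).
Proof. by rewrite /rip ipZr conjE /=; case: (ip x y) => a b /=; congr Complex; ring. Qed.

Lemma complex_scaleE (a b : R) (x : H) : Complex a b *: x = a%:C%C *: x + b%:C%C *: ('i%C *: x).
Proof.
rewrite scalerA -scalerDl; congr (_ *: _).
rewrite -[RHS]/(Complex _ _); congr Complex; rewrite /=; ring.
Qed.

Lemma rip_ge0 x : 0 <= rip x x.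
Proof. by have := ip_ge0 hH x; rewrite lecE => /andP[]. Qed.
Lemma hnorm_sq x : N x ^+ 2 = rip x x.
Proof. by rewrite /hnorm sqr_sqrtr // rip_ge0. Qed.
Lemma hnorm_ge0 x : 0 <= N x. Proof. exact: sqrtr_ge0. Qed.
Lemma hnorm0 : N 0 = 0. Proof. by rewrite /hnorm ip0l /= sqrtr0. Qed.
Lemma hnorm_eq0 x : N x = 0 -> x = 0.
Proof.
move=> h; apply: (ip_definite hH); rewrite ipE ripC ripil.
have := hnorm_sq x; rewrite h expr0n /= => <-.
(* Multiplication by i is antisymmetric for the real form, so the imaginary part of [ip x x]
   vanishes. *)
have h' : rip x ('i%C *: x) = 0.
  have := ripil x x; rewrite ripC; lra.
by rewrite h' oppr0.
Qed.
Lemma rip_eq0 x : rip x x = 0 -> x = 0.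
Proof. by move=> h; apply: hnorm_eq0; apply/eqP; rewrite -sqrf_eq0 hnorm_sq h. Qed.

Lemma hnormN x : N (- x) = N x.
Proof. by rewrite /hnorm ipNl ipNr opprK. Qed.
Lemma hnormC x y : N (x - y) = N (y - x).
Proof. by rewrite -hnormN opprB. Qed.

Lemma normcE (z : R[i]) : normc z ^+ 2 = (complex.Re z) ^+ 2 + (complex.Im z) ^+ 2.
Proof. by case: z => a b /=; rewrite sqr_sqrtr // addr_ge0 // sqr_ge0. Qed.
Lemma normc_ge0 (z : R[i]) : 0 <= normc z.
Proof. by case: z => a b /=; rewrite sqrtr_ge0. Qed.
Lemma normc_real (a : R) : normc a%:C%C = `|a|.
Proof. by rewrite /= expr0n /= addr0 sqrtr_sqr. Qed.
Lemma hnormZ (a : R[i]) x : N (a *: x) = normc a * N x.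
Proof.
apply: (pexpIrn (n := 2)); rewrite ?nnegrE ?mulr_ge0 ?hnorm_ge0 ?normc_ge0 //.
rewrite exprMn normcE !hnorm_sq; case: a => a b /=; rewrite complex_scaleE.
rewrite !(ripDl, ripDr, ripZl, ripZr) ripii ripil; ring.
Qed.
Lemma hnormZr (a : R) x : N (a%:C%C *: x) = `|a| * N x.
Proof. by rewrite hnormZ normc_real. Qed.

Lemma rip_cs x y : `|rip x y| <= N x * N y.
Proof.
rewrite -(ler_pXn2r (n := 2)) ?nnegrE ?mulr_ge0 ?hnorm_ge0 //.
rewrite real_normK ?num_real // exprMn !hnorm_sq.
have [->|y0] := eqVneq y 0; first by rewrite !rip0r expr0n mulr0.
have yy : 0 < rip y y.
  by rewrite lt_def rip_ge0 andbT; apply: contra y0 => /eqP/rip_eq0 ->.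
(* This square expands to <y,y> (<x,x> <y,y> - <x,y>^2). *)
have := rip_ge0 ((rip y y)%:C%C *: x - (rip x y)%:C%C *: y).
rewrite ripBl !ripBr !ripZl !ripZr (ripC y x) => h.
rewrite -(ler_pM2r yy) -subr_ge0; lra.
Qed.

Lemma rip_le x y : rip x y <= N x * N y.
Proof. exact: le_trans (ler_norm _) (rip_cs x y). Qed.
Lemma ip_cs x y : normc (ip x y) <= N x * N y.
Proof.
have [->|n0] := eqVneq (normc (ip x y)) 0; first by rewrite mulr_ge0 ?hnorm_ge0.
have n1 : 0 < normc (ip x y) by rewrite lt_def n0 normc_ge0.
(* Rotating [x] by the conjugate of [ip x y] makes the product real and nonnegative. *)
have := rip_le (((ip x y)^* *: x)) y.
rewrite hnormZ {1}/rip ipZl.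
have -> : normc (ip x y)^* = normc (ip x y).
  by case: (ip x y) => a b; rewrite conjE /= sqrrN.
have -> : complex.Re ((ip x y)^* * ip x y) = normc (ip x y) ^+ 2.
  by rewrite normcE; case: (ip x y) => a b; rewrite conjE /=; ring.
by rewrite expr2 -mulrA ler_pM2l.
Qed.

Lemma hnormD_sq x y : N (x + y) ^+ 2 = N x ^+ 2 + 2 * rip x y + N y ^+ 2.
Proof. by rewrite !hnorm_sq ripDl !ripDr (ripC y x); ring. Qed.
Lemma hnormB_sq x y : N (x - y) ^+ 2 = N x ^+ 2 - 2 * rip x y + N y ^+ 2.
Proof. by rewrite hnormD_sq hnormN ripNr; ring. Qed.

Lemma hnormD x y : N (x + y) <= N x + N y.
Proof.
rewrite -(ler_pXn2r (n := 2)) ?nnegrE ?addr_ge0 ?hnorm_ge0 // hnormD_sq.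
have := rip_le x y; lra.
Qed.
Lemma hnormB x y : N (x - y) <= N x + N y.
Proof. by rewrite -(hnormN y) hnormD. Qed.
Lemma hnorm_distD x y z : N (x - z) <= N (x - y) + N (y - z).
Proof. by rewrite -[x - z](subrKA y) hnormD. Qed.
Lemma hnorm_dist x y : `|N x - N y| <= N (x - y).
Proof.
rewrite ler_norml; have := hnormD (x - y) y; have := hnormD (y - x) x.
by rewrite !subrK (hnormC y x); lra.
Qed.
Lemma hnorm_le_sq x (c : R) : 0 <= c -> N x ^+ 2 <= c ^+ 2 -> N x <= c.
Proof. by move=> c0; rewrite ler_pXn2r // nnegrE ?hnorm_ge0. Qed.

(** [H] is a bare module without topology, so convergence is that of a real sequence of norms. *)
Definition norm_cvg (u : nat -> H) (l : H) := N (u n - l) @[n --> \oo] --> 0.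
Local Notation hlim := norm_cvg.

Lemma hlimP u l : hlim u l <->
  forall e : R, 0 < e -> exists K : nat, forall n : nat, (K <= n)%N -> N (u n - l) < e.
Proof.
split.
  move=> /cvgrPdist_lt h e e0; have [K _ hK] := h e e0.
  exists K => n Kn; have := hK n Kn.
  by rewrite /= sub0r normrN ger0_norm ?hnorm_ge0.
move=> h; apply/cvgrPdist_lt => e e0; have [K hK] := h e e0.
exists K => // n Kn; rewrite /= sub0r normrN ger0_norm ?hnorm_ge0 //; exact: hK.
Qed.

Lemma hlim_squeeze (a : nat -> R) u l :
  (forall n, N (u n - l) <= a n) -> a n @[n --> \oo] --> 0 -> hlim u l.
Proof.
move=> h1 h2; apply: (squeeze_cvgr _ (cvg_cst 0) h2).
by near=> n; rewrite hnorm_ge0 h1.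
Unshelve. all: by end_near. Qed.

Lemma hlim_cst x : hlim (fun=> x) x.
Proof. by apply: (@hlim_squeeze (fun=> 0)); rewrite ?subrr ?hnorm0 //; exact: cvg_cst. Qed.

Lemma hlimD u v x y : hlim u x -> hlim v y -> hlim (fun n => u n + v n) (x + y).
Proof.
move=> hu hv; apply: (@hlim_squeeze (fun n => N (u n - x) + N (v n - y))).
  by move=> n; rewrite opprD addrACA hnormD.
by rewrite -[0]addr0; exact: cvgD.
Qed.

Lemma hlimZ (a : R[i]) u x : hlim u x -> hlim (fun n => a *: u n) (a *: x).
Proof.
move=> hu; apply: (@hlim_squeeze (fun n => normc a * N (u n - x))).
  by move=> n; rewrite -scalerBr hnormZ.
exact: cvg0Ml.
Qed.

Lemma hlimN u x : hlim u x -> hlim (fun n => - u n) (- x).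
Proof.
move=> hu; apply: (@hlim_squeeze (fun n => N (u n - x))) => // n.
by rewrite -opprD hnormN.
Qed.
Lemma hlimB u v x y : hlim u x -> hlim v y -> hlim (fun n => u n - v n) (x - y).
Proof. by move=> hu hv; apply: hlimD => //; exact: hlimN. Qed.

Lemma hlim_norm u x : hlim u x -> N (u n) @[n --> \oo] --> N x.
Proof.
move=> hu; apply/cvgrPdist_lt => e e0.
have [K hK] := (hlimP u x).1 hu e e0; exists K => // n Kn /=.
by apply: le_lt_trans (hnorm_dist _ _) _; rewrite hnormC hK.
Qed.

Lemma hlim_rip u v x y : hlim u x -> hlim v y ->
  rip (u n) (v n) @[n --> \oo] --> rip x y.
Proof.
move=> hu hv; have e a b : rip a b = (N (a + b) ^+ 2 - N a ^+ 2 - N b ^+ 2) / 2.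
  by rewrite hnormD_sq; field.
rewrite e; under eq_fun do rewrite e.
apply: cvgM; last exact: cvg_cst.
apply: cvgB; first apply: cvgB.
- by apply: cvgM; apply: hlim_norm; apply: hlimD.
- by apply: cvgM; apply: hlim_norm.
- by apply: cvgM; apply: hlim_norm.
Qed.

Lemma hlim_unique u x y : hlim u x -> hlim u y -> x = y.
Proof.
move=> hx hy; apply/eqP; rewrite -subr_eq0; apply/eqP/hnorm_eq0.
have := hlim_norm (hlimB hx hy); under eq_fun do rewrite subrr hnorm0.
move=> h; rewrite -(cvg_lim (@Rhausdorff R) h).
by apply: (cvg_lim (@Rhausdorff R)); exact: cvg_cst.
Qed.

Lemma hlim_bound (A : H -> H) (M : R) u x :
  (forall a b, N (A a - A b) <= M * N (a - b)) -> hlim u x -> hlim (fun n => A (u n)) (A x).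
Proof.
move=> hA hu; apply: (@hlim_squeeze (fun n => M * N (u n - x))).
  by move=> n; apply: hA.
exact: cvg0Ml.
Qed.

Lemma hcauchy_cvg u (a : nat -> R) : (forall k l, (k <= l)%N -> N (u l - u k) <= a k) ->
  a n @[n --> \oo] --> 0 -> exists l, hlim u l.
Proof.
move=> h ha; have [l hl] : exists l, forall e : R, 0 < e -> exists K : nat,
    forall n : nat, (K <= n)%N -> N (u n - l) < e.
  apply: (ip_complete hH) => e e0.
  have e2 : 0 < e / 2 by rewrite divr_gt0.
  have [K _ hK] := (cvgrPdist_lt _ _).1 ha _ e2.
  exists K => m n Km Kn; rewrite (@le_lt_trans _ _ (N (u m - u K) + N (u K - u n))) ?hnorm_distD //.
  have := hK K (leqnn _); rewrite /= sub0r normrN => /(le_lt_trans (ler_norm _)) hh {hK}.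
  have := h K m Km; have := h K n Kn; rewrite (hnormC (u K)); lra.
by exists l; apply/hlimP.
Qed.

Lemma hlim_le u v x y : hlim u x -> (forall n, N (u n) <= v n) -> v n @[n --> \oo] --> y ->
  N x <= y.
Proof.
by move=> hu hv cv; exact: (cvg_ler hv (hlim_norm hu) cv). Qed.

Lemma hgeo_cvg (u : nat -> H) (q c : R) : 0 <= q -> q < 1 ->
  (forall n, N (u n.+1 - u n) <= q ^+ n * c) -> exists l, hlim u l.
Proof.
move=> q0 q1 hs; have q1' : 0 < 1 - q by lra.
have c0 : 0 <= c by have := hs 0; rewrite expr0 mul1r; apply: le_trans; exact: hnorm_ge0.
have hs2 k n : N (u (k + n)%N - u k) <= q ^+ k * c / (1 - q).
  suff : N (u (k + n)%N - u k) <= q ^+ k * (1 - q ^+ n) / (1 - q) * c.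
    move/le_trans; apply; rewrite mulrAC ler_pM2r ?invr_gt0 //.
    by rewrite ler_wpM2r // ler_piMr ?exprn_ge0 // gerBl exprn_ge0.
  elim: n => [|n IH]; first by rewrite addn0 subrr hnorm0 expr0 subrr mulr0 !mul0r.
  rewrite (le_trans (hnorm_distD _ (u (k + n)%N) _)) // addnS.
  rewrite (le_trans (lerD (hs _) IH)) // -mulrDl ler_wpM2r //.
  by rewrite exprD exprS ler_pdivlMr // mulrDl divfK ?gt_eqF //; lra.
apply: (@hcauchy_cvg u (fun k => q ^+ k * c / (1 - q))).
  by move=> k l kl; rewrite -(subnKC kl) hs2.
by apply: cvg0Mr; apply: cvg0Mr; apply: cvg_expr; rewrite ger0_norm.
Qed.

Lemma contraction_fixpoint (F : H -> H) (q : R) : 0 <= q -> q < 1 ->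
  (forall x y, N (F x - F y) <= q * N (x - y)) -> exists x, F x = x.
Proof.
move=> q0 q1 hF; pose u n := iter n F 0.
have [l hl] : exists l, hlim u l.
  apply: (@hgeo_cvg u q (N (F 0))) => //.
  elim => [|n IH]; first by rewrite /u /= subr0 expr0 mul1r.
  by rewrite (le_trans (hF _ _)) // exprS -mulrA ler_wpM2l.
exists l; apply: (@hlim_unique (fun n => F (u n))).
  by apply: hlim_bound hl; exact: hF.
by apply/hlimP => e /((hlimP _ _).1 hl)[K hK]; exists K => n Kn; apply: (hK n.+1); apply: leqW.
Qed.

End InnerProduct.


(** * Projection, Riesz representation, Neumann inversion *)

Section Projection.
Variables (R : realType) (H : lmodType R[i]) (ip : H -> H -> R[i]).
Hypothesis hH : is_hilbert ip.
Local Notation N := (hnorm ip).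
Local Notation rip := (real_ip ip).
Local Notation hlim := (norm_cvg ip).

(** [K] is not assumed closed, so the nearest point [z] lies in its closure and the minimising
    sequence is returned with it. Applied to the domain, this yields density. *)
Lemma hprojection (K : set H) (y : H) : K 0 ->
  (forall u v, K u -> K v -> K (u + v)) -> (forall (a : R[i]) u, K u -> K (a *: u)) ->
  exists z (k : nat -> H), [/\ forall n, K (k n), hlim k z & forall x, K x -> ip x (y - z) = 0].
Proof.
move=> K0 KD KZ.
pose A := [set N (y - k) ^+ 2 | k in K].
have A0 : A !=set0 by exists (N (y - 0) ^+ 2), 0.
have Alb : lbound A 0 by move=> _ [k _ <-]; exact: sqr_ge0.
have hA : has_inf A by split => //; exists 0.
pose m := inf A.
have mle k : K k -> m <= N (y - k) ^+ 2 by move=> Kk; apply: ge_inf; [exists 0|exists k].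
have /choice[k hk] : forall n : nat, exists k, K k /\ N (y - k) ^+ 2 <= m + (n.+1%:R^-1) ^+ 2.
  move=> n.
  have e0 : 0 < (n.+1%:R^-1 : R) ^+ 2 by rewrite exprn_gt0 // invr_gt0.
  have [_ [k Kk <-] hk] := inf_adherent e0 hA.
  by exists k; split => //; exact: ltW.
have [z hz] : exists z, hlim k z.
  apply: (@hcauchy_cvg _ _ _ hH k (fun n => 2 * n.+1%:R^-1)).
    move=> n l nl; apply: hnorm_le_sq; first by rewrite mulr_ge0 // invr_ge0.
    have [Kn hn] := hk n; have [Kl hl] := hk l.
    (* Parallelogram identity: the midpoint of two near-minimisers is at squared distance at least
       [m], which forces them to be close. *)
    have := mle ((2^-1)%:C%C *: (k l + k n)) (KZ _ _ (KD _ _ Kl Kn)).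
    have le1 : (l.+1%:R^-1 : R) ^+ 2 <= (n.+1%:R^-1) ^+ 2.
      by rewrite ler_pXn2r ?nnegrE ?invr_ge0 // lef_pV2 ?posrE // ler_nat.
    move: hn hl; rewrite !(hnormB_sq hH) (hnormZr hH) exprMn (hnormD_sq hH) ger0_norm // (ripZr hH) !(ripDr hH).
    move: le1; set e1 := (_ ^+ 2); set e2 := (_ ^+ 2).
    have -> : (2 * n.+1%:R^-1) ^+ 2 = 4 * e2 :> R by rewrite exprMn /e2; congr (_ * _); rewrite -natrX.
    by move=> *; lra.
  by apply: cvg0Ml; exact: cvg_harmonic.
have Nyz : N (y - z) ^+ 2 <= m.
  apply: (@cvg_ler _ (fun n => N (y - k n) ^+ 2) (fun n => m + (n.+1%:R^-1) ^+ 2)).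
  - by move=> n; have [] := hk n.
  - have h := hlim_norm hH (hlimB hH (hlim_cst hH y) hz).
    by apply: cvgM.
  - rewrite -[X in _ --> X]addr0; apply: cvgD; first exact: cvg_cst.
    by rewrite -(mulr0 (0 : R)); apply: cvgM; exact: cvg_harmonic.
have hr x : K x -> rip x (y - z) = 0.
  move=> Kx; have h (t : R) : 0 <= t ^+ 2 * N x ^+ 2 - 2 * t * rip x (y - z).
    have : m <= N (y - z - t%:C%C *: x) ^+ 2.
      have h : hlim (fun n => y - k n - t%:C%C *: x) (y - z - t%:C%C *: x).
        by apply: hlimB => //; [apply: hlimB => //; exact: hlim_cst|exact: hlim_cst].
      apply: (@cvg_ler _ (fun=> m) (fun n => N (y - k n - t%:C%C *: x) ^+ 2)).
      - move=> n; have -> : y - k n - t%:C%C *: x = y - (k n + t%:C%C *: x).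
          by rewrite opprD addrA.
        by apply: mle; apply: KD; [have [] := hk n|exact: KZ].
      - exact: cvg_cst.
      - by have h' := hlim_norm hH h; apply: cvgM.
    rewrite (hnormB_sq hH (y - z)) (hnormZr hH) (ripZr hH) (ripC hH x) exprMn real_normK ?num_real //.
    by move: Nyz; lra.
  move: h; set a := rip _ _; set b := N x ^+ 2 => h.
  have b0 : 0 <= b by exact: sqr_ge0.
  (* The quadratic is minimal at a / b; using b + 1 avoids division by zero and still gives a
     negative value unless a = 0. *)
  have := h (a / (b + 1)); have b1 : 0 < b + 1 by lra.
  have -> : (a / (b + 1)) ^+ 2 * b - 2 * (a / (b + 1)) * a = - (a ^+ 2 * ((b + 2) / (b + 1) ^+ 2)).
    by field; rewrite gt_eqF.
  rewrite oppr_ge0 pmulr_lle0 ?divr_gt0 ?exprn_gt0 //; last by lra.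
  by move=> h1; apply/eqP; rewrite -sqrf_eq0 eq_le h1 sqr_ge0.
exists z, k; split => //; first by move=> n; have [] := hk n.
move=> x Kx; rewrite (ipE hH) hr //; congr Complex.
by have := ripil hH x (y - z); rewrite hr; [lra|exact: KZ].
Qed.

Lemma riesz (f : H -> R[i]) (M : R) : (forall x y, f (x + y) = f x + f y) ->
  (forall a x, f (a *: x) = a * f x) -> (forall x, normc (f x) <= M * N x) ->
  exists s, forall y, f y = ip y s.
Proof.
move=> fD fZ fM; have [f0|] := pselect (forall y, f y = 0).
  by exists 0 => y; rewrite f0 (ip_conj_sym hH) (ip0l hH) rmorph0.
move=> /existsNP[y0 /eqP fy0].
have f0 : f 0 = 0 by rewrite -(scale0r y0) fZ mul0r.
have [|u v hu hv|a u hu|z [k [kK kz zo]]] := @hprojection [set x | f x = 0] y0; first exact: f0.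
- by rewrite /= fD hu hv addr0.
- by rewrite /= fZ hu mulr0.
(* [z] is only a limit of points of the kernel; boundedness of [f] carries the equation to it. *)
have fz : f z = 0.
  apply: eq0_normc; apply/eqP; rewrite eq_le normc_ge0 andbT.
  apply: (@cvg_ler _ (fun=> normc (f z)) (fun n => M * N (z - k n))).
  - move=> n; suff -> : f z = f (z - k n) by exact: fM.
    by rewrite fD -scaleN1r fZ (kK n) mulr0 addr0.
  - exact: cvg_cst.
  - by under eq_fun do rewrite (hnormC hH); exact: cvg0Ml.
move: zo; set w := y0 - z => zo.
have fw : f w != 0 by rewrite /w fD -scaleN1r fZ fz mulr0 addr0.
have ww : ip w w != 0.
  by apply: contra fw => /eqP/(ip_definite hH) ->; rewrite f0.
exists ((f w / ip w w)^* *: w) => y; rewrite (ipZr hH) conjCK.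
have := zo (y - (f y / f w) *: w); rewrite /= fD -scaleNr fZ mulNr divfK // subrr => /(_ erefl).
rewrite (ipDl hH) (ipZl hH) mulNr => /eqP; rewrite subr_eq0 => /eqP ->.
by field; rewrite fw ww.
Qed.

(** [W x] is the fixed point of y -> x + V y, which replaces the summation of a series. *)
Lemma neumann_inverse (V : H -> H) (q : R) : 0 <= q -> q < 1 ->
  (forall x y, V (x + y) = V x + V y) -> (forall a x, V (a *: x) = a *: V x) ->
  (forall x, N (V x) <= q * N x) ->
  exists W, [/\ bounded_op ip W, forall x, W (x - V x) = x, forall x, W x - V (W x) = x &
    forall x, N (W x) <= (1 - q)^-1 * N x].
Proof.
move=> q0 q1 VD VZ Vq; have q1' : 0 < 1 - q by lra.
have VB x y : V (x - y) = V x - V y by rewrite VD -scaleN1r VZ scaleN1r.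
have /choice[W hW] : forall x, exists y, y - V y = x.
  move=> x.
  have [||u v|y hy] := @contraction_fixpoint _ _ _ hH (fun y => x + V y) q => //.
    by rewrite opprD addrACA subrr add0r -VB.
  by exists y; rewrite -{1}hy addrK.
have lb x : (1 - q) * N x <= N (x - V x).
  have := hnorm_distD hH x (V x) 0; rewrite !subr0; have := Vq x; lra.
have inj x : x - V x = 0 -> x = 0.
  move=> h; apply: (hnorm_eq0 hH); have := lb x; rewrite h (hnorm0 hH).
  by rewrite pmulr_rle0 // => h1; apply/eqP; rewrite eq_le h1 hnorm_ge0.
have WV x : W (x - V x) = x.
  apply/eqP; rewrite -subr_eq0; apply/eqP/inj.
  by rewrite VB opprD addrACA -opprD hW subrr.
have Wb x : N (W x) <= (1 - q)^-1 * N x.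
  by rewrite mulrC ler_pdivlMr // mulrC -{2}(hW x) lb.
exists W; split => //; split; last by exists (1 - q)^-1.
- by move=> x y; rewrite -[RHS]WV VD opprD addrACA !hW.
- by move=> a x; rewrite -[RHS]WV VZ -scalerBr hW.
Qed.

End Projection.


(** * Equivalent inner products *)

Section EquivalentProduct.
Variables (R : realType) (H : lmodType R[i]) (ip : H -> H -> R[i]).
Hypothesis hH : is_hilbert ip.
Local Notation N := (hnorm ip).
Local Notation rip := (real_ip ip).
Local Notation hlim := (norm_cvg ip).

Definition clinear (A : H -> H) :=
  (forall x y, A (x + y) = A x + A y) /\ (forall (a : R[i]) x, A (a *: x) = a *: A x).

Lemma clinearB A : clinear A -> forall x y, A (x - y) = A x - A y.
Proof. by move=> [AD AZ] x y; rewrite AD -scaleN1r AZ scaleN1r. Qed.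

(* Y solves Y = (A + Y^2) / 2, that is (1 - Y)^2 = 1 - A. *)
Lemma sqrt1B (A : H -> H) (q : R) : 0 <= q -> q < 1 -> clinear A ->
  (forall x, N (A x) <= q * N x) -> (forall x y, rip (A x) y = rip x (A y)) ->
  exists Y, [/\ clinear Y, forall x, N (Y x) <= q * N x, forall x y, rip (Y x) y = rip x (Y y) &
    forall x, Y (Y x) = Y x + Y x - A x].
Proof.
move=> q0 q1 hA Aq As.
pose h : R[i] := (2^-1)%:C%C.
pose F (Y : H -> H) x := h *: (A x + Y (Y x)).
pose Y n := iter n F (fun=> 0).
have YS n x : Y n.+1 x = h *: (A x + Y n (Y n x)) by [].
have Y0 x : Y 0%N x = 0 by [].
have P n : [/\ clinear (Y n), forall x, N (Y n x) <= q * N x & forall x y, rip (Y n x) y = rip x (Y n y)].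
  elim: n => [|n [[YD YZ] Yq Ysym]].
    split; first split.
    - by move=> x y; rewrite !Y0 addr0.
    - by move=> a x; rewrite !Y0 scaler0.
    - by move=> x; rewrite Y0 (hnorm0 hH) mulr_ge0 // hnorm_ge0.
    - by move=> x y; rewrite !Y0 (rip0l hH) (rip0r hH).
  split; first split.
  - by move=> x y; rewrite !YS hA.1 !YD -scalerDr addrACA.
  - by move=> a x; rewrite !YS hA.2 !YZ -scalerDr !scalerA mulrC.
  - move=> x; rewrite YS (hnormZr hH) ger0_norm ?invr_ge0 //.
    have := hnormD hH (A x) (Y n (Y n x)); have := Aq x.
    have := le_trans (Yq (Y n x)) (ler_wpM2l q0 (Yq x)).
    have : q * (q * N x) <= q * N x by rewrite ler_wpM2l // ler_piMl ?hnorm_ge0 // ltW.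
    by rewrite -[X in _ -> _ -> _ -> _ -> _ <= X]/(q * N x); lra.
  - move=> x y; rewrite !YS (ripZl hH) (ripZr hH) (ripDl hH) (ripDr hH) As !Ysym //.
(* The difference of squares is split as (Y_{n+1} - Y_n) Y_{n+1} + Y_n (Y_{n+1} - Y_n), which
   requires no commutation among the iterates. *)
have inc n x : N (Y n.+1 x - Y n x) <= q ^+ n * (q * N x).
  elim: n x => [|n IH] x.
    have [_ h1 _] := P 1%N; rewrite Y0 subr0 expr0 mul1r; exact: h1.
  rewrite YS [Y n.+1 x in X in _ - X]YS -scalerBr opprD addrACA subrr add0r.
  have [L1 b1 _] := P n.+1; have [L0 b0 _] := P n.
  rewrite (hnormZr hH) ger0_norm ?invr_ge0 // -(subrKA (Y n (Y n.+1 x))).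
  have := hnormD hH (Y n.+1 (Y n.+1 x) - Y n (Y n.+1 x)) (Y n (Y n.+1 x) - Y n (Y n x)).
  have := IH (Y n.+1 x); rewrite -(clinearB L0).
  have := le_trans (b0 (Y n.+1 x - Y n x)) (ler_wpM2l q0 (IH x)).
  have : q ^+ n * (q * N (Y n.+1 x)) <= q ^+ n * (q * (q * N x)).
    by rewrite ler_wpM2l ?exprn_ge0 // ler_wpM2l.
  rewrite exprS; lra.
have /choice[Yl hY] : forall x, exists l, hlim (fun n => Y n x) l.
  by move=> x; apply: (@hgeo_cvg _ _ _ hH _ q (q * N x)).
have Yq x : N (Yl x) <= q * N x.
  apply: (hlim_le hH (hY x) (v := fun=> q * N x)); last exact: cvg_cst.
  by move=> n; have [_ ] := P n.
exists Yl; split=> //.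
- split=> [x y|a x].
    apply: (hlim_unique hH (hY (x + y))).
    have := hlimD hH (hY x) (hY y); congr norm_cvg.
    by apply/funext => n; have [[-> _] _ _] := P n.
  apply: (hlim_unique hH (hY (a *: x))).
  have := hlimZ hH a (hY x); congr norm_cvg.
  by apply/funext => n; have [[_ ->] _ _] := P n.
- move=> x y.
  have h1 := hlim_rip hH (hY x) (hlim_cst hH y).
  have h2 := hlim_rip hH (hlim_cst hH x) (hY y).
  have e : (fun n => rip (Y n x) y) = (fun n => rip x (Y n y)).
    by apply/funext => n; have [_ _ ->] := P n.
  move: h1; rewrite e => h1.
  by rewrite -(cvg_lim (@Rhausdorff R) h1) -(cvg_lim (@Rhausdorff R) h2).
- move=> x.
  have h1 : hlim (fun n => Y n (Y n x)) (Yl (Yl x)).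
    apply: (@hlim_squeeze _ _ _ (fun n => q * N (Y n x - Yl x) + N (Y n (Yl x) - Yl (Yl x)))).
      move=> n; rewrite (le_trans (hnorm_distD hH _ (Y n (Yl x)) _)) // lerD2r.
      by have [L b _] := P n; rewrite -(clinearB L).
    rewrite -(addr0 0); apply: cvgD; last exact: hY.
    by apply: cvg0Ml; exact: hY.
  apply: (hlim_unique hH h1).
  have : hlim (fun n => Y n.+1 x + Y n.+1 x - A x) (Yl x + Yl x - A x).
    apply: (hlimB hH _ (hlim_cst hH _)).
    suff hS : hlim (fun n => Y n.+1 x) (Yl x) by exact: hlimD.
    by apply/hlimP => e /((hlimP _ _ _).1 (hY x))[K hK]; exists K => n Kn; apply: hK; apply: leqW.
  congr norm_cvg; apply/funext => n; rewrite YS -scalerDl.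
  have -> : h + h = 1 by rewrite /h -rmorphD /= (_ : 2^-1 + 2^-1 = 1) //; field.
  by rewrite scale1r addrAC subrr add0r.
Qed.

(** Riesz represents [ip2] by a positive operator S. A small multiple k S equals 1 - A with A a
    strict contraction, so 1 - Y from [sqrt1B] is a square root of k S, and |x - Y x|^2 = <k S x,
    x>. It is invertible by [neumann_inverse]. *)
Lemma equivalent_product (ip2 : H -> H -> R[i]) (c C : R) : is_hilbert ip2 ->
  0 < c -> 0 < C -> (forall x, c * N x <= hnorm ip2 x) -> (forall x, hnorm ip2 x <= C * N x) ->
  exists Rm Ri k, [/\ bounded_op ip Rm /\ bounded_op ip Ri, forall x, Rm (Ri x) = x,
    forall x, Ri (Rm x) = x, 0 < k & forall x, N (Rm x) = k * hnorm ip2 x].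
Proof.
move=> hH2 c0 C0 hc hC.
have /choice[S hS] : forall x, exists s, forall y, ip2 y x = ip y s.
  move=> x; apply: (@riesz _ _ _ hH _ (C * (C * N x))).
  - by move=> y z; rewrite (ipDl hH2).
  - by move=> a y; rewrite (ipZl hH2).
  - move=> y; rewrite (le_trans (ip_cs hH2 _ _)) //.
    rewrite (_ : C * (C * N x) * N y = (C * N y) * (C * N x)); last by ring.
    by rewrite ler_pM ?hnorm_ge0.
have ripS x y : rip (S x) y = real_ip ip2 x y.
  by rewrite (ripC hH) /real_ip -hS -/(real_ip ip2 y x) (ripC hH2).
have SL : clinear S.
  split=> [x y|a x]; apply: (ip_ext hH) => z; rewrite (ip_conj_sym hH) [RHS](ip_conj_sym hH); congr (_^*).
    by rewrite (ipDr hH) -!hS (ipDr hH2).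
  by rewrite (ipZr hH) -!hS (ipZr hH2).
have Sb x : N (S x) <= C ^+ 2 * N x.
  have [->|n0] := eqVneq (N (S x)) 0; first by rewrite mulr_ge0 ?hnorm_ge0 // exprn_ge0 // ltW.
  rewrite -(@ler_pM2l _ (N (S x))) ?lt_def ?n0 ?hnorm_ge0 // -expr2 (hnorm_sq hH) ripS.
  rewrite (le_trans (rip_le hH2 _ _)) // (_ : N (S x) * (C ^+ 2 * N x) = (C * N x) * (C * N (S x))); last by ring.
  by rewrite ler_pM ?hnorm_ge0.
have SC : 0 < C ^+ 4 + c ^+ 4 by rewrite addr_gt0 // exprn_gt0.
(* C^4 in the denominator lets k |S x|^2 be absorbed by |x|_2^2, giving |A x|^2 <= (1 - k c^2)
   |x|^2; c^4 keeps 1 - k c^2 nonnegative. *)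
pose k := c ^+ 2 / (C ^+ 4 + c ^+ 4).
have k0 : 0 < k by rewrite divr_gt0 // exprn_gt0.
have kC : k * C ^+ 4 <= c ^+ 2.
  rewrite /k mulrAC ler_pdivrMr // ler_pM2l ?exprn_gt0 // lerDl exprn_ge0 // ltW //.
have kc : k * c ^+ 2 <= 1.
  rewrite /k mulrAC ler_pdivrMr // mul1r -exprD lerDr exprn_ge0 // ltW //.
pose A x := x - k%:C%C *: S x.
pose q := Num.sqrt (1 - k * c ^+ 2).
have q0 : 0 <= q by exact: sqrtr_ge0.
have q1 : q < 1.
  rewrite -(ltr_pXn2r (n := 2)) ?nnegrE // sqr_sqrtr ?subr_ge0 // expr1n.
  by rewrite ltrBlDr ltrDl mulr_gt0 // exprn_gt0.
have AL : clinear A.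
  split=> [x y|a x]; rewrite /A; first by rewrite SL.1 scalerDr opprD addrACA.
  by rewrite SL.2 scalerBr !scalerA mulrC.
have Aq x : N (A x) <= q * N x.
  apply: hnorm_le_sq; first by rewrite mulr_ge0 // hnorm_ge0.
  rewrite exprMn [q ^+ 2]sqr_sqrtr ?subr_ge0 // /A (hnormB_sq hH) (hnormZr hH) (ripZr hH) (ripC hH) ripS -(hnorm_sq hH2).
  rewrite exprMn real_normK ?num_real //.
  have h1 : c ^+ 2 * N x ^+ 2 <= hnorm ip2 x ^+ 2.
    by rewrite -exprMn ler_pXn2r // nnegrE ?hnorm_ge0 // mulr_ge0 ?hnorm_ge0 // ltW.
  have h2 : N (S x) ^+ 2 <= C ^+ 4 * N x ^+ 2.
    rewrite (_ : C ^+ 4 = (C ^+ 2) ^+ 2); last by rewrite -exprM.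
    by rewrite -exprMn ler_pXn2r // nnegrE ?hnorm_ge0 // mulr_ge0 ?hnorm_ge0 // exprn_ge0 // ltW.
  have h3 : k * (k * N (S x) ^+ 2) <= k * (c ^+ 2 * N x ^+ 2).
    rewrite ler_pM2l // (le_trans (ler_wpM2l (ltW k0) h2)) // mulrA ler_wpM2r // sqr_ge0 //.
  have := ler_wpM2l (ltW k0) h1; rewrite expr2; lra.
have As x y : rip (A x) y = rip x (A y).
  by rewrite /A (ripBl hH) (ripBr hH) (ripZl hH) (ripZr hH) (ripC hH x (S y)) !ripS (ripC hH2).
have [Y [[YD YZ] Yq Ys YY]] := sqrt1B q0 q1 AL Aq As.
have [W [Wb W1 W2 _]] := neumann_inverse hH q0 q1 YD YZ Yq.
exists (fun x => x - Y x), W, (Num.sqrt k); split=> //.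
- split=> //; split=> [x y|a x|]; first by rewrite YD opprD addrACA.
    by rewrite YZ scalerBr.
  exists (1 + q) => x; rewrite (le_trans (hnormB hH _ _)) //; have := Yq x; lra.
- by rewrite sqrtr_gt0.
- move=> x; apply: (pexpIrn (n := 2)) => //; rewrite ?nnegrE ?hnorm_ge0 ?mulr_ge0 ?hnorm_ge0 ?sqrtr_ge0 //.
  rewrite exprMn [Num.sqrt k ^+ 2]sqr_sqrtr ?(ltW k0) // (hnormB_sq hH) [in X in _ + X](hnorm_sq hH) Ys YY (ripBr hH).
  rewrite (ripDr hH) /A (ripBr hH) (ripZr hH).
  rewrite (ripC hH x (S x)) ripS -(hnorm_sq hH2) -(hnorm_sq hH); ring.
Qed.
End EquivalentProduct.


(** * Resolvents and maximal skew operators *)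

Section RightLimit.
Variable R : realType.

Lemma cvg_right0P (f : R -> R) : (f t @[t --> 0^'+] --> 0) <->
  forall e, 0 < e -> exists2 d, 0 < d & forall t, 0 < t -> t < d -> `|f t| < e.
Proof.
split=> [/cvgrPdist_lt h e e0|h].
  have [d /= d0 hd] := h e e0; exists d => // t t0 td.
  by have := hd t; rewrite /= !sub0r !normrN; apply => //; rewrite gtr0_norm.
apply/cvgrPdist_lt => e /h[d d0 hd]; exists d => //= t /=.
by rewrite !sub0r !normrN => td t0; apply: hd => //; exact: le_lt_trans (ler_norm _) td.
Qed.

End RightLimit.

Section Resolvent.
Variables (R : realType) (H : lmodType R[i]) (ip : H -> H -> R[i]).
Hypothesis hH : is_hilbert ip.
Local Notation N := (hnorm ip).
Local Notation rip := (real_ip ip).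
Local Notation hlim := (norm_cvg ip).
Variables (D : set H) (E : H -> H).
Hypothesis hE : linear_operator D E.
Local Notation res := (resolvent D E).
Local Notation rho := (in_resolvent_set ip D E).

Lemma dom0 : D 0. Proof. by have [] := hE. Qed.
Lemma domD x y : D x -> D y -> D (x + y). Proof. by have [_ h _ _ _] := hE; exact: h. Qed.
Lemma domZ a x : D x -> D (a *: x). Proof. by have [_ _ h _ _] := hE; exact: h. Qed.
Lemma opD x y : D x -> D y -> E (x + y) = E x + E y. Proof. by have [_ _ _ h _] := hE; exact: h. Qed.
Lemma opZ a x : D x -> E (a *: x) = a *: E x. Proof. by have [_ _ _ _ h] := hE; exact: h. Qed.
Lemma domN x : D x -> D (- x). Proof. by rewrite -scaleN1r; exact: domZ. Qed.
Lemma domB x y : D x -> D y -> D (x - y). Proof. by move=> hx /domN; exact: domD. Qed.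
Lemma opN x : D x -> E (- x) = - E x. Proof. by move=> Dx; rewrite -scaleN1r opZ // scaleN1r. Qed.
Lemma opB x y : D x -> D y -> E (x - y) = E x - E y.
Proof. by move=> hx hy; rewrite opD ?opN //; exact: domN. Qed.

(** [resolvent] is a choice with default 0; the inverse supplied by [rho z] shows that there is
    something to choose. *)
Lemma resP z h : rho z -> D (res z h) /\ z *: res z h - E (res z h) = h.
Proof.
move=> [Rl [_ h1 _]].
exact: (@xgetPex _ 0 [set y | D y /\ z *: y - E y = h] (ex_intro _ (Rl h) (h1 h))).
Qed.

Lemma resK z x : rho z -> D x -> res z (z *: x - E x) = x.
Proof.
move=> hz; have [Rl [_ _ h2]] := hz; move=> Dx.
have [D1 E1] := resP (z *: x - E x) hz.
by rewrite -[LHS]h2 // E1 h2.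
Qed.

Lemma res_linear z : rho z -> clinear (res z).
Proof.
move=> hz; split=> [x y|a x].
  have [D1 E1] := resP x hz; have [D2 E2] := resP y hz.
  rewrite -[RHS](resK hz); last exact: domD.
  by rewrite opD // scalerDr opprD addrACA E1 E2.
have [D1 E1] := resP x hz.
rewrite -[RHS](resK hz); last exact: domZ.
by rewrite opZ // !scalerA mulrC -scalerA -scalerBr E1.
Qed.

Lemma res_dom z x : rho z -> D (res z x). Proof. by move=> /(resP x)[]. Qed.
Lemma res_eq z x : rho z -> z *: res z x - E (res z x) = x. Proof. by move=> /(resP x)[]. Qed.
Lemma op_res z x : rho z -> E (res z x) = z *: res z x - x.
Proof. by move=> /(resP x)[_ h]; rewrite -[in X in _ - X]h opprB addrC subrK. Qed.

Lemma res_op z x : rho z -> D x -> res z (E x) = z *: res z x - x.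
Proof.
move=> hz Dx; have := resK hz Dx; rewrite (clinearB (res_linear hz)) (res_linear hz).2 => h.
by rewrite -[in X in _ - X]h opprB addrC subrK.
Qed.

Lemma res_comm_op z x : rho z -> D x -> E (res z x) = res z (E x).
Proof. by move=> hz Dx; rewrite res_op // op_res. Qed.

Lemma res_identity a b x : rho a -> rho b ->
  res a x = res b x + (b - a) *: res a (res b x).
Proof.
move=> ha hb; have Dy := res_dom x hb.
have e : a *: res b x - E (res b x) = x + (a - b) *: res b x.
  by rewrite -[X in _ = X + _](res_eq x hb) [RHS]addrC scalerBl subrKA.
have := resK ha Dy; rewrite e (res_linear ha).1 (res_linear ha).2 => h.
by rewrite -[X in _ = X + _]h -addrA -scalerDl addrA subrK subrr scale0r addr0.
Qed.

End Resolvent.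

Section MaxSkew.
Variables (R : realType) (H : lmodType R[i]) (ip : H -> H -> R[i]).
Hypothesis hH : is_hilbert ip.
Local Notation N := (hnorm ip).
Local Notation rip := (real_ip ip).
Local Notation hlim := (norm_cvg ip).

(** This describes the generators of isometry semigroups. Nothing is asked of the left half-plane,
    so [E] need not be skew-adjoint. *)
Definition maxskew (D : set H) (E : H -> H) :=
  [/\ linear_operator D E, (forall x, D x -> rip x (E x) = 0) &
    forall z, 0 < complex.Re z -> forall h, exists x, D x /\ z *: x - E x = h].

Variables (D : set H) (E : H -> H).
Hypothesis hm : maxskew D E.
Local Notation res := (resolvent D E).
Local Notation rho := (in_resolvent_set ip D E).

Let hE : linear_operator D E. Proof. by have [] := hm. Qed.
Let skew x : D x -> rip x (E x) = 0. Proof. by have [_ h _] := hm; exact: h. Qed.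

Lemma rip_scale z x : rip x (z *: x) = complex.Re z * N x ^+ 2.
Proof.
rewrite (hnorm_sq hH); case: z => a b; rewrite complex_scaleE (ripDr hH) !(ripZr hH) /=.
have -> : rip x ('i%C *: x) = 0 by have := ripil hH x x; rewrite (ripC hH); lra.
by rewrite mulr0 addr0.
Qed.

Lemma difference_quotientE t (u y : H) : 0 < t ->
  N (t^-1%:C%C *: u - y) = t^-1 * N (u - t%:C%C *: y).
Proof.
move=> t0; rewrite -[t^-1 in RHS]gtr0_norm ?invr_gt0 // -(hnormZr hH) [in RHS]scalerBr.
by rewrite [in RHS]scalerA -rmorphM mulVf ?gt_eqF // rmorph1 scale1r.
Qed.

(** Pair z x - y with x: only Re z |x|^2 survives. *)
Lemma skew_lower z x y : rip x y = 0 -> complex.Re z * N x <= N (z *: x - y).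
Proof.
move=> xy; have [->|n0] := eqVneq (N x) 0; first by rewrite mulr0 hnorm_ge0.
rewrite -(@ler_pM2r _ (N x)) ?lt_def ?n0 ?hnorm_ge0 // -mulrA -expr2 -rip_scale mulrC.
have := rip_le hH x (z *: x - y); by rewrite (ripBr hH) xy // subr0.
Qed.

Lemma maxskew_lower z x : D x -> complex.Re z * N x <= N (z *: x - E x).
Proof. by move=> Dx; apply: skew_lower; exact: skew. Qed.

Lemma maxskew_rho z : 0 < complex.Re z -> rho z.
Proof.
move=> z0; have [_ _ hs] := hm; have /choice[Rl hR] := hs z z0.
have inj x y : D x -> D y -> z *: x - E x = z *: y - E y -> x = y.
  move=> Dx Dy e; apply/eqP; rewrite -subr_eq0; apply/eqP/(hnorm_eq0 hH).
  have := maxskew_lower z (domB hE Dx Dy).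
  rewrite (opB hE) // scalerBr opprD addrACA -opprD e subrr (hnorm0 hH).
  by rewrite pmulr_rle0 // => h; apply/eqP; rewrite eq_le h hnorm_ge0.
exists Rl; split=> //.
- split=> [x y|a x|].
  + have [D1 E1] := hR x; have [D2 E2] := hR y; have [D3 E3] := hR (x + y).
    apply: inj => //; first exact: (domD hE).
    by rewrite E3 (opD hE) // scalerDr opprD addrACA E1 E2.
  + have [D1 E1] := hR x; have [D3 E3] := hR (a *: x).
    apply: inj => //; first exact: (domZ hE).
    by rewrite E3 (opZ hE) // !scalerA mulrC -scalerA -scalerBr E1.
  + exists (complex.Re z)^-1 => x; have [D1 E1] := hR x.
    by rewrite mulrC ler_pdivlMr // mulrC -{2}E1 maxskew_lower.
- by move=> x Dx; have [D1 E1] := hR (z *: x - E x); exact: inj.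
Qed.

Lemma maxskew_res_le z x : 0 < complex.Re z -> N (res z x) <= (complex.Re z)^-1 * N x.
Proof.
move=> z0; have hz := maxskew_rho z0.
by rewrite mulrC ler_pdivlMr // mulrC -{2}(res_eq x hz) maxskew_lower //; exact: res_dom hz.
Qed.

(** If w is orthogonal to the domain and x = (1 - E)^-1 w, then 0 = <x, w> = <x, x - E x> has real
    part |x|^2, hence x = 0 and w = 0. *)
Lemma maxskew_dense y : exists k : nat -> H, (forall n, D (k n)) /\ hlim k y.
Proof.
have [z [k [kD kz zo]]] := hprojection hH y (dom0 hE) (domD hE) (domZ hE).
exists k; split=> //; suff -> : y = z by [].
apply/eqP; rewrite -subr_eq0; apply/eqP; set w := y - z in zo *.
have h1 : rho 1 by apply: maxskew_rho; rewrite /= ltr01.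
have Dx := res_dom w h1.
have := zo _ Dx; rewrite -{2}(res_eq w h1) => /(congr1 (@complex.Re _)).
rewrite -/(rip _ _) (ripBr hH) skew // subr0 scale1r => /(rip_eq0 hH) e.
by rewrite -(res_eq w h1) e scale1r -(scale0r 0) (opZ hE) ?scale0r ?subr0 //; exact: (dom0 hE).
Qed.

Lemma maxskew_dense_lt y e : 0 < e -> exists2 x, D x & N (y - x) < e.
Proof.
move=> e0; have [k [kD /hlimP/(_ e e0)[K hK]]] := maxskew_dense y.
by exists (k K) => //; rewrite (hnormC hH) hK.
Qed.

End MaxSkew.


(** * Generation: the implicit Euler scheme *)

Section Implicit_Euler.
Variables (R : realType) (H : lmodType R[i]) (ip : H -> H -> R[i]).
Hypothesis hH : is_hilbert ip.
Local Notation N := (hnorm ip).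
Local Notation rip := (real_ip ip).
Local Notation hlim := (norm_cvg ip).
Variables (D : set H) (E : H -> H).
Hypothesis hm : maxskew ip D E.
Local Notation res := (resolvent D E).
Local Notation rho := (in_resolvent_set ip D E).

Let hE : linear_operator D E. Proof. by have [] := hm. Qed.
Let skew x : D x -> rip x (E x) = 0. Proof. by have [_ h _] := hm; exact: h. Qed.

(** This is (1 - h E)^-1, one implicit Euler step of length h, written through the resolvent at 1 /
    h. *)
Definition euler (h : R) (x : H) := (h^-1)%:C%C *: res (h^-1)%:C%C x.
Local Notation F := euler.

Section step.
Variable h : R.
Hypothesis h0 : 0 < h.

Lemma step_rho : rho (h^-1)%:C%C.
Proof. by apply: (maxskew_rho hH hm); rewrite /= invr_gt0. Qed.
Let hr := step_rho.

Lemma step_scale (x : H) : h%:C%C *: ((h^-1)%:C%C *: x) = x.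
Proof. by rewrite scalerA -rmorphM divff ?rmorph1 ?scale1r // gt_eqF. Qed.

Lemma euler_linear : clinear (F h).
Proof.
have [lD lZ] := res_linear hE hr; split=> [x y|a x]; first by rewrite /F lD scalerDr.
by rewrite /F lZ !scalerA mulrC.
Qed.
Lemma euler_dom x : D (F h x). Proof. by apply: (domZ hE); exact: res_dom hr. Qed.
Lemma euler_le x : N (F h x) <= N x.
Proof.
rewrite /F (hnormZr hH) gtr0_norm ?invr_gt0 //.
have := maxskew_res_le hH hm x (z := (h^-1)%:C%C); rewrite /= invr_gt0 invrK => /(_ h0) h1.
have h2 : 0 <= h^-1 by rewrite invr_ge0 ltW.
by rewrite (le_trans (ler_wpM2l h2 h1)) // mulrA mulVf ?mul1r // gt_eqF.
Qed.
Lemma euler_eq x : F h x - x = h%:C%C *: E (F h x).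
Proof.
rewrite /F (opZ hE); last exact: res_dom hr.
by rewrite (op_res x hr) step_scale.
Qed.
Lemma euler_op x : D x -> E (F h x) = F h (E x).
Proof.
move=> Dx; rewrite /F (opZ hE); last exact: res_dom hr.
by rewrite (res_comm_op hE hr).
Qed.
Lemma eulerK x : D x -> F h (x - h%:C%C *: E x) = x.
Proof.
move=> Dx; rewrite -[RHS](resK hr Dx) /F -(res_linear hE hr).2 scalerBr; congr (res _ (_ - _)).
by rewrite scalerA -rmorphM mulVf ?rmorph1 ?scale1r // gt_eqF.
Qed.
Lemma euler_sub x : D x -> N (F h x - x) <= h * N (E x).
Proof.
move=> Dx; rewrite euler_eq (hnormZr hH) gtr0_norm // euler_op // ler_pM2l //; exact: euler_le.
Qed.
(** Skewness makes F x orthogonal to the increment F x - x = h E (F x). This exact energy balance is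
    the source of the isometry property. *)
Lemma euler_sq x : N x ^+ 2 = N (F h x) ^+ 2 + N (F h x - x) ^+ 2.
Proof.
have e : rip (F h x) (F h x - x) = 0.
  by rewrite euler_eq (ripZr hH) skew ?mulr0 //; exact: euler_dom.
rewrite [LHS](_ : _ = N (F h x - (F h x - x)) ^+ 2); last by rewrite opprB addrC subrK.
by rewrite (hnormB_sq hH) e; ring.
Qed.
End step.

Lemma euler_double h x : 0 < h -> D x ->
  F (2 * h) x - F h x = F h (F (2 * h) (h%:C%C *: E x)).
Proof.
move=> h0 Dx; have h2 : 0 < 2 * h by lra.
have Dg := euler_dom h2 x.
rewrite -[in X in X - _](eulerK h0 Dg) -(clinearB (euler_linear h0)); congr (F h _).
rewrite (euler_linear h2).2 -(euler_op h2 Dx).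
rewrite addrAC (euler_eq h2) -scalerBl -rmorphB; congr (_%:C%C *: _); ring.
Qed.

(** Local error of two steps h against one step 2 h. Using [euler_double] twice writes it as three
    contractions applied to h^2 E (E x). *)
Lemma euler_diff h x : 0 < h -> D x -> D (E x) ->
  N (F h (F h x) - F (2 * h) x) <= h ^+ 2 * N (E (E x)).
Proof.
move=> h0 Dx DEx; have h2 : 0 < 2 * h by lra.
have FB := clinearB (euler_linear h0).
have -> : F h (F h x) - F (2 * h) x =
    - F h (F h (F (2 * h) (h%:C%C *: E (h%:C%C *: E x)))).
  rewrite -euler_double //; last exact: (domZ hE).
  rewrite FB opprB.
  have -> : F h (F h (h%:C%C *: E x)) = F h (F h x) - F h x.
    by rewrite -FB euler_eq // euler_op // (euler_linear h0).2.
  by rewrite -euler_double // opprB addrA subrK.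
rewrite (hnormN hH) (le_trans (euler_le h0 _)) // (le_trans (euler_le h0 _)) //.
rewrite (le_trans (euler_le h2 _)) // (opZ hE) // scalerA (hnormZ hH) -rmorphM normc_real.
by rewrite -expr2 ger0_norm ?exprn_ge0 // ltW.
Qed.
End Implicit_Euler.

(** * Iterated Euler steps on dyadic grids *)

Section Iterates.
Variables (R : realType) (H : lmodType R[i]) (ip : H -> H -> R[i]).
Hypothesis hH : is_hilbert ip.
Local Notation N := (hnorm ip).
Local Notation rip := (real_ip ip).
Local Notation hlim := (norm_cvg ip).
Variables (D : set H) (E : H -> H).
Hypothesis hm : maxskew ip D E.
Local Notation F := (euler D E).

Let hE : linear_operator D E. Proof. by have [] := hm. Qed.

Definition eulern (h : R) (m : nat) (x : H) := iter m (F h) x.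
Local Notation I := eulern.

Lemma eulernS h m x : I h m.+1 x = F h (I h m x). Proof. by []. Qed.
Lemma eulernD h m n x : I h (m + n) x = I h m (I h n x).
Proof. by rewrite /I iterD. Qed.

Section step.
Variable h : R.
Hypothesis h0 : 0 < h.
Let FL := euler_linear hH hm h0.
Let FB := clinearB FL.

Lemma eulern_linear m : clinear (I h m).
Proof.
split=> [x y|a x]; elim: m => [|m IH] //; rewrite !eulernS IH.
  exact: FL.1.
exact: FL.2.
Qed.
Lemma eulern_le m x : N (I h m x) <= N x.
Proof. by elim: m => [|m IH] //; apply: le_trans IH; exact: euler_le. Qed.
Lemma eulern_lip m x y : N (I h m x - I h m y) <= N (x - y).
Proof. by rewrite -(clinearB (eulern_linear m)) eulern_le. Qed.
Lemma eulern_dom m x : D x -> D (I h m x).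
Proof. by case: m => // m _; apply: (euler_dom hH hm). Qed.
Lemma eulern_op m x : D x -> E (I h m x) = I h m (E x).
Proof.
move=> Dx; elim: m => [|m IH] //.
by rewrite !eulernS (euler_op hH hm h0) ?IH //; exact: eulern_dom.
Qed.

Lemma eulern_sub m x : D x -> N (I h m x - x) <= m%:R * h * N (E x).
Proof.
move=> Dx; elim: m => [|m IH]; first by rewrite subrr (hnorm0 hH) !mul0r.
rewrite eulernS (le_trans (hnorm_distD hH _ (I h m x) _)) // -natr1.
have := euler_sub hH hm h0 (eulern_dom m Dx); rewrite eulern_op // => h1.
have := ler_wpM2l (ltW h0) (eulern_le m (E x)); lra.
Qed.

(** Each step loses at most h^2 |E x|^2 of the squared norm; with m h <= t the total loss is O(h)
    and vanishes in the limit. *)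
Lemma eulern_sq m x : D x -> N x ^+ 2 <= N (I h m x) ^+ 2 + m%:R * h ^+ 2 * N (E x) ^+ 2.
Proof.
move=> Dx; elim: m => [|m IH]; first by rewrite !mul0r addr0.
rewrite (le_trans IH) // (euler_sq hH hm h0 (I h m x)) -eulernS -addrA lerD2l -natr1.
have : N (I h m.+1 x - I h m x) ^+ 2 <= h ^+ 2 * N (E x) ^+ 2.
  rewrite -exprMn ler_pXn2r ?nnegrE ?hnorm_ge0 // ?mulr_ge0 ?hnorm_ge0 ?(ltW h0) //.
  rewrite (le_trans (euler_sub hH hm h0 (eulern_dom m Dx))) // eulern_op //.
  by rewrite ler_pM2l // eulern_le.
lra.
Qed.

(** [E x] need not lie in the domain, so its variation along the scheme is controlled through a
    nearby [z] that does. *)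
Lemma eulern_der m x z : D x -> D z ->
  N (I h m x - x - (m%:R * h)%:C%C *: E x) <=
  m%:R * h * (2 * N (E x - z) + m%:R * h * N (E z)).
Proof.
move=> Dx Dz; elim: m => [|m IH]; first by rewrite subrr !mul0r scale0r subr0 (hnorm0 hH).
have e : I h m.+1 x - x - (m.+1%:R * h)%:C%C *: E x =
   (I h m x - x - (m%:R * h)%:C%C *: E x) + h%:C%C *: (I h m.+1 (E x) - E x).
  rewrite scalerBr -(eulern_op _ Dx) eulernS -(euler_eq hH hm h0) -eulernS.
  rewrite -natr1 mulrDl mul1r rmorphD scalerDl.
  by rewrite [RHS]addrACA -opprD [X in _ = X + _]addrC subrKA.
rewrite e (le_trans (hnormD hH _ _)) // (hnormZr hH) gtr0_norm //.
have h1 : N (I h m.+1 (E x) - E x) <= 2 * N (E x - z) + m.+1%:R * h * N (E z).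
  have := hnorm_distD hH (I h m.+1 (E x)) (I h m.+1 z) (E x).
  have := hnorm_distD hH (I h m.+1 z) z (E x).
  have := eulern_lip m.+1 (E x) z; have := eulern_sub m.+1 Dz; rewrite (hnormC hH z); lra.
have h2 := ler_wpM2l (ltW h0) h1.
have m0 : 0 <= m%:R :> R by [].
have : m%:R * h * (m%:R * h * N (E z)) <= m%:R * h * ((m%:R + 1) * h * N (E z)).
  rewrite ler_wpM2l ?mulr_ge0 ?(ltW h0) // ler_wpM2r ?hnorm_ge0 // ler_wpM2r ?(ltW h0) //; lra.
move: h2 IH; rewrite -natr1; lra.
Qed.
End step.

Lemma eulern_double h m x : 0 < h -> D x -> D (E x) ->
  N (I h m.*2 x - I (2 * h) m x) <= m%:R * h ^+ 2 * N (E (E x)).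
Proof.
move=> h0 Dx DEx; have h2 : 0 < 2 * h by lra.
elim: m => [|m IH]; first by rewrite subrr (hnorm0 hH) !mul0r.
rewrite doubleS !eulernS (le_trans (hnorm_distD hH _ (F h (F h (I (2 * h) m x))) _)) //.
have FB := clinearB (euler_linear hH hm h0).
rewrite -!FB -natr1.
have := euler_diff hH hm h0 (eulern_dom h2 m Dx).
rewrite (eulern_op h2) // (eulern_op h2) // => /(_ (eulern_dom h2 m DEx)).
have := ler_wpM2l (exprn_ge0 2 (ltW h0)) (eulern_le h2 m (E (E x))).
have := le_trans (euler_le hH hm h0 _) (euler_le hH hm h0 (I h m.*2 x - I (2 * h) m x)).
lra.
Qed.

Definition dyadic k : R := (2^-1) ^+ k.
(** The number of full steps of length 2^-k before time t. Halving the step makes consecutive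
    approximations comparable by [eulern_double]. *)
Definition dcount (t : R) k := Num.truncn (t * 2 ^+ k).

Lemma dyadic_gt0 k : 0 < dyadic k. Proof. by rewrite exprn_gt0. Qed.
Lemma dyadic_cvg0 : dyadic k @[k --> \oo] --> 0.
Proof. by apply: cvg_expr; rewrite ger0_norm // invf_lt1 // ltr1n. Qed.
Lemma pow_dyadic k : 2 ^+ k * dyadic k = 1.
Proof. by rewrite /dyadic -exprMn divff // expr1n. Qed.

Lemma dcount_itv t k : 0 <= t ->
  (dcount t k)%:R * dyadic k <= t /\ t < (dcount t k)%:R * dyadic k + dyadic k.
Proof.
move=> t0; have t1 : 0 <= t * 2 ^+ k by rewrite mulr_ge0 // exprn_ge0.
have /andP[h1 h2] := truncn_itv t1; have d0 := dyadic_gt0 k.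
have := ler_wpM2r (ltW d0) h1; rewrite -mulrA pow_dyadic mulr1.
have : t * 2 ^+ k * dyadic k < (Num.truncn (t * 2 ^+ k)).+1%:R * dyadic k by rewrite ltr_pM2r.
by rewrite -mulrA pow_dyadic mulr1 -natr1 mulrDl mul1r => -> ->.
Qed.

(** The boolean is the next binary digit of [t]. *)
Lemma dcountS t k : 0 <= t -> exists b : bool, dcount t k.+1 = ((dcount t k).*2 + b)%N.
Proof.
move=> t0; have t1 : 0 <= t * 2 ^+ k by rewrite mulr_ge0 // exprn_ge0.
have t2 : 0 <= t * 2 ^+ k.+1 by rewrite mulr_ge0 // exprn_ge0.
have /andP[h1 h2] := truncn_itv t1; have /andP[h3 h4] := truncn_itv t2.
move: h1 h2 h3 h4; rewrite -/(dcount t k) -/(dcount t k.+1) exprS mulrCA -!natr1.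
set a := dcount t k; set b := dcount t k.+1; set s := t * 2 ^+ k => h1 h2 h3 h4.
have l1 : (a.*2 <= b)%N.
  by rewrite -ltnS -(ltr_nat R) -natr1 -muln2 natrM; lra.
have l2 : (b < a.*2.+2)%N.
  by rewrite -(ltr_nat R) -!natr1 -muln2 natrM; lra.
exists (b != a.*2); have [->|n] := eqVneq b a.*2; first by rewrite addn0.
rewrite addn1; apply/eqP; rewrite eqn_leq.
by rewrite -ltnS l2 /= ltn_neqAle eq_sym n.
Qed.

(** The boolean is the carry from the two fractional parts. *)
Lemma dcountD s t k : 0 <= s -> 0 <= t ->
  exists b : bool, dcount (s + t) k = (dcount s k + dcount t k + b)%N.
Proof.
move=> s0 t0; have st0 : 0 <= s + t by rewrite addr_ge0.
have s1 : 0 <= s * 2 ^+ k by rewrite mulr_ge0 // exprn_ge0.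
have t1 : 0 <= t * 2 ^+ k by rewrite mulr_ge0 // exprn_ge0.
have st1 : 0 <= (s + t) * 2 ^+ k by rewrite mulr_ge0 // exprn_ge0.
have /andP[] := truncn_itv s1; have /andP[] := truncn_itv t1; have /andP[] := truncn_itv st1.
rewrite -/(dcount s k) -/(dcount t k) -/(dcount (s + t) k) mulrDl -!natr1.
set a := dcount s k; set b := dcount t k; set c := dcount _ k.
set x := s * _; set y := t * _ => h1 h2 h3 h4 h5 h6.
have l1 : (a + b <= c)%N.
  by rewrite -ltnS -(ltr_nat R) -natr1 natrD; lra.
have l2 : (c < (a + b).+2)%N.
  by rewrite -(ltr_nat R) -!natr1 natrD; lra.
exists (c != a + b)%N; have [->|n] := eqVneq c (a + b)%N; first by rewrite addn0.
rewrite addn1; apply/eqP; rewrite eqn_leq.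
by rewrite -ltnS l2 /= ltn_neqAle eq_sym n.
Qed.

Definition dstep t k x := I (dyadic k) (dcount t k) x.

(** Refining the grid costs the doubling error, at most t 2^-k |E (E x)| / 4, and possibly one more
    short step, at most 2^-(k+1) |E x|. Both are summable. *)
Lemma dstep_cvg2 t x : 0 <= t -> D x -> D (E x) -> exists l, hlim (fun k => dstep t k x) l.
Proof.
move=> t0 Dx DEx; apply: (@hgeo_cvg _ _ _ hH _ (2^-1) (N (E x) + t * N (E (E x)))) => //.
  by rewrite invf_lt1 // ltr1n.
move=> k; have [b hb] := dcountS k t0; rewrite /dstep hb -/(dyadic k).
set m := dcount t k; have d0 := dyadic_gt0 k; have d1 := dyadic_gt0 k.+1.
have e2 : 2 * dyadic k.+1 = dyadic k by rewrite /dyadic exprS mulrA divff // mul1r.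
have h1 := eulern_double m d1 Dx DEx; rewrite e2 in h1.
have h2 : N (I (dyadic k.+1) (m.*2 + b) x - I (dyadic k.+1) m.*2 x) <= dyadic k.+1 * N (E x).
  rewrite eulernD -(clinearB (eulern_linear d1 _)) (le_trans (eulern_le d1 _ _)) //.
  rewrite (le_trans (eulern_sub d1 _ Dx)) // ler_wpM2r ?hnorm_ge0 // ler_piMl ?(ltW d1) //.
  by rewrite lern1; case: b {hb}.
rewrite (le_trans (hnorm_distD hH _ (I (dyadic k.+1) m.*2 x) _)) // (le_trans (lerD h2 h1)) // mulrDr.
apply: lerD; first by rewrite ler_wpM2r ?hnorm_ge0 //; lra.
rewrite [leRHS]mulrA ler_wpM2r ?hnorm_ge0 //.
have [h3 _] := dcount_itv k t0.
have h4 := ler_wpM2r (ltW d0) h3; rewrite -/m in h4.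
have -> : dyadic k.+1 ^+ 2 = dyadic k ^+ 2 / 4 by rewrite -e2; field.
have d2 : 0 <= m%:R * dyadic k ^+ 2 by rewrite mulr_ge0 // sqr_ge0.
by rewrite mulrA ler_pdivrMr //; move: d2 h4; rewrite expr2; lra.
Qed.
End Iterates.

(** * The limit semigroup and its generator *)

Section Generation.
Variables (R : realType) (H : lmodType R[i]) (ip : H -> H -> R[i]).
Hypothesis hH : is_hilbert ip.
Local Notation N := (hnorm ip).
Local Notation rip := (real_ip ip).
Local Notation hlim := (norm_cvg ip).
Variables (D : set H) (E : H -> H).
Hypothesis hm : maxskew ip D E.
Local Notation F := (euler D E).
Local Notation I := (eulern D E).
Local Notation A := (dstep D E).

Let hE : linear_operator D E. Proof. by have [] := hm. Qed.
Let skew x : D x -> rip x (E x) = 0. Proof. by have [_ h _] := hm; exact: h. Qed.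

(** An Euler step smooths: E (F h x) = F h (E x) lies in the domain again, and F h x tends to x with
    h. *)
Lemma maxskew_dense2_lt y e : 0 < e -> exists x, [/\ D x, D (E x) & N (y - x) < e].
Proof.
move=> e0; have e2 : 0 < e / 2 by lra.
have [x Dx hx] := maxskew_dense_lt hH hm y e2.
pose h := e / 2 / (N (E x) + 1); have n1 : 0 < N (E x) + 1 by have := hnorm_ge0 ip (E x); lra.
have h0 : 0 < h by rewrite divr_gt0.
exists (F h x); split.
- exact: (euler_dom hH hm).
- by rewrite (euler_op hH hm) //; exact: (euler_dom hH hm).
- have h1 := euler_sub hH hm h0 Dx.
  have h2 : h * N (E x) <= e / 2 by rewrite /h mulrAC ler_pdivrMr // ler_pM2l //; lra.
  by have := hnorm_distD hH y x (F h x); rewrite (hnormC hH x); lra.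
Qed.

Lemma dstep_lip t k x y : N (A t k x - A t k y) <= N (x - y).
Proof. exact: (eulern_lip hH hm (dyadic_gt0 R k)). Qed.
Lemma dstep_le t k x : N (A t k x) <= N x.
Proof. exact: (eulern_le hH hm (dyadic_gt0 R k)). Qed.
Lemma dstep_linear t k : clinear (A t k).
Proof. exact: (eulern_linear hH hm (dyadic_gt0 R k)). Qed.

Lemma dstep_cvg t x : 0 <= t -> exists l, hlim (fun k => A t k x) l.
Proof.
move=> t0; suff [l hl] : exists l, forall e : R, 0 < e -> exists K : nat,
    forall n : nat, (K <= n)%N -> N (A t n x - l) < e by exists l; apply/hlimP.
apply: (ip_complete hH) => e e0; have e4 : 0 < e / 4 by lra.
have [y [Dy DEy xy]] := maxskew_dense2_lt x e4.
have [l /hlimP/(_ _ e4)[K hK]] := dstep_cvg2 hH hm t0 Dy DEy.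
exists K => m n Km Kn.
have := hK _ Km; have := hK _ Kn.
have := hnorm_distD hH (A t m x) (A t m y) (A t n x); have := hnorm_distD hH (A t m y) l (A t n x).
have := hnorm_distD hH l (A t n y) (A t n x); have := dstep_lip t m x y; have := dstep_lip t n y x.
rewrite (hnormC hH l (A t n y)) (hnormC hH y x); lra.
Qed.

Lemma semigroup_exists : exists T : R -> H -> H, forall t x, 0 <= t -> hlim (fun k => A t k x) (T t x).
Proof.
have /choice[T hT] : forall p : R * H, exists l, 0 <= p.1 -> hlim (fun k => A p.1 k p.2) l.
  (* Negative times receive the value 0. *)
  move=> [t x] /=; have [t0|t0] := boolP (0 <= t); last by exists 0.
  by have [l hl] := dstep_cvg x t0; exists l.
by exists (fun t x => T (t, x)) => t x; exact: (hT (t, x)).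
Qed.

Variable T : R -> H -> H.
Hypothesis hT : forall t x, 0 <= t -> hlim (fun k => A t k x) (T t x).

Let cc (x : R) : (fun=> x) n @[n --> \oo] --> x. Proof. exact: cvg_cst. Qed.

Lemma semigroup_linear t : 0 <= t -> clinear (T t).
Proof.
move=> t0; split=> [x y|a x].
  apply: (hlim_unique hH (hT _ t0)).
  have := hlimD hH (hT x t0) (hT y t0); congr norm_cvg.
  by apply/funext => k; rewrite (dstep_linear t k).1.
apply: (hlim_unique hH (hT _ t0)).
have := hlimZ hH a (hT x t0); congr norm_cvg.
by apply/funext => k; rewrite (dstep_linear t k).2.
Qed.

Lemma semigroup_le t x : 0 <= t -> N (T t x) <= N x.
Proof. by move=> t0; apply: (hlim_le hH (hT x t0) (v := fun=> N x)) => [k|]; [exact: dstep_le|exact: cc]. Qed.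

Lemma semigroup_lip t x y : 0 <= t -> N (T t x - T t y) <= N (x - y).
Proof. by move=> t0; rewrite -(clinearB (semigroup_linear t0)) semigroup_le. Qed.

Lemma semigroup0 x : T 0 x = x.
Proof.
apply: (hlim_unique hH (hT x (lexx 0))).
suff -> : (fun k => A 0 k x) = (fun=> x) by exact: hlim_cst.
by apply/funext => k; rewrite /dstep /dcount mul0r truncn0.
Qed.

Lemma eq_of_le (x y : H) : (forall e, 0 < e -> N (x - y) <= e) -> x = y.
Proof.
move=> h; apply/eqP; rewrite -subr_eq0; apply/eqP/(hnorm_eq0 hH)/eqP.
by rewrite eq_le hnorm_ge0 andbT; apply/ler_addgt0Pr => e e0; rewrite add0r; exact: h.
Qed.

Lemma semigroupD s t x : 0 <= s -> 0 <= t -> T (s + t) x = T s (T t x).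
Proof.
move=> s0 t0; have st0 : 0 <= s + t by rewrite addr_ge0.
suff hD y : D y -> T (s + t) y = T s (T t y).
  apply: eq_of_le => e e0; have e2 : 0 < e / 2 by lra.
  have [y Dy xy] := maxskew_dense_lt hH hm x e2.
  have := hnorm_distD hH (T (s + t) x) (T (s + t) y) (T s (T t x)).
  have := semigroup_lip x y st0; have := semigroup_lip (T t y) (T t x) s0; have := semigroup_lip y x t0.
  rewrite -(hD y Dy) (hnormC hH y x); lra.
move=> Dy; apply: (hlim_unique hH (hT _ st0)).
apply: (@hlim_squeeze _ _ _ (fun k => dyadic R k * N (E y) + (N (A t k y - T t y) +
    N (A s k (T t y) - T s (T t y))))) => [k|].
  have d0 := dyadic_gt0 R k.
  (* The two step counts differ by the carry, so at most one step of length 2^-k separates both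
     sides. *)
  have h1 : N (A (s + t) k y - A s k (A t k y)) <= dyadic R k * N (E y).
    have [b hb] := dcountD k s0 t0; rewrite /dstep hb -(eulernD _ _ (dyadic R k) (dcount s k)).
    rewrite eulernD -(clinearB (eulern_linear hH hm d0 _)) (le_trans (eulern_le hH hm d0 _ _)) //.
    rewrite (le_trans (eulern_sub hH hm d0 _ Dy)) // ler_wpM2r ?hnorm_ge0 // ler_piMl ?(ltW d0) //.
    by rewrite lern1; case: b {hb}.
  have := hnorm_distD hH (A (s + t) k y) (A s k (A t k y)) (T s (T t y)).
  have := hnorm_distD hH (A s k (A t k y)) (A s k (T t y)) (T s (T t y)).
  have := dstep_lip s k (A t k y) (T t y); lra.
rewrite -[X in _ --> X](addr0 0); apply: cvgD; first by apply: cvg0Mr; exact: dyadic_cvg0.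
by rewrite -[X in _ --> X](addr0 0); apply: cvgD; exact: hT.
Qed.

(** Contractivity is inherited from the scheme. The reverse inequality is the limit of [eulern_sq]
    on the domain, extended by density. *)
Lemma semigroup_iso t x : 0 <= t -> N (T t x) = N x.
Proof.
move=> t0; apply/eqP; rewrite eq_le semigroup_le //=.
suff hD y : D y -> N y <= N (T t y).
  apply/ler_addgt0Pr => e e0; have e2 : 0 < e / 2 by lra.
  have [y Dy xy] := maxskew_dense_lt hH hm x e2; have := hD y Dy.
  have := hnorm_dist hH x y; have := hnorm_dist hH (T t x) (T t y); have := semigroup_lip x y t0.
  by rewrite !ler_norml => ? /andP[? ?] /andP[? ?] ?; lra.
move=> Dy; rewrite -(ler_pXn2r (n := 2)) ?nnegrE ?hnorm_ge0 //.
apply: (@cvg_ler _ (fun=> N y ^+ 2) (fun k => N (A t k y) ^+ 2 + dyadic R k * (t * N (E y) ^+ 2))).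
- move=> k; have d0 := dyadic_gt0 R k.
  rewrite (le_trans (eulern_sq hH hm d0 (dcount t k) Dy)) // lerD2l [leRHS]mulrA ler_wpM2r ?sqr_ge0 //.
  have [m1 _] := dcount_itv k t0; have := ler_wpM2l (ltW d0) m1; rewrite expr2; lra.
- exact: cc.
- rewrite -[X in _ --> X]addr0; apply: cvgD.
    by have h := hlim_norm hH (hT y t0); apply: cvgM.
  by apply: cvg0Mr; exact: dyadic_cvg0.
Qed.

Lemma semigroup_der t x z : 0 <= t -> D x -> D z ->
  N (T t x - x - t%:C%C *: E x) <= t * (2 * N (E x - z) + t * N (E z)).
Proof.
move=> t0 Dx Dz.
have hc : N (A t k x - x - t%:C%C *: E x) @[k --> \oo] --> N (T t x - x - t%:C%C *: E x).
  apply: (hlim_norm hH); apply: (hlimB hH); last exact: hlim_cst.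
  by apply: (hlimB hH); [exact: hT|exact: hlim_cst].
apply: (@cvg_ler _ _ (fun k => t * (2 * N (E x - z) + t * N (E z)) + dyadic R k * N (E x)) _ _ _ hc).
  move=> k; have d0 := dyadic_gt0 R k; have [m1 m2] := dcount_itv k t0.
  have h1 := eulern_der hH hm d0 (dcount t k) Dx Dz.
  set m := _%:R * _ in m1 m2 h1; have m0 : 0 <= m by rewrite mulr_ge0 // ltW.
  (* The scheme stops at the grid time [m] below [t]; the gap is less than one step. *)
  have e : A t k x - x - t%:C%C *: E x = (A t k x - x - m%:C%C *: E x) - (t - m)%:C%C *: E x.
    by rewrite rmorphB scalerBl opprB addrA subrK.
  rewrite e (le_trans (hnormB hH _ _)) // lerD //.
    have a0 := hnorm_ge0 ip (E x - z); have b0 := hnorm_ge0 ip (E z).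
    have mb := ler_wpM2r b0 m1; have mb0 := mulr_ge0 m0 b0.
    by rewrite (le_trans h1) // ler_pM //; lra.
  rewrite (hnormZr hH) ler_wpM2r ?hnorm_ge0 // ger0_norm; lra.
rewrite -[X in _ --> X]addr0; apply: cvgD; first exact: cc.
by apply: cvg0Mr; exact: dyadic_cvg0.
Qed.

Lemma semigroup_sub t x : 0 <= t -> D x -> N (T t x - x) <= t * N (E x).
Proof.
move=> t0 Dx; have hc := hlim_norm hH (hlimB hH (hT x t0) (hlim_cst hH x)).
apply: (@cvg_ler _ _ (fun=> t * N (E x)) _ _ _ hc); last exact: cc.
move=> k; have d0 := dyadic_gt0 R k.
rewrite (le_trans (eulern_sub hH hm d0 _ Dx)) // ler_wpM2r ?hnorm_ge0 //.
by have [] := dcount_itv k t0.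
Qed.

Lemma semigroup_C0 : C0_semigroup ip T.
Proof.
split.
- move=> t t0; have [h1 h2] := semigroup_linear t0; split=> //.
  by exists 1 => x; rewrite mul1r semigroup_le.
- exact: semigroup0.
- by move=> s t x; exact: semigroupD.
- move=> x; apply/cvg_right0P => e e0; have e4 : 0 < e / 4 by lra.
  have [y Dy xy] := maxskew_dense_lt hH hm x e4.
  have n1 : 0 < N (E y) + 1 by have := hnorm_ge0 ip (E y); lra.
  exists (e / 4 / (N (E y) + 1)); first by rewrite divr_gt0.
  move=> t t0; rewrite ltr_pdivlMr // ger0_norm ?hnorm_ge0 // mulrDr => h.
  have := hnorm_distD hH (T t x) (T t y) x; have := hnorm_distD hH (T t y) y x.
  have := semigroup_lip x y (ltW t0); have := semigroup_sub (ltW t0) Dy.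
  rewrite (hnormC hH y); lra.
Qed.

Lemma semigroup_generates : generates ip D E T.
Proof.
split; first exact: semigroup_C0.
have fwd x : D x -> N (t^-1%:C%C *: (T t x - x) - E x) @[t --> 0^'+] --> 0.
  move=> Dx; apply/cvg_right0P => e e0; have e4 : 0 < e / 4 by lra.
  have [z Dz xz] := maxskew_dense_lt hH hm (E x) e4.
  have n1 : 0 < N (E z) + 1 by have := hnorm_ge0 ip (E z); lra.
  exists (e / 4 / (N (E z) + 1)); first by rewrite divr_gt0.
  move=> t t0; rewrite ltr_pdivlMr // ger0_norm ?hnorm_ge0 // mulrDr => h.
  rewrite (difference_quotientE hH) // mulrC ltr_pdivrMr // mulrC.
  rewrite (le_lt_trans (semigroup_der (ltW t0) Dx Dz)) // ltr_pM2l //; lra.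
move=> x y; split=> [[Dx <-]|h]; first exact: fwd.
(* The generator is no larger than [E]: take x' in the domain with x' - E x' = x - y. Then w = x -
   x' has derivative w along the semigroup, and contractivity forces w = 0. *)
have r1 : in_resolvent_set ip D E 1 by apply: (maxskew_rho hH hm); rewrite /= ltr01.
have Dx' := res_dom (x - y) r1; set x' := resolvent D E 1 (x - y) in Dx'.
have e' : x' - E x' = x - y by rewrite -(res_eq (x - y) r1) scale1r.
have ww : x - x' = y - E x'.
  by rewrite -[LHS](subrKA y) -e' addrC subrKA.
have hw : N (t^-1%:C%C *: (T t (x - x') - (x - x')) - (x - x')) @[t --> 0^'+] --> 0.
  apply: (squeeze_cvgr _ (cvg_cst 0) (_ : (N (t^-1%:C%C *: (T t x - x) - y) +
     N (t^-1%:C%C *: (T t x' - x') - E x')) @[t --> 0^'+] --> 0)).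
    near=> t; rewrite hnorm_ge0 /= [X in _ - X]ww (clinearB (semigroup_linear _)); last by near: t; exact: nbhs_right_ge.
    rewrite [in X in _ *: X]opprD [in X in _ *: X]addrACA -[in X in _ *: X]opprD scalerBr.
    by rewrite opprD addrACA -opprD (hnormB hH).
  by rewrite -[X in _ --> X](addr0 0); apply: cvgD => //; exact: fwd.
suff w0 : x - x' = 0.
  have -> : x = x' by apply/eqP; rewrite -subr_eq0 w0.
  by split=> //; apply/eqP; rewrite eq_sym -subr_eq0 -ww w0.
apply: (hnorm_eq0 hH); apply/eqP; rewrite eq_le hnorm_ge0 andbT leNgt; apply/negP => w0.
have [d d0 hd] := (cvg_right0P _).1 hw _ w0.
have t0 : 0 < d / 2 by lra.
have td : d / 2 < d by lra.
have := hd _ t0 td; move: w0; set w := x - x'; set u := _ *: _ => w0.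
rewrite ger0_norm ?hnorm_ge0 // => uw.
(* Contractivity gives <T w - w, w> <= 0, hence <u, w> <= 0, whereas [u] is closer to [w] than
   |w|. *)
have : rip (u - w) w <= - N w ^+ 2.
  rewrite (ripBl hH) -(hnorm_sq hH) lerBlDr addNr (ripZl hH) pmulr_rle0 ?invr_gt0 //.
  rewrite (ripBl hH) -(hnorm_sq hH) subr_le0 (le_trans (rip_le hH _ _)) // expr2 ler_wpM2r ?hnorm_ge0 //.
  exact/semigroup_le/ltW.
have := rip_cs hH (u - w) w; rewrite ler_norml => /andP[h1 _] h2.
have : N (u - w) * N w < N w * N w by rewrite ltr_pM2r.
by move: h2; rewrite expr2; lra.
Unshelve. all: by end_near.
Qed.

End Generation.

Theorem maxskew_generates (R : realType) (H : lmodType R[i]) (ip : H -> H -> R[i])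
  (D : set H) (E : H -> H) : is_hilbert ip -> maxskew ip D E ->
  exists T, generates ip D E T /\ forall t x, 0 <= t -> hnorm ip (T t x) = hnorm ip x.
Proof.
move=> hH hm; have [T hT] := semigroup_exists hH hm.
by exists T; split; [exact: semigroup_generates hT|exact: semigroup_iso hT].
Qed.


(** * Generators of isometry semigroups *)

Section IsometrySemigroup.
Variables (R : realType) (H : lmodType R[i]) (ip : H -> H -> R[i]).
Hypothesis hH : is_hilbert ip.
Local Notation N := (hnorm ip).
Local Notation rip := (real_ip ip).
Local Notation hlim := (norm_cvg ip).
Variables (D : set H) (E : H -> H).
Hypothesis hE : linear_operator D E.
Variable T : R -> H -> H.
Hypothesis hT : generates ip D E T.
Hypothesis T_iso : forall (t : R) x, 0 <= t -> N (T t x) = N x.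

Lemma le0_small (a K : R) : 0 <= K -> (forall e, 0 < e -> e < 1 -> a <= e * K) -> a <= 0.
Proof.
move=> K0 h; rewrite leNgt; apply/negP => a0.
have k1 : 0 < K + a + 1 by lra.
have := h (a / (K + a + 1)); rewrite divr_gt0 // ltr_pdivrMr // mul1r => /(_ isT).
have -> : a < K + a + 1 by lra.
move=> /(_ isT); rewrite mulrAC ler_pdivlMr // ler_pM2l //; lra.
Qed.

Lemma isometric_skew x : D x -> rip x (E x) = 0.
Proof.
move=> Dx; have [_ /(_ x (E x))[/(_ (conj Dx erefl)) hd _]] := hT.
have := (cvg_right0P _).1 hd => {}hd.
apply/eqP; rewrite -normr_eq0 eq_le normr_ge0 andbT.
have K0 : 0 <= N x + (N (E x) + 1) ^+ 2 by rewrite addr_ge0 ?hnorm_ge0 ?sqr_ge0.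
apply: (le0_small K0) => e e0 e1.
have [d d0 hdd] := hd e e0; pose t := Num.min (d / 2) e.
have t0 : 0 < t by rewrite lt_min e0 andbT; lra.
have td : t < d by rewrite gt_min; apply/orP; left; lra.
have te : t <= e by rewrite ge_min lexx orbT.
have := hdd t t0 td; set u := _ *: _; rewrite ger0_norm ?hnorm_ge0 // => ue.
have eT : T t x = x + t%:C%C *: u.
  by rewrite /u scalerA -rmorphM divff ?gt_eqF // rmorph1 scale1r addrC subrK.
(* Expanding |x + t u|^2 = |x|^2 replaces the differentiation of the squared norm. *)
have h1 : 2 * rip x u = - t * N u ^+ 2.
  have : N (T t x) ^+ 2 = N x ^+ 2 by rewrite T_iso ?(ltW t0).
  rewrite eT (hnormD_sq hH) (ripZr hH) (hnormZr hH) exprMn real_normK ?num_real // => h.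
  apply: (mulfI (x := t)); first by rewrite gt_eqF.
  rewrite mulrA (mulrC t 2) -mulrA; move: h; rewrite expr2; lra.
have Nu : N u <= N (E x) + 1 by have := hnorm_distD hH u (E x) 0; rewrite !subr0; lra.
have Nu2 : N u ^+ 2 <= (N (E x) + 1) ^+ 2.
  by rewrite ler_pXn2r ?nnegrE ?hnorm_ge0 //; have := hnorm_ge0 ip (E x); lra.
have := rip_cs hH x (u - E x); rewrite (ripBr hH).
have h2 : N x * N (u - E x) <= N x * e by rewrite ler_wpM2l ?hnorm_ge0 // ltW.
have h3 : t * N u ^+ 2 <= e * (N (E x) + 1) ^+ 2 by rewrite ler_pM ?sqr_ge0 // ltW.
have h4 : 0 <= t * N u ^+ 2 by rewrite mulr_ge0 ?sqr_ge0 // ltW.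
move: h1 h2 h3 h4; set r := N u ^+ 2; set v := _ ^+ 2; set p := rip x u.
rewrite ler_norml => h1 h2 h3 h4 /andP[h5 h6].
by rewrite ler_norml; apply/andP; split; lra.
Qed.

Let C0T : C0_semigroup ip T. Proof. by have [] := hT. Qed.
Let TL t : 0 <= t -> clinear (T t).
Proof. by move=> t0; have [h _ _ _] := C0T; have [] := h t t0. Qed.
Let T0 x : T 0 x = x. Proof. by have [_ ] := C0T. Qed.
Let TD s t x : 0 <= s -> 0 <= t -> T (s + t) x = T s (T t x).
Proof. by have [_ _ h _] := C0T; exact: h. Qed.

Lemma expR_le_quadratic (u : R) : 0 <= u -> u <= 2^-1 ->
  1 + u <= expR u /\ expR u <= 1 + u + 2 * u ^+ 2.
Proof.
move=> u0 u2; split; first exact: expR_ge1Dx.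
have h1 : expR u * (1 - u) <= 1.
  rewrite -[leRHS](expRxMexpNx_1 u) ler_pM2l ?expR_gt0 //; have := expR_ge1Dx (- u); lra.
have u1 : 0 < 1 - u by lra.
rewrite -(ler_pM2r u1) (le_trans h1) //.
have u3 : 0 <= 1 - 2 * u by lra.
have := mulr_ge0 (sqr_ge0 u) u3; lra.
Qed.

(** * The damped semigroup and the resolvent equation *)

Section damped.
Variable a : R.
Hypothesis a0 : 0 < a.

(** Damping gives norm exp(- a t) < 1 for t > 0, so 1 - S t is invertible; the generator becomes E -
    a. *)
Definition damped t x := (expR (- (a * t)))%:C%C *: T t x.
Local Notation S := damped.

Lemma damped_linear t : 0 <= t -> clinear (S t).
Proof.
move=> t0; have [lD lZ] := TL t0; split=> [x y|b x]; first by rewrite /S lD scalerDr.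
by rewrite /S lZ !scalerA mulrC.
Qed.
Lemma damped_norm t x : 0 <= t -> N (S t x) = expR (- (a * t)) * N x.
Proof. by move=> t0; rewrite /S (hnormZr hH) gtr0_norm ?expR_gt0 // T_iso. Qed.
Lemma damp_le1 t : 0 <= t -> expR (- (a * t)) <= 1.
Proof. by move=> t0; rewrite -expR0 ler_expR oppr_le0 mulr_ge0 // ltW. Qed.
Lemma damped_le t x : 0 <= t -> N (S t x) <= N x.
Proof. by move=> t0; rewrite damped_norm // ler_piMl ?hnorm_ge0 // damp_le1. Qed.
Lemma damped0 x : S 0 x = x.
Proof. by rewrite /S mulr0 oppr0 expR0 rmorph1 scale1r T0. Qed.
Lemma dampedD s t x : 0 <= s -> 0 <= t -> S (s + t) x = S s (S t x).
Proof.
move=> s0 t0; rewrite /S TD // (TL s0).2 scalerA -rmorphM -expRD.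
by congr ((expR _)%:C%C *: _); ring.
Qed.

Lemma damped_continuous x e : 0 < e -> exists2 d, 0 < d & forall r, 0 <= r -> r < d -> N (S r x - x) <= e.
Proof.
move=> e0; have e2 : 0 < e / 2 by lra.
have [_ _ _ /(_ x)/cvg_right0P/(_ _ e2)[d d0 hd]] := C0T.
have n1 : 0 < a * N x + 1 by have := mulr_ge0 (ltW a0) (hnorm_ge0 ip x); lra.
exists (Num.min d (e / 2 / (a * N x + 1))); first by rewrite lt_min d0 divr_gt0.
move=> r; rewrite le_eqVlt => /orP[/eqP <- _|r0].
  by rewrite damped0 subrr (hnorm0 hH) ltW.
rewrite lt_min ltr_pdivlMr // => /andP[/(hd _ r0)]; rewrite ger0_norm ?hnorm_ge0 // => h1 h2.
have h3 : N (S r x - T r x) <= a * r * N x.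
  have -> : S r x - T r x = (expR (- (a * r)) - 1)%:C%C *: T r x.
    by rewrite rmorphB scalerBl rmorph1 scale1r.
  rewrite (hnormZr hH) T_iso ?(ltW r0) // ler_wpM2r ?hnorm_ge0 // ler0_norm ?subr_le0 ?damp_le1 ?(ltW r0) //.
  by have := expR_ge1Dx (- (a * r)); lra.
have := hnorm_distD hH (S r x) (T r x) x; move: h2 h3; lra.
Qed.

Lemma damped_solve t h : 0 < t -> exists x, x - S t x = t%:C%C *: h.
Proof.
move=> t0; have q1 : expR (- (a * t)) < 1 by rewrite -expR0 ltr_expR oppr_lt0 mulr_gt0.
have [lD lZ] := damped_linear (ltW t0).
have [|W [_ _ h1 _]] := neumann_inverse hH (expR_ge0 (- (a * t))) q1 lD lZ.
  by move=> x; rewrite damped_norm // ltW.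
by exists (W (t%:C%C *: h)); rewrite h1.
Qed.

(** Since exp(- a t) <= 1 / (1 + a t), the inverse of 1 - S t has norm at most (1 + a t) / (a t), of
    order 1 / t. *)
Lemma damped_lower t x : 0 < t -> a * t * N x <= (1 + a * t) * N (x - S t x).
Proof.
move=> t0; have at0 : 0 < a * t by rewrite mulr_gt0.
have := hnorm_distD hH x (S t x) 0; rewrite !subr0 damped_norm ?(ltW t0) // => h.
have h1 : (1 + a * t) * expR (- (a * t)) <= 1.
  by rewrite expRN ler_pdivrMr ?expR_gt0 // mul1r expR_ge1Dx.
have h2 := ler_wpM2r (hnorm_ge0 ip x) h1.
have h3 : 0 <= 1 + a * t by lra.
have := ler_wpM2l h3 h; lra.
Qed.

(** Telescoping: x - S (m tau) x is the sum of tau S (j tau) h over j < m, and each S (j tau) h is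
    within e of h while j tau < d. *)
Lemma damped_sum tau x h e d m : 0 < tau -> x - S tau x = tau%:C%C *: h ->
  (forall r, 0 <= r -> r < d -> N (S r h - h) <= e) -> m%:R * tau < d ->
  N (x - S (m%:R * tau) x - (m%:R * tau)%:C%C *: h) <= m%:R * tau * e.
Proof.
move=> t0 hx he; elim: m => [|m IH] md.
  by rewrite !mul0r damped0 subrr scale0r subr0 (hnorm0 hH).
have m0 : 0 <= m%:R * tau by rewrite mulr_ge0 // ltW.
have md' : m%:R * tau < d by apply: le_lt_trans md; rewrite ler_wpM2r ?ler_nat // ltW.
have -> : x - S (m.+1%:R * tau) x - (m.+1%:R * tau)%:C%C *: h =
  (x - S (m%:R * tau) x - (m%:R * tau)%:C%C *: h) + tau%:C%C *: (S (m%:R * tau) h - h).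
  have eS : tau%:C%C *: S (m%:R * tau) h = S (m%:R * tau) x - S (m%:R * tau + tau) x.
    by rewrite -(damped_linear m0).2 -hx (clinearB (damped_linear m0)) dampedD // ltW.
  rewrite scalerBr eS.
  rewrite -natr1 mulrDl mul1r rmorphD scalerDl.
  by rewrite [RHS]addrACA -opprD subrKA.
rewrite (le_trans (hnormD hH _ _)) // (hnormZr hH) gtr0_norm // -natr1 mulrDl mul1r mulrDl.
by apply: lerD; [exact: IH|rewrite ler_pM2l //; exact: he].
Qed.

(* The solutions x_k of (1 - S(t_k)) x_k = t_k h with t_k = 2^-k play the role of Riemann sums of the
   Laplace integral of the semigroup; no vector-valued integral is needed. *)
Lemma resolvent_equation_solvable h : exists x, D x /\ a%:C%C *: x - E x = h.
Proof.
have /choice[x hx] : forall k, exists x, x - S (dyadic R k) x = (dyadic R k)%:C%C *: h.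
  by move=> k; apply: damped_solve; exact: dyadic_gt0.
(* t_k is a multiple of t_l, so by [damped_sum] x_l nearly solves the equation of x_k;
   [damped_lower] turns the residual into a distance. *)
have cau e d k l : (forall r, 0 <= r -> r < d -> N (S r h - h) <= e) -> dyadic R k < d -> (k <= l)%N ->
    a * N (x l - x k) <= (1 + a) * e.
  move=> he kd kl; set t := dyadic R k in kd *; have t0 : 0 < t by exact: dyadic_gt0.
  have e0 : 0 <= e by rewrite (le_trans _ (he t (ltW t0) kd)) // hnorm_ge0.
  have t1 : t <= 1 by rewrite exprn_ile1 // invf_le1 // ler1n.
  have := damped_lower (x l - x k) t0.
  rewrite (clinearB (damped_linear (ltW t0))) opprD addrACA -opprD hx => h1.
  have et : t = (2 ^ (l - k))%N%:R * dyadic R l.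
    by rewrite /t natrX -{2}(subnKC kl) /dyadic exprD mulrCA -/(dyadic R (l - k)) pow_dyadic mulr1.
  have := damped_sum (m := (2 ^ (l - k))%N) (dyadic_gt0 R l) (hx l) he; rewrite -et => /(_ kd) h2.
  rewrite -(ler_pM2l t0); have h3 : 0 <= 1 + a * t by have := mulr_gt0 a0 t0; lra.
  have h4 := le_trans h1 (ler_wpM2l h3 h2).
  have h5 : (1 + a * t) * (t * e) <= (1 + a) * (t * e).
    rewrite ler_wpM2r ?mulr_ge0 ?(ltW t0) // lerD2l; have := ler_wpM2l (ltW a0) t1; lra.
  by lra.
have [x0 hx0] : exists x0, hlim x x0.
  suff [l hl] : exists l, forall e : R, 0 < e -> exists K : nat,
    forall n : nat, (K <= n)%N -> N (x n - l) < e by exists l; apply/hlimP.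
  apply: (ip_complete hH) => e e0.
  have a1 : 0 < 1 + a by rewrite addr_gt0.
  pose e1 := a * e / 4 / (1 + a).
  have e10 : 0 < e1 by rewrite !divr_gt0 ?mulr_gt0.
  have [d d0 hd] := damped_continuous h e10.
  have [K _ hK] := (cvgrPdist_lt _ _).1 (@dyadic_cvg0 R) _ d0.
  have Kd : dyadic R K < d.
    by have := hK K (leqnn _); rewrite /= sub0r normrN gtr0_norm ?dyadic_gt0.
  exists K => m n Km Kn.
  have := cau _ _ _ _ hd Kd Km; have := cau _ _ _ _ hd Kd Kn.
  have -> : (1 + a) * e1 = a * (e / 4) by rewrite /e1; field; rewrite gt_eqF.
  rewrite !ler_pM2l //; have := hnorm_distD hH (x m) (x K) (x n); rewrite (hnormC hH (x K)); lra.
(* Grid times [sl l] approach an arbitrary s from below, so the limit [x0] inherits the estimate of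
   [damped_sum] at s. *)
have lim e d s : (forall r, 0 <= r -> r < d -> N (S r h - h) <= e) -> 0 < s -> s < d ->
    N (x0 - S s x0 - s%:C%C *: h) <= s * e.
  move=> he s0 sd; have e0 : 0 <= e by rewrite (le_trans _ (he s (ltW s0) sd)) // hnorm_ge0.
  have mt l : exists m : nat, [/\ 0 <= m%:R * dyadic R l, m%:R * dyadic R l <= s & s < m%:R * dyadic R l + dyadic R l].
    exists (dcount s l); have [h1 h2] := dcount_itv l (ltW s0).
    by split => //; rewrite mulr_ge0 // ltW // dyadic_gt0.
  have /choice[m hm] := mt; pose sl l := (m l)%:R * dyadic R l.
  have hs : hlim (fun l => S (sl l) (x l)) (S s x0).
    apply: (@hlim_squeeze _ _ _ (fun l => N (x l - x0) + N (x0 - S (s - sl l) x0))) => [l|].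
      have [m0 m1 _] := hm l; have L := clinearB (damped_linear (m0 : 0 <= sl l)).
      rewrite (le_trans (hnorm_distD hH _ (S (sl l) x0) _)) //; apply: lerD.
        by rewrite -L damped_le.
      have e1 : S s x0 = S (sl l) (S (s - sl l) x0) by rewrite -dampedD ?subr_ge0 // subrKC.
      by rewrite e1 -L damped_le.
    rewrite -[X in _ --> X](addr0 0); apply: cvgD; first exact: hx0.
    apply/cvgrPdist_lt => e' e'0; have e'2 : 0 < e' / 2 by lra.
    have [d' d'0 hd'] := damped_continuous x0 e'2.
    have [K _ hK] := (cvgrPdist_lt _ _).1 (@dyadic_cvg0 R) _ d'0.
    exists K => // l /= Kl; rewrite sub0r normrN ger0_norm ?hnorm_ge0 // (hnormC hH).
    have := hK l Kl; rewrite /= sub0r normrN gtr0_norm ?dyadic_gt0 // => ld.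
    have [m0 m1 m2] := hm l; have := hd' (s - sl l); rewrite subr_ge0 m1 => /(_ isT).
    have -> : s - sl l < d' by rewrite /sl; lra.
    by move=> /(_ isT); lra.
  have hsl : sl l @[l --> \oo] --> s.
    apply/cvgrPdist_lt => e' e'0.
    have [K _ hK] := (cvgrPdist_lt _ _).1 (@dyadic_cvg0 R) _ e'0.
    exists K => // l /= Kl.
    have := hK l Kl; rewrite /= sub0r normrN gtr0_norm ?dyadic_gt0 // => ld.
    have [m0 m1 m2] := hm l; rewrite ger0_norm ?subr_ge0 //; rewrite /sl; lra.
  have hc : hlim (fun l => x l - S (sl l) (x l) - (sl l)%:C%C *: h) (x0 - S s x0 - s%:C%C *: h).
    apply: (hlimB hH); first exact: hlimB.
    apply: (@hlim_squeeze _ _ _ (fun l => `|sl l - s| * N h)) => [l|].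
      by rewrite -scalerBl -rmorphB (hnormZr hH).
    apply: cvg0Mr; apply/cvgrPdist_lt => e' e'0.
    have [K _ hK] := (cvgrPdist_lt _ _).1 hsl _ e'0; exists K => // l Kl.
    by rewrite sub0r normrN normr_id distrC; exact: hK.
  apply: (cvg_ler _ (hlim_norm hH hc) (_ : (sl l * e) @[l --> \oo] --> s * e)).
    move=> l; have [m0 m1 m2] := hm l.
    by apply: (damped_sum (dyadic_gt0 R l) (hx l) he); exact: le_lt_trans m1 sd.
  by apply: cvgM => //; exact: cvg_cst.
exists x0; suff [Dx Ex] : D x0 /\ E x0 = a%:C%C *: x0 - h by rewrite Ex opprB addrC subrK.
have [_ hgen] := hT; apply/hgen; apply/cvg_right0P => e e0.
have e8 : 0 < e / 8 by lra.
have [d d0 hd] := damped_continuous h e8.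
(* [K] bounds the second-order terms of exp(a t) that appear on passing from S back to T. *)
pose K := 2 * a ^+ 2 * N x0 + 2 * a * N h; have K0 : 0 <= K.
  by rewrite addr_ge0 ?mulr_ge0 ?hnorm_ge0 ?exprn_ge0 ?(ltW a0).
exists (Num.min d (Num.min (2^-1 / a) (e / 8 / (K + 1)))).
  by rewrite !lt_min d0 !divr_gt0 //; lra.
move=> t t0; rewrite !lt_min => /andP[td /andP[ta tK]].
have at0 : 0 <= a * t by rewrite mulr_ge0 // ltW.
have at2 : a * t <= 2^-1 by move: ta; rewrite ltr_pdivlMr // mulrC => /ltW.
have [p1 p2] := expR_le_quadratic at0 at2.
rewrite ger0_norm ?hnorm_ge0 // (difference_quotientE hH) // mulrC ltr_pdivrMr // mulrC.
have hr := lim _ _ _ hd t0 td; move: hr; set r := _ - _ - _ => hr.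
set p := expR (a * t) in p1 p2.
(* From T t = exp(a t) S t. The first two terms are O(t^2), the last is at most t e / 4. *)
have -> : T t x0 - x0 - t%:C%C *: (a%:C%C *: x0 - h) =
    (p - 1 - t * a)%:C%C *: x0 - (t * (p - 1))%:C%C *: h - p%:C%C *: r.
  have eT : T t x0 = p%:C%C *: S t x0.
    by rewrite /S scalerA -rmorphM /p expRxMexpNx_1 rmorph1 scale1r.
  rewrite eT /r; apply: (ip_ext hH) => z.
  rewrite !(rmorphB, rmorphM, rmorph1) !(ipBl hH, ipZl hH); ring.
rewrite (le_lt_trans (hnormB hH _ _)) //.
have := hnormB hH ((p - 1 - t * a)%:C%C *: x0) ((t * (p - 1))%:C%C *: h).
rewrite !(hnormZr hH) !ger0_norm; try lra; last first.
  by rewrite mulr_ge0 ?(ltW t0) //; lra.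
have at4 : (a * t) ^+ 2 <= 2^-1 * (a * t) by rewrite expr2 ler_wpM2r.
have b1 : (p - 1 - t * a) * N x0 <= t * (2 * a ^+ 2 * t) * N x0.
  by rewrite ler_wpM2r ?hnorm_ge0 //; move: p2; rewrite !exprMn; lra.
have b2 : t * (p - 1) * N h <= t * (2 * a * t) * N h.
  by rewrite ler_wpM2r ?hnorm_ge0 // ler_wpM2l ?(ltW t0) //; lra.
have b3 : p * N r <= 2 * (t * (e / 8)).
  by rewrite ler_pM ?hnorm_ge0 //; lra.
have b4 : t * (t * (K + 1)) < t * (e / 8).
  by rewrite ltr_pM2l // -ltr_pdivlMr //; lra.
have b5 : 0 < t * t by rewrite mulr_gt0.
have b6 : 0 < t * e by rewrite mulr_gt0.
by move: b4; rewrite /K; lra.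
Qed.
End damped.

(** Real points are already solved. For general z, the equation is rewritten as (a - E) x = h + (a -
    z) x and solved by contraction, which requires |a - z| < a. *)
Lemma isometric_maxskew : maxskew ip D E.
Proof.
split=> //; first exact: isometric_skew.
move=> z z0 h.
(* Chosen so that |a - z|^2 = a^2 - 1. *)
pose a := (normc z ^+ 2 + 1) / (2 * complex.Re z).
have n0 : 0 < normc z ^+ 2 + 1 by have := sqr_ge0 (normc z); lra.
have a0 : 0 < a by rewrite divr_gt0 // mulr_gt0.
have /choice[Rl hR] := resolvent_equation_solvable a0.
pose q := normc (a%:C%C - z) / a.
have q0 : 0 <= q by rewrite divr_ge0 ?normc_ge0 // ltW.
have q1 : q < 1.
  rewrite /q ltr_pdivrMr // mul1r -(ltr_pXn2r (n := 2)) ?nnegrE ?normc_ge0 ?(ltW a0) //.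
  have e : 2 * complex.Re z * a = normc z ^+ 2 + 1.
    by rewrite /a; field; rewrite gt_eqF.
  move: e z0; rewrite !normcE; case: (z) => u v /=; lra.
have lip y y' : N (h + (a%:C%C - z) *: Rl y - (h + (a%:C%C - z) *: Rl y')) <= q * N (y - y').
  rewrite opprD addrACA subrr add0r -scalerBr (hnormZ hH) /q -mulrA ler_wpM2l ?normc_ge0 //.
  rewrite mulrC ler_pdivlMr // mulrC.
  have [Dy Ey] := hR y; have [Dy' Ey'] := hR y'.
  have := skew_lower hH a%:C%C (isometric_skew (domB hE Dy Dy')).
  by rewrite (opB hE) // scalerBr opprD addrACA -opprD Ey Ey'.
have [y hy] := contraction_fixpoint hH q0 q1 lip.
exists (Rl y); have [Dy Ey] := hR y; split=> //.
have -> : z *: Rl y - E (Rl y) = (a%:C%C *: Rl y - E (Rl y)) - (a%:C%C - z) *: Rl y.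
  by apply: (ip_ext hH) => w; rewrite !(ipBl hH, ipZl hH); ring.
by rewrite Ey -[X in X - _]hy addrK.
Qed.

End IsometrySemigroup.


(** * Integrals over symmetric segments *)

Section SegmentIntegral.
Variable R : realType.
Local Notation mu := (@lebesgue_measure R).
Implicit Types (f g F : R -> R) (n : nat).

(** The shift to n + 1 keeps the segment nondegenerate and bounds of order 1 / n.+1 meaningful at n
    = 0. *)
Definition segment n : set R := `[- n.+1%:R, n.+1%:R]%classic.
Definition sint n f : R := (\int[mu]_(x in segment n) f x)%R.

Lemma msegment n : measurable (segment n : set (measurableTypeR R)).
Proof. exact: measurable_itv. Qed.

Lemma sint_integrable n f : continuous f -> mu.-integrable (segment n) (EFin \o f).
Proof.
move=> cf; apply: continuous_compact_integrable; first exact: segment_compact.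
exact: continuous_subspaceT.
Qed.

Lemma sintE n f : continuous f -> (sint n f)%:E = (\int[mu]_(x in segment n) (f x)%:E)%E.
Proof.
move=> cf; rewrite /sint /Rintegral fineK //.
by apply: integrable_fin_num; [exact: msegment|exact: sint_integrable].
Qed.

Lemma le_sint n f g : continuous f -> continuous g -> (forall x, f x <= g x) ->
  sint n f <= sint n g.
Proof.
move=> cf cg h; apply: le_Rintegral => //; [exact: msegment|exact: sint_integrable|exact: sint_integrable].
Qed.

Lemma sintD n f g : continuous f -> continuous g ->
  sint n (fun x => f x + g x) = sint n f + sint n g.
Proof.
by move=> cf cg; apply: RintegralD; [exact: msegment|exact: sint_integrable|exact: sint_integrable].
Qed.
Lemma sintB n f g : continuous f -> continuous g ->
  sint n (fun x => f x - g x) = sint n f - sint n g.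
Proof.
by move=> cf cg; apply: RintegralB; [exact: msegment|exact: sint_integrable|exact: sint_integrable].
Qed.
Lemma sintZ n a f : continuous f -> sint n (fun x => a * f x) = a * sint n f.
Proof. by move=> cf; apply: RintegralZl; [exact: msegment|exact: sint_integrable]. Qed.

Lemma sint_cst n a : sint n (fun=> a) = a * (2 * n.+1%:R).
Proof.
rewrite /sint Rintegral_cst; last exact: msegment.
rewrite /segment /= lebesgue_measure_itv /= lte_fin; congr (_ * _).
have h : - n.+1%:R < n.+1%:R :> R by rewrite gtrN.
by rewrite h -EFinD /=; ring.
Qed.

Lemma sint_abs_le n f c : continuous f -> (forall x, `|f x| <= c) -> `|sint n f| <= c * (2 * n.+1%:R).
Proof.
move=> cf h; have cc (k : R) : continuous (fun _ : R => k) by move=> x; exact: cvg_cst.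
rewrite ler_norml -mulNr -!sint_cst; apply/andP; split; apply: le_sint => //.
  by move=> x; have := h x; rewrite ler_norml => /andP[].
by move=> x; have := h x; rewrite ler_norml => /andP[].
Qed.

(** Resolvent identities deliver expansions with quadratic remainder; this turns them into
    derivatives, so that no resolvent is differentiated directly. *)
Lemma quadratic_is_derive (F f : R -> R) (K : R) :
  (forall x y, `|F y - F x - (y - x) * f x| <= K * (y - x) ^+ 2) ->
  forall x : R, is_derive x (1 : R) F (f x).
Proof.
move=> h x; have K0 : 0 <= K.
  by have := h 0 1; rewrite subr0 expr1n mulr1; apply: le_trans.
have cv : (fun t => t^-1 *: ((F \o shift x) (t *: (1 : R)) - F x)) @ 0^' --> f x.
  apply/cvgrPdist_lt => e e0.
  exists (e / (K + 1)); first by rewrite /= divr_gt0 //; lra.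
  move=> t /=; rewrite sub0r normrN => te t0.
  have := h x (t + x); rewrite addrK => ht.
  rewrite /shift /= -[t *: 1]/(t * 1) mulr1 -[_ *: _]/(t^-1 * _).
  have -> : f x - t^-1 * (F (t + x) - F x) = - (t^-1 * (F (t + x) - F x - t * f x)).
    by field.
  rewrite normrN normrM normfV mulrC ltr_pdivrMr ?normr_gt0 //.
  rewrite (le_lt_trans ht) // -(real_normK (num_real t)) expr2 mulrA ltr_pM2r ?normr_gt0 //.
  move: te; rewrite ltr_pdivlMr; last lra.
  have := normr_ge0 t; lra.
apply: DeriveDef; first exact: (cvgP _ cv).
by rewrite /derive; apply: cvg_lim => //; exact: Rhausdorff.
Qed.

Lemma sint_FTC n (F f : R -> R) : continuous f -> (forall x : R, is_derive x (1 : R) F (f x)) ->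
  sint n f = F n.+1%:R - F (- n.+1%:R).
Proof.
move=> cf d; have cF : continuous F.
  move=> x; apply: differentiable_continuous; apply/derivable1_diffP; by have := d x => -[].
have ab : - n.+1%:R < n.+1%:R :> R by rewrite gtrN.
rewrite /sint /Rintegral (continuous_FTC2 ab (F := F)) //.
- exact: continuous_subspaceT.
- split.
  + by move=> x _; have := d x => -[].
  + by apply: cvg_at_right_filter; exact: cF.
  + by apply: cvg_at_left_filter; exact: cF.
- by move=> x _; rewrite derive1E; have := d x => -[].
Qed.

Lemma lipschitz_continuousR f K : (forall x y, `|f y - f x| <= K * `|y - x|) -> continuous f.
Proof.
move=> h x; have K0 : 0 <= K by have := h 0 1; rewrite subr0 normr1 mulr1; apply: le_trans.
apply/cvgrPdist_lt => e e0; exists (e / (K + 1)); first by rewrite /= divr_gt0 //; lra.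
move=> t /=; rewrite distrC ltr_pdivlMr; last lra.
move=> te; rewrite distrC (le_lt_trans (h x t)) //; have := normr_ge0 (t - x); lra.
Qed.

Lemma continuous_measurable_EFin f (A : set (measurableTypeR R)) : continuous f -> measurable A ->
  measurable_fun A (fun x => (f x)%:E).
Proof.
move=> cf mA; apply/measurable_EFinP; apply: (measurable_funS measurableT) => //.
exact: continuous_measurable_fun.
Qed.

Lemma sint_cvg f : continuous f -> (forall x, 0 <= f x) ->
  ((sint n f)%:E @[n --> \oo] --> \int[mu]_(x in setT) (f x)%:E)%E.
Proof.
move=> cf f0; under eq_fun do rewrite sintE //.
have -> : [set: R] = \bigcup_i segment i.
  apply/seteqP; split=> // x _; exists (Num.truncn `|x|) => //=.
  rewrite /segment /= in_itv /= -ler_norml ltW //.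
  exact: truncnS_gt.
apply: ge0_nondecreasing_set_cvg_integral.
- move=> m n mn; rewrite subsetEset; apply: subset_itv; rewrite bnd_simp ?lerN2 ler_nat //.
- by move=> i; exact: msegment.
- by move=> i; apply: continuous_measurable_EFin => //; exact: msegment.
- by move=> i x _; rewrite lee_fin.
Qed.

Lemma sint_nondecreasing f n m : continuous f -> (forall x, 0 <= f x) -> (n <= m)%N ->
  sint n f <= sint m f.
Proof.
move=> cf f0 nm; rewrite -lee_fin !sintE //.
apply: ge0_subset_integral; try exact: msegment.
- by apply: continuous_measurable_EFin => //; exact: msegment.
- by move=> x _; rewrite lee_fin.
- by apply: subset_itv; rewrite bnd_simp ?lerN2 ler_nat ltnS.
Qed.

Lemma sint_le_integral f n : continuous f -> (forall x, 0 <= f x) ->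
  ((sint n f)%:E <= \int[mu]_(x in setT) (f x)%:E)%E.
Proof.
move=> cf f0; rewrite sintE //.
apply: ge0_subset_integral => //; first exact: msegment.
- by apply: continuous_measurable_EFin.
- by move=> x _; rewrite lee_fin.
Qed.

Lemma integral_le_sint f (c : R) : continuous f -> (forall x, 0 <= f x) ->
  (forall n, sint n f <= c) -> (\int[mu]_(x in setT) (f x)%:E <= c%:E)%E.
Proof.
move=> cf f0 h; have cv := sint_cvg cf f0.
rewrite -(cvg_lim (@ereal_hausdorff R) cv); apply: lime_le; first exact: (cvgP _ cv).
by near=> n; rewrite lee_fin.
Unshelve. all: by end_near. Qed.

(* Subdivide [a, b] into m pieces and let m tend to infinity. *)
Lemma quadratic_lipschitz (P W : R -> R) (M K e0 a b : R) :
  (forall x y, e0 <= x -> e0 <= y -> `|P y - P x - (y - x) * W x| <= K * (y - x) ^+ 2) ->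
  (forall x, e0 <= x -> `|W x| <= M) -> e0 <= a -> a <= b -> `|P b - P a| <= (b - a) * M.
Proof.
move=> hP hW ea ab.
have h (m : nat) : `|P b - P a| <= (b - a) * M + m.+1%:R^-1 * (K * (b - a) ^+ 2).
  pose d := (b - a) / m.+1%:R; have d0 : 0 <= d by rewrite divr_ge0 // subr_ge0.
  have hk (k : nat) : `|P (a + k%:R * d) - P a| <= k%:R * (d * M + K * d ^+ 2).
    elim: k => [|k IH]; first by rewrite !mul0r addr0 subrr normr0.
    have ek : e0 <= a + k%:R * d by rewrite (le_trans ea) // lerDl mulr_ge0.
    have ek1 : e0 <= a + k.+1%:R * d by rewrite (le_trans ea) // lerDl mulr_ge0.
    have := hP _ _ ek ek1.
    have -> : a + k.+1%:R * d - (a + k%:R * d) = d by rewrite -natr1; ring.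
    have := hW _ ek; move: IH; rewrite !ler_norml -natr1 => /andP[i1 i2] /andP[w1 w2] /andP[p1 p2].
    have := ler_wpM2l d0 w1; have := ler_wpM2l d0 w2 => ? ?.
    by apply/andP; split; lra.
  have := hk m.+1; have -> : a + m.+1%:R * d = b by rewrite /d mulrC divfK // addrC subrK.
  move/le_trans; apply; rewrite /d le_eqVlt; apply/orP; left; apply/eqP.
  by field; rewrite ?nat1r ?natr1 pnatr_eq0.
apply: (cvg_ler h (cvg_cst _)).
rewrite -[X in _ --> X]addr0; apply: cvgD; first exact: cvg_cst.
by apply: cvg0Mr; exact: cvg_harmonic.
Qed.

End SegmentIntegral.


(** * The resolvent integral of a maximal skew operator *)

Section ResolventContinuity.
Variables (R : realType) (H : lmodType R[i]) (ip : H -> H -> R[i]).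
Hypothesis hH : is_hilbert ip.
Local Notation N := (hnorm ip).
Variables (D : set H) (E : H -> H).
Hypothesis hE : linear_operator D E.
Local Notation res := (resolvent D E).
Local Notation rho := (in_resolvent_set ip D E).

Lemma res_bounded z : rho z -> exists M, 0 < M /\ forall k, N (res z k) <= M * N k.
Proof.
move=> hz; have [Rl [[_ _ [M hM]] h1 h2]] := hz.
exists (`|M| + 1); split; first by have := normr_ge0 M; lra.
move=> k; have -> : res z k = Rl k.
  by have [D1 E1] := resP k hz; rewrite -[LHS]h2 // E1.
rewrite (le_trans (hM k)) // ler_wpM2r ?hnorm_ge0 //; have := ler_norm M; lra.
Qed.

Lemma res_sub a b h : rho a -> rho b -> res a h - res b h = (b - a) *: res b (res a h).
Proof.
by move=> ha hb; rewrite (res_identity hE h hb ha) opprD addrA subrr add0r -scaleNr opprB.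
Qed.

Lemma normc_vertical (e x y : R) : normc (Complex e y - Complex e x) = `|y - x|.
Proof.
rewrite -[_ - _]/(Complex (e - e) (y - x)) subrr /= expr0n /= add0r sqrtr_sqr //.
Qed.

(** No bound uniform along the line is available for a general operator, so a local one is derived
    from the bound at the single point [x]. *)
Lemma resolvent_continuous e h : (forall xi, rho (Complex e xi)) ->
  continuous (fun xi => N (res (Complex e xi) h) ^+ 2).
Proof.
move=> hr x; have [M [M0 hM]] := res_bounded (hr x).
(* In the resolvent identity the correction is at most half of the left-hand norm when |y - x| M <=
   1/2, and is absorbed there. *)
have near_bound y k : `|y - x| * M <= 2^-1 -> N (res (Complex e y) k) <= 2 * M * N k.
  move=> yx; have := res_sub k (hr y) (hr x).
  have := hnorm_distD hH (res (Complex e y) k) (res (Complex e x) k) 0; rewrite !subr0 => h1 h2.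
  move: h1; rewrite h2 (hnormZ hH) normc_vertical distrC => h1.
  have h3 := ler_wpM2l (normr_ge0 (y - x)) (hM (res (Complex e y) k)).
  have := ler_wpM2r (hnorm_ge0 ip (res (Complex e y) k)) yx; have := hM k; lra.
suff cN : (fun xi => N (res (Complex e xi) h)) xi @[xi --> x] --> N (res (Complex e x) h).
  by apply: cvgM.
apply/cvgrPdist_lt => d d0; pose K := 2 * M * M * N h.
have K0 : 0 <= K by rewrite /K !mulr_ge0 ?hnorm_ge0 // ltW.
exists (Num.min (2^-1 / M) (d / (K + 1))).
  by rewrite /= lt_min !divr_gt0 //; lra.
move=> y /=; rewrite distrC lt_min => /andP[y1 y2].
have y3 : `|y - x| * M <= 2^-1 by move: y1; rewrite ltr_pdivlMr // => /ltW.
rewrite (le_lt_trans (hnorm_dist hH _ _)) // (hnormC hH) (res_sub h (hr y) (hr x)) (hnormZ hH) normc_vertical distrC.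
have h1 := ler_wpM2l (ltW M0) (near_bound y h y3).
have h2 := ler_wpM2l (normr_ge0 (y - x)) (le_trans (hM _) h1).
rewrite (le_lt_trans h2) //; move: y2; rewrite ltr_pdivlMr; last lra.
by have := normr_ge0 (y - x); rewrite /K; lra.
Qed.

Lemma resolvent_energy_continuous e h : (forall xi, rho (Complex e xi)) ->
  continuous (fun xi => e * N (res (Complex e xi) h) ^+ 2).
Proof.
move=> hr x; have c := resolvent_continuous (h := h) hr.
by apply: cvgM; [exact: cvg_cst|exact: c].
Qed.

Lemma res_integralE e h : 0 < e -> (forall xi, rho (Complex e xi)) ->
  res_integral ip D E h e =
  (\int[lebesgue_measure]_(x in setT) (e * N (res (Complex e x) h) ^+ 2)%:E)%E.
Proof.
move=> e0 hr; rewrite /res_integral -ge0_integralZl //=.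
- by apply: continuous_measurable_EFin => //; exact: resolvent_continuous.
- by move=> x _; rewrite lee_fin sqr_ge0.
- by rewrite lee_fin ltW.
Qed.

End ResolventContinuity.

(** * The resolvent integral along vertical lines *)

Section SpectralIntegral.
Variables (R : realType) (H : lmodType R[i]) (ip : H -> H -> R[i]).
Hypothesis hH : is_hilbert ip.
Local Notation N := (hnorm ip).
Local Notation rip := (real_ip ip).
Variables (D : set H) (E : H -> H).
Hypothesis hm : maxskew ip D E.
Local Notation res := (resolvent D E).
Local Notation rho := (in_resolvent_set ip D E).
Let hE : linear_operator D E. Proof. by have [] := hm. Qed.
Let skew x : D x -> rip x (E x) = 0. Proof. by have [_ h _] := hm; exact: h. Qed.
Let hr e x : 0 < e -> rho (Complex e x). Proof. by move=> e0; exact: (maxskew_rho hH hm). Qed.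
Let rle e x h : 0 < e -> N (res (Complex e x) h) <= e^-1 * N h.
Proof. by move=> e0; exact: (maxskew_res_le hH hm). Qed.

(** An exact second-order expansion; its remainder carries three resolvents, hence the factor e^-3
    in later bounds. *)
Lemma res_taylor a b h : rho a -> rho b ->
  res b h = res a h + (a - b) *: res a (res a h) + (a - b) ^+ 2 *: res b (res a (res a h)).
Proof.
move=> ha hb; rewrite {1}(res_identity hE h hb ha) -addrA; congr (_ + _).
by rewrite (res_identity hE (res a h) hb ha) scalerDr scalerA expr2.
Qed.

(* With F(e + i x) = <(e + i x - E)^-1 h, h>: energy = Re F, flux = Im F, and slope = Re F' is both
   the e-derivative of energy and the x-derivative of flux. *)
Definition energy (h : H) (e x : R) : R := e * N (res (Complex e x) h) ^+ 2.
Definition flux (h : H) (e x : R) : R := rip (res (Complex e x) h) ('i%C *: h).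
Definition slope (h : H) (e x : R) : R := - rip (res (Complex e x) (res (Complex e x) h)) h.

(** Skewness makes the energy linear in the resolvent, so that [res_taylor] expands it directly. *)
Lemma energyE h e x : 0 < e -> energy h e x = rip (res (Complex e x) h) h.
Proof.
move=> e0; have hz := hr x e0; have := rip_scale hH (Complex e x) (res (Complex e x) h).
rewrite /= => e1; apply/eqP; rewrite /energy -e1 -subr_eq0 -(ripBr hH) -(op_res h hz).
by rewrite skew //; exact: res_dom hz.
Qed.

Lemma resolvent_le_uniform e e1 x k : 0 < e -> e <= e1 -> N (res (Complex e1 x) k) <= e^-1 * N k.
Proof.
move=> e0 ee; have e10 : 0 < e1 by exact: lt_le_trans ee.
by rewrite (le_trans (rle x k e10)) // ler_wpM2r ?hnorm_ge0 // lef_pV2.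
Qed.

Lemma res3_le e e1 e2 e3 x y z h : 0 < e -> e <= e1 -> e <= e2 -> e <= e3 ->
  N (res (Complex e1 x) (res (Complex e2 y) (res (Complex e3 z) h))) <= e ^- 3 * N h.
Proof.
move=> e0 ee1 ee2 ee3; have i0 : 0 <= e^-1 by rewrite invr_ge0 ltW.
have h1 := resolvent_le_uniform z h e0 ee3.
have h2 := le_trans (resolvent_le_uniform y _ e0 ee2) (ler_wpM2l i0 h1).
have h3 := le_trans (resolvent_le_uniform x _ e0 ee1) (ler_wpM2l i0 h2).
by rewrite (le_trans h3) // !mulrA -!expr2 -exprSr exprVn.
Qed.

Lemma flux_taylor h e x y : 0 < e ->
  `|flux h e y - flux h e x - (y - x) * slope h e x| <= e ^- 3 * N h ^+ 2 * (y - x) ^+ 2.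
Proof.
move=> e0; rewrite /flux (res_taylor h (hr x e0) (hr y e0)).
have -> : Complex e x - Complex e y = (x - y)%:C%C * 'i%C.
  by rewrite -[LHS]/(Complex _ _) -[RHS]/(Complex _ _) subrr; congr Complex; rewrite /=; ring.
set k2 := res _ (res _ h); set k3 := res (Complex e y) k2.
have -> : ((x - y)%:C%C * 'i%C) ^+ 2 = (- (y - x) ^+ 2)%:C%C.
  by rewrite exprMn sqr_i -rmorphXn -opprB sqrrN mulrN1 rmorphN.
rewrite !(ripDl hH) -scalerA !(ripZl hH) (ripii hH) /slope -/k2.
rewrite (_ : _ - _ - _ = - ((y - x) ^+ 2 * rip k3 ('i%C *: h))); last by ring.
rewrite normrN normrM ger0_norm ?sqr_ge0 // mulrC ler_wpM2r ?sqr_ge0 //.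
rewrite (le_trans (rip_cs hH _ _)) // (hnormZ hH) /= expr0n expr1n add0r sqrtr1 mul1r expr2 mulrA.
by rewrite ler_wpM2r ?hnorm_ge0 //; exact: res3_le.
Qed.

Lemma energy_taylor h e0 e e1 x : 0 < e0 -> e0 <= e -> e0 <= e1 ->
  `|energy h e1 x - energy h e x - (e1 - e) * slope h e x| <= e0 ^- 3 * N h ^+ 2 * (e1 - e) ^+ 2.
Proof.
move=> e00 ee ee1; have ep : 0 < e by exact: lt_le_trans ee.
have e1p : 0 < e1 by exact: lt_le_trans ee1.
rewrite !energyE // (res_taylor h (hr x ep) (hr x e1p)).
have -> : Complex e x - Complex e1 x = (e - e1)%:C%C.
  by rewrite -[LHS]/(Complex _ _) subrr.
set k2 := res _ (res _ h); set k3 := res (Complex e1 x) k2.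
rewrite -rmorphXn !(ripDl hH) !(ripZl hH) /slope -/k2.
rewrite (_ : _ - _ - _ = (e1 - e) ^+ 2 * rip k3 h); last by ring.
rewrite normrM ger0_norm ?sqr_ge0 // mulrC ler_wpM2r ?sqr_ge0 //.
rewrite (le_trans (rip_cs hH _ _)) // expr2 mulrA ler_wpM2r ?hnorm_ge0 //.
exact: res3_le.
Qed.

Lemma slope_continuous h e : 0 < e -> continuous (slope h e).
Proof.
move=> e0; apply: (@lipschitz_continuousR _ _ (2 * (e ^- 3 * N h) * N h)) => x y.
set a := Complex e x; set b := Complex e y; have ha := hr x e0; have hb := hr y e0.
rewrite /slope -/a -/b -opprD normrN -(ripBl hH) (le_trans (rip_cs hH _ _)) //.
rewrite mulrAC ler_wpM2r ?hnorm_ge0 //.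
have c1 k : N (res b k - res a k) = `|y - x| * N (res a (res b k)).
  by rewrite (res_sub hE k hb ha) (hnormZ hH) normc_vertical distrC.
rewrite (le_trans (hnorm_distD hH _ (res b (res a h)) _)) //.
rewrite -(clinearB (res_linear hE hb)) (res_sub hE h hb ha) (res_linear hE hb).2 (hnormZ hH) c1.
rewrite normc_vertical distrC.
have := ler_wpM2l (normr_ge0 (y - x)) (res3_le y x y h e0 (lexx e) (lexx e) (lexx e)).
have := ler_wpM2l (normr_ge0 (y - x)) (res3_le x y x h e0 (lexx e) (lexx e) (lexx e)).
by rewrite -/a -/b; lra.
Qed.

Lemma energy_continuous h e : 0 < e -> continuous (energy h e).
Proof.
by move=> e0; apply: (resolvent_energy_continuous hH hE) => xi; exact: hr.
Qed.

Lemma energy_ge0 h e x : 0 < e -> 0 <= energy h e x.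
Proof. by move=> e0; rewrite mulr_ge0 ?sqr_ge0 // ltW. Qed.

(** On the domain z (z - E)^-1 h = h + (z - E)^-1 E h, and the last term is at most |E h| / e. This
    gives decay in 1 / |z| from above and below. *)
Lemma normc_scale_res h e x : 0 < e -> D h ->
  normc (Complex e x) * N (res (Complex e x) h) <= N h + e^-1 * N (E h) /\
  N h - e^-1 * N (E h) <= normc (Complex e x) * N (res (Complex e x) h).
Proof.
move=> e0 Dh; have hz := hr x e0; rewrite -(hnormZ hH).
have := rle x (E h) e0; have := res_op hE hz Dh; set u := _ *: _; set w := res _ (E h) => e1 h1.
have -> : u = h + w by rewrite e1 addrC subrK.
have := hnormD hH h w; have := hnormB hH (h + w) w; rewrite addrK; lra.
Qed.

Lemma flux_decay h e x : 0 < e -> D h -> `|x| * `|flux h e x| <= (N h + e^-1 * N (E h)) * N h.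
Proof.
move=> e0 Dh; have [h1 _] := normc_scale_res x e0 Dh.
have h2 : `|flux h e x| <= N (res (Complex e x) h) * N h.
  by rewrite (le_trans (rip_cs hH _ _)) // (hnormZ hH) /= expr0n expr1n add0r sqrtr1 mul1r.
have h3 : `|x| <= normc (Complex e x).
  by rewrite /= -sqrtr_sqr ler_sqrt ?addr_ge0 ?sqr_ge0 // lerDr sqr_ge0.
rewrite (le_trans (ler_pM (normr_ge0 _) (normr_ge0 _) h3 h2)) // mulrA.
by rewrite ler_wpM2r ?hnorm_ge0.
Qed.

Definition esum n h e := sint n (energy h e).

(** The e-derivative of the truncated integral is the integral of [slope], of which [flux] is an
    antiderivative in x. Only two boundary values remain, and they are O(1/n) for [h] in the
    domain. *)
Lemma esum_lipschitz n h e s : 0 < e -> e <= s -> D h ->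
  `|esum n h s - esum n h e| <= (s - e) * (2 * ((N h + e^-1 * N (E h)) * N h) / n.+1%:R).
Proof.
move=> e0 es Dh; set C := (N h + _) * N h.
apply: (@quadratic_lipschitz _ (esum n h) (fun t => flux h t n.+1%:R - flux h t (- n.+1%:R)) _
  (e ^- 3 * N h ^+ 2 * (2 * n.+1%:R)) e) => //.
- move=> x y ex ey; have x0 : 0 < x by exact: lt_le_trans ex.
  have y0 : 0 < y by exact: lt_le_trans ey.
  have cx := energy_continuous (h := h) x0; have cy := energy_continuous (h := h) y0.
  have cs := slope_continuous (h := h) x0.
  have cs' : continuous (fun t => (y - x) * slope h x t).
    by move=> t; apply: cvgM; [exact: cvg_cst|exact: cs].
  have cyx : continuous (fun t => energy h y t - energy h x t).
    by move=> t; apply: cvgB; [exact: cy|exact: cx].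
  have df t := quadratic_is_derive (fun a b => flux_taylor h a b x0) t.
  rewrite -(sint_FTC n cs df).
  rewrite /esum -sintZ // -sintB // -sintB //.
  rewrite mulrAC; apply: sint_abs_le.
    by move=> t; apply: cvgB; [exact: cyx|exact: cs'].
  by move=> t; exact: energy_taylor.
- move=> x ex; have x0 : 0 < x by exact: lt_le_trans ex.
  have C1 : (N h + x^-1 * N (E h)) * N h <= C.
    by rewrite ler_wpM2r ?hnorm_ge0 // lerD2l ler_wpM2r ?hnorm_ge0 // lef_pV2.
  have := flux_decay n.+1%:R x0 Dh; have := flux_decay (- n.+1%:R) x0 Dh.
  rewrite normrN ger0_norm // => h1 h2; rewrite ler_pdivlMr // mulrC.
  have := ler_normB (flux h x n.+1%:R) (flux h x (- n.+1%:R)).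
  have n0 : 0 < n.+1%:R :> R by rewrite ltr0n.
  rewrite -(ler_pM2l n0) mulrDr; lra.
Qed.

(** The Poisson kernel without its factor 1 / pi, so that its total mass is pi. *)
Definition poisson (s x : R) : R := s / (s ^+ 2 + x ^+ 2).

Lemma poisson_den (s x : R) : 0 < s -> 0 < s ^+ 2 + x ^+ 2.
Proof. by move=> s0; rewrite ltr_pwDl ?sqr_ge0 // exprn_gt0. Qed.

Lemma poisson_continuous s : 0 < s -> continuous (poisson s).
Proof.
move=> s0 x; apply: cvgM; first exact: cvg_cst.
apply: cvgV; first by rewrite gt_eqF // poisson_den.
by apply: cvgD; [exact: cvg_cst|apply: cvgM; exact: cvg_id].
Qed.

Lemma sint_poisson n s : 0 < s -> sint n (poisson s) = 2 * atan (n.+1%:R / s).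
Proof.
move=> s0; have df (x : R) : is_derive x (1 : R) (fun x => atan (x / s)) (poisson s x); last first.
  by rewrite (sint_FTC n (poisson_continuous s0) df) mulNr atanN; ring.
have d1 : is_derive x (1 : R) (fun x => x / s) s^-1.
  apply: (@quadratic_is_derive _ (fun x => x / s) (fun=> s^-1) 0) => a b.
  by rewrite mulrBl subrr normr0 mul0r.
have d2 := @is_derive1_comp R (@atan R) (fun x => x / s) x _ _ (is_derive1_atan _) d1.
rewrite (_ : poisson s x = (1 + (x / s) ^+ 2)^-1 * s^-1) //.
rewrite /poisson -invfM; apply: (@mulIf _ (s ^+ 2 + x ^+ 2)); first by rewrite gt_eqF ?poisson_den.
rewrite divfK ?gt_eqF ?poisson_den // (_ : (1 + (x / s) ^+ 2) * s = (s ^+ 2 + x ^+ 2) / s).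
  by rewrite invf_div divfK // gt_eqF // poisson_den.
by field; rewrite gt_eqF.
Qed.

(** For such large s, |z| |(z - E)^-1 h| lies between |h| / 2 and 3 |h| / 2; squaring gives 1/4 and
    9/4. *)
Lemma esum_near_limit n h s : 0 < s -> D h -> 2 * N (E h) <= s * N h ->
  4^-1 * N h ^+ 2 * sint n (poisson s) <= esum n h s /\
  esum n h s <= 9 / 4 * N h ^+ 2 * sint n (poisson s).
Proof.
move=> s0 Dh hs; have cp := poisson_continuous s0; have ce := energy_continuous (h := h) s0.
have cpk (k : R) : continuous (fun x => k * poisson s x).
  by move=> x; apply: cvgM; [exact: cvg_cst|exact: cp].
have b x : 4^-1 * N h ^+ 2 * poisson s x <= energy h s x /\ energy h s x <= 9 / 4 * N h ^+ 2 * poisson s x.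
  have [h1 h2] := normc_scale_res x s0 Dh; have d0 := poisson_den x s0.
  have h3 : s^-1 * N (E h) <= N h / 2 by rewrite mulrC ler_pdivrMr // mulrAC ler_pdivlMr // mulrC; lra.
  set u := normc _ * _ in h1 h2.
  have -> : energy h s x = u ^+ 2 * poisson s x.
    by rewrite /energy /u exprMn normcE /= /poisson; field; rewrite gt_eqF.
  have p0 : 0 <= poisson s x by rewrite divr_ge0 // ltW.
  have n0 := hnorm_ge0 ip h.
  have u1 : u <= 3 / 2 * N h by lra.
  have u2 : 2^-1 * N h <= u by lra.
  split; apply: ler_wpM2r => //.
    rewrite (_ : 4^-1 * _ = (2^-1 * N h) ^+ 2); last by field.
    by rewrite ler_pXn2r // nnegrE; lra.
  rewrite (_ : 9 / 4 * _ = (3 / 2 * N h) ^+ 2); last by field.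
  by rewrite ler_pXn2r // nnegrE; lra.
rewrite -!sintZ //; split; apply: le_sint => // x; by have [] := b x.
Qed.

Lemma sint_poisson_le n s : 0 < s -> sint n (poisson s) <= pi.
Proof. by move=> s0; rewrite sint_poisson //; have := atan_ltpi2 (n.+1%:R / s); lra. Qed.

Lemma sint_poisson_ge n s : 0 < s -> s <= n.+1%:R -> pi / 2 <= sint n (poisson s).
Proof.
move=> s0 sn; rewrite sint_poisson //.
have h : atan 1 <= atan (n.+1%:R / s) by apply: le_atan; rewrite ler_pdivlMr // mul1r.
by move: h; rewrite atan1; lra.
Qed.

Lemma large_scale h e : 0 < e -> 0 < N h ->
  exists s, [/\ e <= s, 0 < s & 2 * N (E h) <= s * N h].
Proof.
move=> e0 h0; have es : e <= e + 2 * N (E h) / N h by rewrite lerDl divr_ge0 ?mulr_ge0 ?hnorm_ge0.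
exists (e + 2 * N (E h) / N h); split=> //; first exact: lt_le_trans es.
by rewrite [leRHS]mulrDl divfK ?gt_eqF // lerDr mulr_ge0 ?hnorm_ge0 // ltW.
Qed.

Lemma esum_dom_le n h e : 0 < e -> D h -> esum n h e <= 9 / 4 * pi * N h ^+ 2.
Proof.
move=> e0 Dh; have ce := energy_continuous (h := h) e0.
have [h0|hn0] := eqVneq (N h) 0.
  rewrite h0 expr0n mulr0 /esum.
  have -> : energy h e = fun=> 0.
    apply/funext => x; rewrite /energy (hnorm_eq0 hH h0).
    have z : res (Complex e x) 0 = 0.
      by rewrite -(scale0r 0) (res_linear hE (hr x e0)).2 !scale0r.
    by rewrite z (hnorm0 hH) expr0n mulr0.
  by rewrite sint_cst mul0r.
have h0 : 0 < N h by rewrite lt_def hn0 hnorm_ge0.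
have [s [es s0 hs]] := large_scale e0 h0.
(* Enlarging the segment only increases the integral, and the cost of moving from e to s on it is
   O(1/m), which disappears as m grows. *)
have hm' m : (n <= m)%N -> esum n h e <= 9 / 4 * pi * N h ^+ 2 +
    m.+1%:R^-1 * ((s - e) * (2 * ((N h + e^-1 * N (E h)) * N h))).
  move=> nm; have := sint_nondecreasing ce (fun x => energy_ge0 h x e0) nm.
  move/le_trans; apply; have := esum_lipschitz m e0 es Dh.
  have [_ h2] := esum_near_limit m s0 Dh hs.
  have h3 : 9 / 4 * N h ^+ 2 * sint m (poisson s) <= 9 / 4 * N h ^+ 2 * pi.
    by rewrite ler_wpM2l ?sint_poisson_le // mulr_ge0 ?sqr_ge0.
  rewrite ler_norml /esum => /andP[h4 h5]; move: h2 h3 h4; rewrite /esum; move: (m.+1%:R^-1) (e^-1) => q r; lra.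
move: hm'; set K := (s - e) * _ => hm'; have K0 : 0 <= K.
  rewrite mulr_ge0 ?subr_ge0 // mulr_ge0 // mulr_ge0 ?hnorm_ge0 // addr_ge0 ?hnorm_ge0 //.
  by rewrite mulr_ge0 ?hnorm_ge0 // invr_ge0 ltW.
apply: (@cvg_ler _ (fun=> esum n h e) (fun m => 9 / 4 * pi * N h ^+ 2 + m.+1%:R^-1 * K)).
- move=> m; rewrite (le_trans (hm' (n + m)%N (leq_addr _ _))) // lerD2l ler_wpM2r //.
  by rewrite lef_pV2 ?posrE // ler_nat ltnS leq_addl.
- exact: cvg_cst.
- rewrite -[X in _ --> X]addr0; apply: cvgD; first exact: cvg_cst.
  by apply: cvg0Mr; exact: cvg_harmonic.
Qed.

Lemma esum_dom_ge h e : 0 < e -> D h -> exists n, pi / 16 * N h ^+ 2 <= esum n h e.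
Proof.
move=> e0 Dh; have ce := energy_continuous (h := h) e0.
have [h0|hn0] := eqVneq (N h) 0.
  exists 0%N; rewrite h0 expr0n mulr0 /esum.
  have c0 : continuous (fun _ : R => (0 : R)) by move=> x; exact: cvg_cst.
  have := le_sint 0 c0 ce (fun x => energy_ge0 h x e0); by rewrite sint_cst mul0r.
have h0 : 0 < N h by rewrite lt_def hn0 hnorm_ge0.
have [s [es s0 hs]] := large_scale e0 h0.
pose K := (s - e) * (2 * ((N h + e^-1 * N (E h)) * N h)).
have p0 : 0 < pi / 16 * N h ^+ 2 by rewrite mulr_gt0 ?exprn_gt0 // divr_gt0 // pi_gt0.
(* n > s secures half the mass of the kernel, hence pi / 8; the second bound keeps the cost of
   moving from s to e below pi / 16. *)
pose n := Num.truncn (Num.max s (K / (pi / 16 * N h ^+ 2))).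
exists n; have := truncnS_gt (Num.max s (K / (pi / 16 * N h ^+ 2))); rewrite -/n gt_max => /andP[n1 n2].
have [h1 _] := esum_near_limit n s0 Dh hs.
have h2 : 4^-1 * N h ^+ 2 * (pi / 2) <= 4^-1 * N h ^+ 2 * sint n (poisson s).
  by rewrite ler_wpM2l ?sint_poisson_ge ?(ltW n1) // mulr_ge0 ?sqr_ge0.
have := esum_lipschitz n e0 es Dh.
have h3 : (s - e) * (2 * ((N h + e^-1 * N (E h)) * N h) / n.+1%:R) <= pi / 16 * N h ^+ 2.
  rewrite (_ : _ * _ = K / n.+1%:R); last by rewrite /K !mulrA.
  by rewrite ler_pdivrMr // mulrC -ler_pdivrMr // ltW.
rewrite ler_norml => /andP[h4 h5]; move: h1 h2 h3 h5; move: (n.+1%:R^-1) (e^-1) => q r; lra.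
Qed.

Lemma energy_parallelogram h k e x : 0 < e ->
  energy h e x <= 2 * energy k e x + 2 * energy (h - k) e x.
Proof.
move=> e0; have hz := hr x e0; rewrite /energy (clinearB (res_linear hE hz)).
set a := res _ h; set b := res _ k.
have h1 : N a <= N (a - b) + N b by have := hnormD hH (a - b) b; rewrite subrK.
have h2 : N a ^+ 2 <= (N (a - b) + N b) ^+ 2.
  by rewrite ler_pXn2r // nnegrE ?addr_ge0 ?hnorm_ge0.
have h3 : N a ^+ 2 <= 2 * N b ^+ 2 + 2 * N (a - b) ^+ 2.
  have := sqr_ge0 (N (a - b) - N b); move: h2; rewrite sqrrD sqrrB !mulr2n; lra.
have := ler_wpM2l (ltW e0) h3; lra.
Qed.

Lemma esum_parallelogram n h k e : 0 < e ->
  esum n h e <= 2 * esum n k e + 2 * esum n (h - k) e.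
Proof.
move=> e0; have c l := energy_continuous (h := l) e0.
have c2 l : continuous (fun x => 2 * energy l e x).
  by move=> x; apply: cvgM; [exact: cvg_cst|exact: c].
rewrite /esum -!sintZ // -sintD //; apply: le_sint => //.
  by move=> x; apply: cvgD; [exact: c2|exact: c2].
by move=> x; exact: energy_parallelogram.
Qed.

Lemma esum_crude n h e : 0 < e -> esum n h e <= e^-1 * N h ^+ 2 * (2 * n.+1%:R).
Proof.
move=> e0; rewrite /esum -sint_cst; apply: le_sint.
- exact: energy_continuous.
- by move=> x; exact: cvg_cst.
- move=> x; rewrite /energy; have h1 := rle x h e0.
  have h2 : N (res (Complex e x) h) ^+ 2 <= (e^-1 * N h) ^+ 2.
    by rewrite ler_pXn2r // nnegrE ?mulr_ge0 ?hnorm_ge0 // invr_ge0 ltW.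
  rewrite (le_trans (ler_wpM2l (ltW e0) h2)) //.
  rewrite (_ : e * (e^-1 * N h) ^+ 2 = e^-1 * N h ^+ 2) //.
  by field; rewrite gt_eqF.
Qed.

(** For fixed n, [esum_crude] makes the contribution of the approximation error vanish; the
    parallelogram bound doubles the constant. *)
Lemma esum_le n h e : 0 < e -> esum n h e <= 9 / 2 * pi * N h ^+ 2.
Proof.
move=> e0; have [k [kD hk]] := maxskew_dense hH hm h.
have cN : N (k m) @[m --> \oo] --> N h by exact: (hlim_norm hH).
apply: (@cvg_ler _ (fun=> esum n h e) (fun m => 9 / 2 * pi * (N (k m) * N (k m)) +
   (N (k m - h) * N (k m - h)) * (2 * (e^-1 * (2 * n.+1%:R))))).
- move=> m; rewrite (le_trans (esum_parallelogram n h (k m) e0)) //.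
  have := esum_dom_le n e0 (kD m); have := esum_crude n (h - k m) e0.
  rewrite (hnormC hH h) !expr2; lra.
- exact: cvg_cst.
- rewrite -[X in _ --> X]addr0; apply: cvgD.
    by rewrite expr2; apply: cvgM; [exact: cvg_cst|exact: cvgM].
  by apply: cvg0Mr; rewrite -(mulr0 (0 : R)); apply: cvgM; exact: hk.
Qed.

(** Here n depends on the approximant k, so k - h must be controlled uniformly in n; hence [esum_le]
    in place of [esum_crude]. *)
Lemma esum_ge h e : 0 < e -> exists n, pi / 64 * N h ^+ 2 <= esum n h e.
Proof.
move=> e0; have [h0|hn0] := eqVneq (N h) 0.
  exists 0%N; rewrite h0 expr0n mulr0 /esum.
  have c0 : continuous (fun _ : R => (0 : R)) by move=> x; exact: cvg_cst.
  have := le_sint 0 c0 (energy_continuous (h := h) e0) (fun x => energy_ge0 h x e0).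
  by rewrite sint_cst mul0r.
have h0 : 0 < N h by rewrite lt_def hn0 hnorm_ge0.
(* With this error, half of pi / 16 (31/32)^2 - 9 pi / 32^2 still exceeds pi / 64. *)
have d0 : 0 < N h / 32 by rewrite divr_gt0.
have [k Dk hk] := maxskew_dense_lt hH hm h d0.
have [n hn] := esum_dom_ge e0 Dk; exists n.
have := esum_parallelogram n k h e0; have := esum_le n (k - h) e0.
have nk : 31 / 32 * N h <= N k.
  by have := hnorm_dist hH h k; rewrite ler_norml => /andP[_]; lra.
have b1 : (31 / 32 * N h) ^+ 2 <= N k ^+ 2 by rewrite ler_pXn2r // nnegrE ?hnorm_ge0 //; lra.
have b2 : N (k - h) ^+ 2 <= (N h / 32) ^+ 2.
  by rewrite (hnormC hH) ler_pXn2r ?nnegrE ?hnorm_ge0 ?(ltW hk) ?(ltW d0).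
have b3 := ler_wpM2l (pi_ge0 R) b1; have b4 := ler_wpM2l (pi_ge0 R) b2.
have b5 : 0 < pi * N h ^+ 2 :> R by rewrite mulr_gt0 ?exprn_gt0 ?pi_gt0.
by move: hn b3 b4 b5; rewrite !exprMn !expr2; lra.
Qed.

Lemma maxskew_integral_bounds h e : 0 < e ->
  ((pi / 64 * N h ^+ 2)%:E <= res_integral ip D E h e)%E /\
  (res_integral ip D E h e <= (9 / 2 * pi * N h ^+ 2)%:E)%E.
Proof.
move=> e0; rewrite (res_integralE hH hE h e0 (fun xi => hr xi e0)); have c := energy_continuous (h := h) e0.
have g x := energy_ge0 h x e0; split.
  have [n hn] := esum_ge h e0.
  by apply: le_trans (sint_le_integral n c g); rewrite lee_fin.
by apply: integral_le_sint => // n; exact: esum_le.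
Qed.

End SpectralIntegral.


(** * Change of norm and Banach limits *)

Section NormEquivalence.
Variables (R : realType) (H : lmodType R[i]) (ip ip2 : H -> H -> R[i]).
Hypothesis (hH : is_hilbert ip) (hH2 : is_hilbert ip2).
Local Notation N := (hnorm ip).
Local Notation N2 := (hnorm ip2).
Variables (c C : R).
Hypothesis (c0 : 0 < c) (C0 : 0 < C).
Hypothesis (hc : forall x, c * N x <= N2 x) (hC : forall x, N2 x <= C * N x).

Lemma equiv_norm_le x : N x <= c^-1 * N2 x.
Proof. by rewrite mulrC ler_pdivlMr // mulrC. Qed.

Lemma bounded_op_equiv A : bounded_op ip2 A -> bounded_op ip A.
Proof.
move=> [AD AZ [M hM]]; split=> //; exists (c^-1 * (`|M| * C)) => x.
rewrite (le_trans (equiv_norm_le _)) // -!mulrA ler_wpM2l ?invr_ge0 ?(ltW c0) //.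
rewrite (le_trans (hM x)) // (le_trans (ler_wpM2r (hnorm_ge0 _ _) (ler_norm M))) //.
by rewrite ler_wpM2l.
Qed.

Lemma resolvent_set_equiv D E z : in_resolvent_set ip2 D E z -> in_resolvent_set ip D E z.
Proof. by move=> [Rl [/bounded_op_equiv hb h1 h2]]; exists Rl. Qed.

Lemma cvg0_equiv (T : Type) (F : set_system T) (FF : Filter F) (u : T -> H) :
  N2 (u t) @[t --> F] --> 0 <-> N (u t) @[t --> F] --> 0.
Proof.
split=> h.
  apply: (squeeze_cvgr _ (cvg_cst 0) (_ : c^-1 * N2 (u t) @[t --> F] --> 0)).
    by near=> t; rewrite hnorm_ge0 equiv_norm_le.
  by rewrite -(mulr0 c^-1); apply: cvgM => //; exact: cvg_cst.
apply: (squeeze_cvgr _ (cvg_cst 0) (_ : C * N (u t) @[t --> F] --> 0)).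
  by near=> t; rewrite hnorm_ge0 hC.
by rewrite -(mulr0 C); apply: cvgM => //; exact: cvg_cst.
Unshelve. all: by end_near. Qed.

Lemma generates_equiv D E T : generates ip2 D E T -> generates ip D E T.
Proof.
move=> [[h1 h2 h3 h4] h5]; split; first split=> //.
- by move=> t t0; apply/bounded_op_equiv/h1.
- by move=> x; apply/cvg0_equiv/h4.
- by move=> x y; rewrite h5; exact: cvg0_equiv.
Qed.

End NormEquivalence.

(** * Banach limits *)

Section BanachLimit.
Variable R : realType.
Implicit Types u v : nat -> R.

Definition bounded_seq u := exists M, forall n, `|u n| <= M.

(** The limit along an ultrafilter refining [\oo] is linear and monotone on bounded sequences; shift
    invariance is gained afterwards from Cesaro means. *)
Lemma ultrafilter_limit : exists L : (nat -> R) -> R,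
  [/\ forall u v, bounded_seq u -> bounded_seq v -> L (fun n => u n + v n) = L u + L v,
      forall a u, bounded_seq u -> L (fun n => a * u n) = a * L u,
      forall u v, bounded_seq u -> bounded_seq v -> (forall n, u n <= v n) -> L u <= L v &
      forall u (l : R), u n @[n --> \oo] --> l -> L u = l].
Proof.
have [U [UU sU]] := @ultraFilterLemma nat \oo _.
have cv u : bounded_seq u -> exists l : R, u n @[n --> U] --> l.
  move=> [M hM]; have PU : ProperFilter (u @ U) by exact: fmap_proper_filter.
  have uM : (u @ U) `[- M, M]%classic.
    suff -> : (u @ U) `[- M, M]%classic = U setT by exact: filterT.
    congr (U _); apply/seteqP; split=> // n _ /=; rewrite in_itv /= -ler_norml //.
  (* Compactness gives a cluster point, and an ultrafilter converges to its cluster points. *)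
  have [l [_ hl]] := @segment_compact R (- M) M _ PU uM.
  exists l => B lB; have [//|nB] := in_ultra_setVsetC (u @^-1` B) UU.
  by have [x [nBx Bx]] := hl (~` B) B nB lB.
have E u (l : R) : u n @[n --> U] --> l -> lim (u n @[n --> U]) = l.
  by move=> h; apply: cvg_lim => //; exact: Rhausdorff.
have C (a : R) : (fun=> a) n @[n --> U] --> a by exact: cvg_cst.
exists (fun u => lim (u n @[n --> U])); split.
- move=> u v /cv[l hl] /cv[l' hl']; rewrite (E _ _ hl) (E _ _ hl'); apply: E.
  exact: cvgD.
- move=> a u /cv[l hl]; rewrite (E _ _ hl); apply: E.
  by apply: cvgM => //; exact: C.
- move=> u v /cv[l hl] /cv[l' hl'] h; apply: ler_lim; [exact: (cvgP _ hl)|exact: (cvgP _ hl')|].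
  by apply: (filterS _ (@filterT _ U _)) => n _; exact: h.
- move=> u l hl; apply: E; apply: cvg_trans hl.
  by move=> A /= /sU.
Qed.

Definition cesaro u n : R := n.+1%:R^-1 * \sum_(k < n.+1) u k.

Lemma cesaro_bounded u M n : (forall n, `|u n| <= M) -> `|cesaro u n| <= M.
Proof.
move=> h; rewrite /cesaro normrM ger0_norm ?invr_ge0 // mulrC ler_pdivrMr ?ltr0n //.
rewrite (le_trans (ler_norm_sum _ _ _)) //.
have -> : M * n.+1%:R = \sum_(k < n.+1) M by rewrite sumr_const card_ord mulr_natr.
by apply: ler_sum => i _; exact: h.
Qed.

Lemma banach_limit : exists L : (nat -> R) -> R,
  [/\ forall u v, bounded_seq u -> bounded_seq v -> L (fun n => u n + v n) = L u + L v,
      forall a u, bounded_seq u -> L (fun n => a * u n) = a * L u,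
      forall u, bounded_seq u -> L (fun n => u n.+1) = L u,
      forall u v, bounded_seq u -> bounded_seq v -> (forall n, u n <= v n) -> L u <= L v &
      forall a, L (fun=> a) = a].
Proof.
have [L [LD LZ Lle Llim]] := ultrafilter_limit.
have cb u : bounded_seq u -> bounded_seq (cesaro u).
  by move=> [M hM]; exists M => n; exact: cesaro_bounded.
have cD u v : cesaro (fun n => u n + v n) = (fun n => cesaro u n + cesaro v n).
  by apply/funext => n; rewrite /cesaro big_split mulrDr.
have cZ a u : cesaro (fun n => a * u n) = (fun n => a * cesaro u n).
  by apply/funext => n; rewrite /cesaro -mulr_sumr mulrCA.
have c0 a : cesaro (fun=> a) = (fun=> a).
  apply/funext => n; rewrite /cesaro sumr_const card_ord -[a *+ _]mulr_natr mulrCA mulVf ?mulr1 //.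
have bZ a u : bounded_seq u -> bounded_seq (fun n => a * u n).
  by move=> [M hM]; exists (`|a| * M) => n; rewrite normrM ler_wpM2l.
exists (fun u => L (cesaro u)); split.
- by move=> u v hu hv; rewrite cD LD //; exact: cb.
- by move=> a u hu; rewrite cZ LZ //; exact: cb.
- move=> u hu; have hu' : bounded_seq (fun n => u n.+1) by have [M hM] := hu; exists M.
  (* The two means differ by (u_{n+1} - u_0) / (n + 1), which tends to 0. *)
  suff : L (fun n => cesaro (fun n => u n.+1) n + -1 * cesaro u n) = 0.
    rewrite LD ?LZ //; try exact: cb; last exact/bZ/cb.
    by move/eqP; rewrite mulN1r subr_eq0 => /eqP.
  apply: Llim; have [M hM] := hu.
  have cM : n.+1%:R^-1 * (2 * M) @[n --> \oo] --> 0 by apply: cvg0Mr; exact: cvg_harmonic.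
  have cM' : - (n.+1%:R^-1 * (2 * M)) @[n --> \oo] --> 0 by rewrite -[X in _ --> X]oppr0; exact: cvgN.
  apply: (squeeze_cvgr _ cM' cM); near=> n.
  rewrite -ler_norml /cesaro mulN1r -mulrBr normrM ger0_norm ?invr_ge0 // ler_wpM2l ?invr_ge0 //.
  rewrite -sumrB -(big_mkord xpredT (fun i => u i.+1 - u i)) telescope_sumr //.
  have := ler_normB (u n.+1) (u 0%N); have := hM n.+1; have := hM 0%N; lra.
- move=> u v hu hv h; apply: Lle; try exact: cb.
  move=> n; rewrite /cesaro ler_wpM2l ?invr_ge0 //; exact: ler_sum.
- by move=> a; rewrite c0; apply: Llim; exact: cvg_cst.
Unshelve. all: by end_near.
Qed.
End BanachLimit.

(** * An equivalent inner product invariant under a power-bounded operator *)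

Section InvariantProduct.
Variables (R : realType) (H : lmodType R[i]) (ip : H -> H -> R[i]).
Hypothesis hH : is_hilbert ip.
Local Notation N := (hnorm ip).
Local Notation rip := (real_ip ip).

Lemma invariant_product (V : H -> H) (c C : R) : clinear V -> 0 < c -> 0 < C ->
  (forall n x, c * N x <= N (iter n V x)) -> (forall n x, N (iter n V x) <= C * N x) ->
  exists ip2, [/\ is_hilbert ip2, forall x, c * N x <= hnorm ip2 x, forall x, hnorm ip2 x <= C * N x &
    forall x, hnorm ip2 (V x) = hnorm ip2 x].
Proof.
move=> [VD VZ] c0 C0 hc hC.
have [L [LD LZ LS Lle Lcst]] := banach_limit R.
pose W n x := iter n V x.
have WD n x y : W n (x + y) = W n x + W n y by elim: n => //= n ->.
have WZ n a x : W n (a *: x) = a *: W n x by elim: n => //= n ->.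
pose s x y n := rip (W n x) (W n y).
have sb x y : bounded_seq (s x y).
  exists (C * N x * (C * N y)) => n; rewrite (le_trans (rip_cs hH _ _)) //.
  by rewrite ler_pM ?hnorm_ge0 //; exact: hC.
have bcst a : bounded_seq (fun=> a : R) by exists `|a|.
have bZ a u : bounded_seq u -> bounded_seq (fun n => a * u n).
  by move=> [M hM]; exists (`|a| * M) => n; rewrite normrM ler_wpM2l.
have bD u v : bounded_seq u -> bounded_seq v -> bounded_seq (fun n => u n + v n).
  by move=> [M hM] [M' hM']; exists (M + M') => n; rewrite (le_trans (ler_normD _ _)) // lerD.
pose b x y := L (s x y).
have bC x y : b x y = b y x by rewrite /b; congr L; apply/funext => n; rewrite /s (ripC hH).
have biL x y : b ('i%C *: x) y = - b x ('i%C *: y).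
  rewrite -mulN1r -LZ //; congr L; apply/funext => n.
  by rewrite /s !WZ (ripil hH) mulN1r.
have bN x y : b x (- y) = - b x y.
  rewrite -mulN1r -LZ //; congr L; apply/funext => n.
  by rewrite /s -scaleN1r WZ scaleN1r (ripNr hH) mulN1r.
have bDl x y z : b (x + y) z = b x z + b y z.
  by rewrite -LD //; congr L; apply/funext => n; rewrite /s WD (ripDl hH).
have bZl (a : R) x z : b (a%:C%C *: x) z = a * b x z.
  by rewrite -LZ //; congr L; apply/funext => n; rewrite /s WZ (ripZl hH).
have ii (x : H) : 'i%C *: ('i%C *: x) = - x by rewrite scalerA -expr2 sqr_i scaleN1r.
(* The formula of [ipE]; [biL] is what makes it complex linear on the left. *)
pose ip2 x y := Complex (b x y) (b x ('i%C *: y)).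
have sq x : s x x = fun n => N (W n x) ^+ 2 by apply/funext => n; rewrite /s (hnorm_sq hH).
have lo x : (c * N x) ^+ 2 <= b x x.
  rewrite -[leLHS]Lcst; apply: Lle => // n; rewrite sq ler_pXn2r ?nnegrE ?hnorm_ge0 ?mulr_ge0 ?hnorm_ge0 ?(ltW c0) //.
  exact: hc.
have hi x : b x x <= (C * N x) ^+ 2.
  rewrite -[leRHS]Lcst; apply: Lle => // n; rewrite sq ler_pXn2r ?nnegrE ?hnorm_ge0 ?mulr_ge0 ?hnorm_ge0 ?(ltW C0) //.
  exact: hC.
have b_ge0 x : 0 <= b x x by rewrite (le_trans _ (lo x)) // sqr_ge0.
have N2sq x : hnorm ip2 x ^+ 2 = b x x by rewrite /hnorm /= sqr_sqrtr.
have lo2 x : c * N x <= hnorm ip2 x.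
  rewrite -(ler_pXn2r (n := 2)) ?nnegrE ?sqrtr_ge0 ?mulr_ge0 ?hnorm_ge0 ?(ltW c0) //.
  by rewrite N2sq lo.
have hi2 x : hnorm ip2 x <= C * N x.
  rewrite -(ler_pXn2r (n := 2)) ?nnegrE ?sqrtr_ge0 ?mulr_ge0 ?hnorm_ge0 ?(ltW C0) //.
  by rewrite N2sq hi.
exists ip2; split=> //; last first.
  move=> x; rewrite /hnorm /=; congr (Num.sqrt _); rewrite /b -[RHS]LS //; congr L.
  by apply/funext => n; rewrite /s /W -!iterSr.
split.
- move=> [a1 a2] x y z; rewrite /ip2 complex_scaleE !bDl !bZl !biL ii bN.
  by rewrite -[RHS]/(Complex _ _); congr Complex; ring.
- by move=> x y; rewrite /ip2 conjE /= bC; congr Complex; rewrite bC biL.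
- move=> x; rewrite lecE /= b_ge0 andbT; apply/eqP.
  have := biL x x; rewrite bC; lra.
- move=> x [h _]; apply: (hnorm_eq0 hH); apply/eqP; have := lo x; rewrite h.
  move=> h1; have : (c * N x) ^+ 2 == 0 by rewrite eq_le h1 sqr_ge0.
  by rewrite sqrf_eq0 mulf_eq0 gt_eqF.
- move=> u hu; have [e e0|l hl] := ip_complete hH (u := u).
    have [K hK] := hu (c * e) (mulr_gt0 c0 e0); exists K => m n Km Kn.
    by rewrite -(ltr_pM2l c0) (le_lt_trans (lo2 _)) // hK.
  exists l => e e0; have [K hK] := hl (e / C) (divr_gt0 e0 C0); exists K => n Kn.
  by rewrite (le_lt_trans (hi2 _)) // mulrC -ltr_pdivlMr // hK.
Qed.

End InvariantProduct.

(** * Comparison of upper and lower limits at 0 *)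

Section LimitComparison.
Variable R : realType.
Implicit Types f g : R -> \bar R.

Lemma limf_esup_le f (a : \bar R) : (\forall t \near 0^'+, (f t <= a)%E) ->
  (limf_esup f (0 : R)^'+ <= a)%E.
Proof.
move=> h; rewrite limf_esupE; apply: ereal_inf_le.
exists (ereal_sup (f @` [set t | (f t <= a)%E])); first by exists [set t | (f t <= a)%E].
by apply: ge_ereal_sup => _ [t /= ht <-].
Qed.

Lemma limf_esup_ge f (a : \bar R) : (\forall t \near 0^'+, (a <= f t)%E) ->
  (a <= limf_esup f (0 : R)^'+)%E.
Proof.
move=> h; rewrite limf_esupE; apply: le_ereal_inf_tmp => _ [V hV <-].
have [t [Vt ht]] := filter_ex (filterI hV h).
by apply: le_trans ht _; apply: ereal_sup_ubound; exists t.
Qed.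

Lemma limf_esup_lt f (a : \bar R) : (limf_esup f (0 : R)^'+ < a)%E ->
  \forall t \near 0^'+, (f t < a)%E.
Proof.
rewrite limf_esupE => /ereal_inf_lt[_ [V hV <-] h].
apply: filterS hV => t Vt; apply: le_lt_trans h.
by apply: ereal_sup_ubound; exists t.
Qed.

(** For the liminf, small values in every neighbourhood suffice; they need not persist near 0. *)
Lemma limf_einf_le f (a : \bar R) :
  (forall V : set R, nbhs 0^'+ V -> exists2 t, V t & (f t <= a)%E) -> (limf_einf f (0 : R)^'+ <= a)%E.
Proof.
move=> h; rewrite limf_einfE; apply: ge_ereal_sup => _ [V hV <-].
have [t Vt ht] := h V hV; apply: le_trans ht; apply: ereal_inf_lbound; by exists t.
Qed.

Lemma limf_einf_lt f (a : \bar R) (V : set R) : (limf_einf f (0 : R)^'+ < a)%E -> nbhs 0^'+ V ->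
  exists2 t, V t & (f t < a)%E.
Proof.
rewrite limf_einfE => h hV.
have : (ereal_inf (f @` V) < a)%E.
  by apply: le_lt_trans h; apply: ereal_sup_ubound; exists V.
by move=> /ereal_inf_lt[_ [t Vt <-] ht]; exists t.
Qed.

(* Stated in s = sqrt t because the cross term of the Cayley estimate has order sqrt eps. *)
Definition asymp_le f g := exists2 K, 0 <= K & forall s : R, 0 < s -> s <= 2^-1 ->
  (f (s ^+ 2)%R <= (1 + 10 * s)%:E * g (s ^+ 2)%R + (K * s)%:E)%E.

(** A pointwise implication valid near 0 serves both limits: its premise holds eventually for the
    limsup and frequently for the liminf. *)
Lemma asymp_le_near f g (c e : R) : asymp_le f g -> 0 <= c -> 0 < e ->
  exists2 d : R, 0 < d & \forall t \near 0^'+, (g t < (c + d)%:E)%E -> (f t <= (c + e)%:E)%E.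
Proof.
move=> [K K0 h] c0 e0; pose d := Num.min (e / 4) 1.
have d0 : 0 < d by rewrite lt_min divr_gt0 //=.
have d1 : d <= e / 4 by rewrite ge_min lexx.
have d2 : d <= 1 by rewrite ge_min lexx orbT.
(* [r] makes s (10 (c + 1) + K) at most e / 4; together with d <= e / 4 the total error stays below
   e. *)
exists d => //; pose r := Num.min (2^-1) (e / 4 / (10 * (c + 1) + K + 1)).
have k0 : 0 < 10 * (c + 1) + K + 1 by lra.
have r0 : 0 < r by rewrite lt_min !divr_gt0 // andbT invr_gt0.
near=> t; have t0 : 0 < t by near: t; exact: nbhs_right_gt.
have tr : t < r ^+ 2 by near: t; apply: nbhs_right_lt; exact: exprn_gt0.
pose s := Num.sqrt t; have s0 : 0 < s by rewrite sqrtr_gt0.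
have ts : t = s ^+ 2 by rewrite sqr_sqrtr // ltW.
have sr : s < r by rewrite -(ltr_pXn2r (n := 2)) ?nnegrE ?(ltW s0) ?(ltW r0) // -ts.
move: sr; rewrite lt_min => /andP[s2 sk]; rewrite ltr_pdivlMr // in sk.
have := h s s0 (ltW s2); rewrite -ts => /le_trans hle gt; apply: hle.
have h1 : ((1 + 10 * s)%:E * g t <= (1 + 10 * s)%:E * (c + d)%:E)%E.
  by apply: lee_wpmul2l; [rewrite lee_fin; lra|exact: ltW].
apply: le_trans (leeD2r _ h1) _; rewrite -EFinM -EFinD lee_fin.
have h2 : s * (c + d) <= s * (c + 1) by rewrite ler_wpM2l ?(ltW s0) // lerD2l.
by move: sk h2; lra.
Unshelve. all: by end_near. Qed.

Lemma asymp_le_esup f g (c : R) : asymp_le f g -> 0 <= c ->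
  (limf_esup g (0 : R)^'+ <= c%:E)%E -> (limf_esup f (0 : R)^'+ <= c%:E)%E.
Proof.
move=> h c0 hg; apply/lee_addgt0Pr => e e0; rewrite -EFinD.
have [d d0 hd] := asymp_le_near h c0 e0.
apply: limf_esup_le; have : (limf_esup g (0 : R)^'+ < (c + d)%:E)%E.
  by apply: le_lt_trans hg _; rewrite lte_fin ltrDl.
by move=> /limf_esup_lt gd; near=> t; apply: (near hd t); [by []|near: t; exact: gd].
Unshelve. all: by end_near. Qed.

Lemma asymp_le_einf f g (c : R) : asymp_le f g -> 0 <= c ->
  (limf_einf g (0 : R)^'+ <= c%:E)%E -> (limf_einf f (0 : R)^'+ <= c%:E)%E.
Proof.
move=> h c0 hg; apply/lee_addgt0Pr => e e0; rewrite -EFinD.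
have [d d0 hd] := asymp_le_near h c0 e0.
have gd : (limf_einf g (0 : R)^'+ < (c + d)%:E)%E.
  by apply: le_lt_trans hg _; rewrite lte_fin ltrDl.
apply: limf_einf_le => V hV.
by have [t [Vt ht] gt] := limf_einf_lt gd (filterI hV hd); exists t => //; exact: ht.
Qed.

End LimitComparison.


(** * The Cayley transform *)

Section CayleyTransform.
Variables (R : realType) (H : lmodType R[i]) (ip : H -> H -> R[i]).
Hypothesis hH : is_hilbert ip.
Local Notation N := (hnorm ip).
Local Notation rip := (real_ip ip).

Lemma ripZZ (a : R[i]) x y : rip (a *: x) (a *: y) = normc a ^+ 2 * rip x y.
Proof.
case: a => a b; rewrite normcE /= (complex_scaleE a b x) (complex_scaleE a b y).
rewrite !(ripDl hH, ripDr hH, ripZl hH, ripZr hH) (ripii hH) (ripil hH); ring.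
Qed.

(* Applied with (mu, z) = (lambda, x) and (- lambda, - x), which exchanges k and m.  The cross term
   <k, z> / (1 + mu) decays only like 1 / |xi|; AM-GM with weight s makes it integrable. *)
Lemma cayley_estimate (y z k m : H) (mu : R[i]) (s : R) :
  0 < s -> s <= 2^-1 -> `|complex.Re mu| <= s ^+ 2 ->
  k = y + mu *: y - z -> m = y - mu *: y + z ->
  N m ^+ 2 <= (1 + 10 * s) * N k ^+ 2 + 11 * s^-1 * N z ^+ 2 * poisson 1 (complex.Im mu).
Proof.
move=> s0 s1 amu ek em; set xi := complex.Im mu; set a := complex.Re mu in amu *.
pose q := z - mu *: y.
have mE : m = y + q by rewrite em /q addrA addrAC.
have kE : k = y - q by rewrite ek /q opprB addrA.
have s4 : s ^+ 2 <= 4^-1 by rewrite (_ : 4^-1 = (2^-1) ^+ 2); [rewrite ler_pXn2r ?nnegrE ?(ltW s0) // invr_ge0|field].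
move: amu; rewrite ler_norml => /andP[a1 a2].
(* For m = y + q and k = y - q the squared norms differ by 4 <y, q>, and <y, mu y> contributes only
   Re mu, of size at most s^2. *)
have h1 : N m ^+ 2 = N k ^+ 2 + 4 * (rip y z - a * N y ^+ 2).
  rewrite mE kE (hnormD_sq hH y q) (hnormB_sq hH y q) {2 3}/q (ripBr hH) (rip_scale hH) -/a; ring.
pose w := 1 + mu; have ew : w *: y = k + z by rewrite /w scalerDl scale1r ek subrK.
have Wn : normc w ^+ 2 = (1 + a) ^+ 2 + xi ^+ 2.
  by rewrite normcE /w /a /xi; case: (mu) => u v /=; rewrite add0r.
set W := normc w ^+ 2 in Wn; set S := normc w in W Wn.
(* From |a| <= 1/4 one has (1 + a)^2 >= 9/16. *)
have Wlow : 2^-1 * (1 + xi ^+ 2) <= W.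
  rewrite Wn; have := sqr_ge0 xi; have : 0 <= (1 + a - 3 / 4) * (1 + a + 3 / 4) by rewrite mulr_ge0 //; lra.
  lra.
have xi0 : 0 < 1 + xi ^+ 2 by have := sqr_ge0 xi; lra.
have W0 : 0 < W by lra.
have S0 : 0 < S by rewrite lt_def normc_ge0 andbT; apply/eqP => e; move: W0; rewrite /W e expr0n ltxx.
pose p := W^-1; have p0 : 0 < p by rewrite invr_gt0.
have pb : p <= 2 * poisson 1 xi.
  rewrite /poisson /p expr1n mul1r -[leRHS]invrK lef_pV2 ?posrE //.
    by rewrite invfM invrK.
  by rewrite invr_gt0 mulr_gt0 // invr_gt0.
have b1 : poisson 1 xi <= 1.
  by rewrite /poisson expr1n mul1r invf_le1 // lerDl sqr_ge0.
have p2 : p <= 2 by lra.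
have h2 : N y ^+ 2 <= p * (2 * N k ^+ 2 + 2 * N z ^+ 2).
  rewrite mulrC ler_pdivlMr // /W mulrC -exprMn -(hnormZ hH) ew (hnormD_sq hH).
  have := sqr_ge0 (N (k - z)); rewrite (hnormB_sq hH); lra.
(* Scaling both arguments by w gives W <y, z> = <k + z, w z>; the part <k, w z> is the slowly
   decaying cross term. *)
have h3 : rip y z <= N k * (N z * S^-1) + p * (1 + a) * N z ^+ 2.
  have : W * rip y z = rip k (w *: z) + (1 + a) * N z ^+ 2.
    by rewrite /W -ripZZ ew (ripDl hH) (rip_scale hH) /w /a; case: (mu).
  have : rip k (w *: z) <= N k * (S * N z) by rewrite (le_trans (rip_le hH _ _)) // (hnormZ hH).
  move=> e1 e2; rewrite -(ler_pM2l W0) e2 mulrDr.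
  rewrite (_ : W * (N k * (N z * S^-1)) = N k * (S * N z)); last by rewrite /W; field; rewrite gt_eqF.
  rewrite (_ : W * (p * (1 + a) * N z ^+ 2) = (1 + a) * N z ^+ 2) ?lerD2r //.
  by rewrite /p; field; rewrite gt_eqF.
pose t := s^-1; have st : s * t = 1 by rewrite divff // gt_eqF.
have t0 : 0 < t by rewrite invr_gt0.
have t2 : 2 <= t by rewrite -[2]invrK lef_pV2 // posrE.
pose A := N k ^+ 2; pose B := p * N z ^+ 2.
have A0 : 0 <= A by exact: sqr_ge0.
have B0 : 0 <= B by rewrite mulr_ge0 ?sqr_ge0 // ltW.
have h4 : N k * (N z * S^-1) <= 2^-1 * (s * A + t * B).
  have eB : B = (N z * S^-1) ^+ 2 by rewrite /B /p /W exprMn exprVn mulrC.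
  have : 0 <= t * (s * N k - N z * S^-1) ^+ 2 by rewrite mulr_ge0 ?sqr_ge0 // ltW.
  rewrite (_ : t * _ = s * (s * t) * A - 2 * (s * t) * (N k * (N z * S^-1)) + t * B); last by rewrite eB /A; ring.
  by rewrite st; lra.
have h5 : N y ^+ 2 <= 4 * A + 2 * B.
  have : p * A <= 2 * A by rewrite ler_wpM2r.
  by move: h2; rewrite /A /B; lra.
have h6 : - a * N y ^+ 2 <= s ^+ 2 * (4 * A + 2 * B).
  have := ler_wpM2r (sqr_ge0 (N y)) (_ : - a <= s ^+ 2); have := ler_wpM2l (sqr_ge0 s) h5.
  by move=> e1 e2; have := e2 ltac:(lra); lra.
have h7 : s ^+ 2 * A <= 2^-1 * (s * A) by rewrite [leRHS]mulrA ler_wpM2r // expr2 ler_wpM2r // ltW.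
have h8 : s ^+ 2 * B <= 4^-1 * B by rewrite ler_wpM2r.
have h9 : p * (1 + a) * N z ^+ 2 <= 5 / 4 * B.
  by rewrite mulrAC mulrC -/B ler_wpM2r //; lra.
have h10 : 2 * B <= t * B by rewrite ler_wpM2r.
have h11 : t * B <= t * (2 * poisson 1 xi * N z ^+ 2).
  by rewrite ler_pM2l // /B ler_wpM2r ?sqr_ge0.
rewrite h1 -/A -/t; lra.
Qed.

Variables (D : set H) (E : H -> H).
Hypothesis hE : linear_operator D E.
Local Notation res := (resolvent D E).
Local Notation rho := (in_resolvent_set ip D E).
Hypothesis hrho : forall z : R[i], 0 < complex.Re z -> rho z.

Let r1 : rho 1. Proof. by apply: hrho; rewrite /= ltr01. Qed.
Let hr e x : 0 < e -> rho (Complex e x). Proof. by move=> e0; exact: hrho. Qed.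

(** Written as 2 (1 - E)^-1 - 1, without [E] itself; [cayleyE] recovers (1 + E)(1 - E)^-1. *)
Definition cayley h := res 1 h + res 1 h - h.

Lemma cayley_linear : clinear cayley.
Proof.
have [lD lZ] := res_linear hE r1; split=> [x y|a x]; last first.
  by rewrite /cayley lZ -scalerDr -scalerBr.
by rewrite /cayley lD; apply: (ip_ext hH) => z; rewrite !(ipBl hH, ipDl hH, ipNl hH); ring.
Qed.

Lemma cayleyE h : cayley h = res 1 h + E (res 1 h).
Proof. by rewrite /cayley (op_res h r1) scale1r addrA. Qed.

Lemma cayley_resE h : h = res 1 h - E (res 1 h).
Proof. by rewrite -[LHS](res_eq h r1) scale1r. Qed.

(** The integrals over the line may be infinite, so the inequality is proved between finite numbers
    on segments, where the kernel contributes at most pi, and then passed to the limit. *)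
Lemma integral_compare (f g : R -> R) (c d : R) : continuous f -> continuous g ->
  (forall x, 0 <= f x) -> (forall x, 0 <= g x) -> 0 <= c -> 0 <= d ->
  (forall x, f x <= c * g x + d * poisson 1 x) ->
  (\int[lebesgue_measure]_(x in setT) (f x)%:E <=
   c%:E * \int[lebesgue_measure]_(x in setT) (g x)%:E + (d * pi)%:E)%E.
Proof.
move=> cf cg f0 g0 c0 d0 h; have cv := sint_cvg cf f0.
have cp := poisson_continuous (s := 1) (ltr01 : 0 < (1 : R)).
have ccg : continuous (fun x => c * g x) by move=> x; apply: cvgM; [exact: cvg_cst|exact: cg].
have cdp : continuous (fun x => d * poisson 1 x) by move=> x; apply: cvgM; [exact: cvg_cst|exact: cp].
rewrite -(cvg_lim (@ereal_hausdorff R) cv); apply: lime_le; first exact: (cvgP _ cv).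
near=> n; have : sint n f <= c * sint n g + d * pi.
  have : sint n f <= sint n (fun x => c * g x + d * poisson 1 x).
    by apply: le_sint => // x; apply: cvgD; [exact: ccg|exact: cdp].
  rewrite (sintD n ccg cdp) (sintZ n c cg) (sintZ n d cp); move/le_trans; apply; rewrite lerD2l ler_wpM2l //.
  exact: sint_poisson_le.
rewrite -lee_fin EFinD EFinM => /le_trans; apply; apply: leeD2r.
by apply: lee_wpmul2l; [rewrite lee_fin|exact: sint_le_integral].
Unshelve. all: by end_near. Qed.

(** Multiplying by eps = s^2 turns the tail factor s^-1 into s, so the tail vanishes with eps. *)
Lemma res_integral_asymp h k x :
  (forall s xi, 0 < s -> s <= 2^-1 -> N (res (Complex (s ^+ 2) xi) h) ^+ 2 <=
     (1 + 10 * s) * N (res (Complex (s ^+ 2) xi) k) ^+ 2 + 11 * s^-1 * N x ^+ 2 * poisson 1 xi) ->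
  asymp_le (res_integral ip D E h) (res_integral ip D E k).
Proof.
move=> hk; exists (11 * N x ^+ 2 * pi); first by rewrite mulr_ge0 ?pi_ge0 // mulr_ge0 ?sqr_ge0.
move=> s s0 s1; have e0 : 0 < s ^+ 2 by rewrite exprn_gt0.
have hre xi := hr xi e0.
rewrite !(res_integralE hH hE _ e0 hre) //.
rewrite (_ : 11 * N x ^+ 2 * pi * s = (11 * s * N x ^+ 2) * pi); last by ring.
apply: integral_compare.
- exact: resolvent_energy_continuous.
- exact: resolvent_energy_continuous.
- by move=> xi; rewrite mulr_ge0 ?sqr_ge0.
- by move=> xi; rewrite mulr_ge0 ?sqr_ge0.
- lra.
- by rewrite mulr_ge0 ?sqr_ge0 // mulr_ge0 // ltW.
- move=> xi; have := ler_wpM2l (ltW e0) (hk s xi s0 s1).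
  move/le_trans; apply; rewrite le_eqVlt; apply/orP; left; apply/eqP.
  by field; rewrite gt_eqF.
Qed.

(** With y = (lambda - E)^-1 x, the resolvent sends [h] to y - lambda y + x and [cayley h] to y +
    lambda y - x, the two vectors that [cayley_estimate] compares. *)
Lemma cayley_asymp h :
  asymp_le (res_integral ip D E h) (res_integral ip D E (cayley h)) /\
  asymp_le (res_integral ip D E (cayley h)) (res_integral ip D E h).
Proof.
set x := res 1 h; have Dx : D x := res_dom h r1.
have rh e xi (e0 : 0 < e) : let y := res (Complex e xi) x in
    res (Complex e xi) h = y - Complex e xi *: y + x /\
    res (Complex e xi) (cayley h) = y + Complex e xi *: y - x.
  have hz := hr xi e0; have [lD lZ] := res_linear hE hz => y; split.
    rewrite {1}(cayley_resE h) -/x (clinearB (conj lD lZ)) (res_op hE hz Dx) -/y.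
    by rewrite opprB addrA addrAC.
  by rewrite cayleyE -/x lD (res_op hE hz Dx) -/y addrA.
split; apply: (res_integral_asymp (x := x)) => s xi s0 s1; have e0 : 0 < s ^+ 2 by rewrite exprn_gt0.
- have [e1 e2] := rh (s ^+ 2) xi e0; rewrite e1 e2.
  apply: (cayley_estimate (mu := Complex (s ^+ 2) xi) (z := x) s0 s1) => //=.
  by rewrite ger0_norm // ltW.
- have [e1 e2] := rh (s ^+ 2) xi e0; rewrite e1 e2 -(hnormN hH x).
  have -> : poisson 1 xi = poisson 1 (complex.Im (- Complex (s ^+ 2) xi)) by rewrite /poisson /= sqrrN.
  apply: (cayley_estimate (mu := - Complex (s ^+ 2) xi) (z := - x) s0 s1) => /=.
  + by rewrite normrN ger0_norm // ltW.
  + by rewrite scaleNr opprK.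
  + by rewrite scaleNr opprK.
Qed.

Lemma cayley_power_bounds (alpha beta : R) : 0 < alpha -> 0 < beta ->
  (forall h,
     ((alpha * N h ^+ 2)%:E <= limf_esup (res_integral ip D E h) 0^'+)%E /\
     (limf_esup (res_integral ip D E h) 0^'+ <= (beta * N h ^+ 2)%:E)%E) \/
  (forall h,
     ((alpha * N h ^+ 2)%:E <= limf_einf (res_integral ip D E h) 0^'+)%E /\
     (limf_einf (res_integral ip D E h) 0^'+ <= (beta * N h ^+ 2)%:E)%E) ->
  forall n h, alpha * N h ^+ 2 <= beta * N (iter n cayley h) ^+ 2 /\
    alpha * N (iter n cayley h) ^+ 2 <= beta * N h ^+ 2.
Proof.
move=> a0 b0 hyp.
have [p [pb pV]] : exists p : H -> R, (forall h, alpha * N h ^+ 2 <= p h /\ p h <= beta * N h ^+ 2) /\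
    forall h, p (cayley h) = p h.
  (* Treats both alternatives at once: all it asks of the limit are the two bounds and monotonicity
     along [asymp_le]. *)
  have gen (q : H -> \bar R) :
      (forall h, ((alpha * N h ^+ 2)%:E <= q h)%E /\ (q h <= (beta * N h ^+ 2)%:E)%E) ->
      (forall h k, asymp_le (res_integral ip D E h) (res_integral ip D E k) ->
         forall c, 0 <= c -> (q k <= c%:E)%E -> (q h <= c%:E)%E) ->
      exists p : H -> R, (forall h, alpha * N h ^+ 2 <= p h /\ p h <= beta * N h ^+ 2) /\
        forall h, p (cayley h) = p h.
    move=> qb qle; have qf h : q h = (fine (q h))%:E.
      have [h1 h2] := qb h; case: (q h) h1 h2 => [r|//|]; first by [].
      by rewrite leeNy_eq.
    have pb h : alpha * N h ^+ 2 <= fine (q h) /\ fine (q h) <= beta * N h ^+ 2.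
      by rewrite -!lee_fin -qf; exact: qb.
    exists (fun h => fine (q h)); split=> // h.
    have p0 k : 0 <= fine (q k).
      by have [h1 _] := pb k; apply: le_trans h1; rewrite mulr_ge0 ?sqr_ge0 // ltW.
    have [h1 h2] := cayley_asymp h.
    apply/eqP; rewrite eq_le -!lee_fin -!qf; apply/andP; split.
      by rewrite [leRHS]qf; apply: (qle _ _ h2) => //; rewrite -qf.
    by rewrite [leRHS]qf; apply: (qle _ _ h1) => //; rewrite -qf.
  case: hyp => hyp.
    exact: (gen (fun h => limf_esup (res_integral ip D E h) 0^'+) hyp
      (fun h k hk c c0 => asymp_le_esup hk c0)).
  exact: (gen (fun h => limf_einf (res_integral ip D E h) 0^'+) hyp
    (fun h k hk c c0 => asymp_le_einf hk c0)).
have pn n h : p (iter n cayley h) = p h by elim: n => //= n <-.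
move=> n h; have := pn n h; have [h1 h2] := pb h; have [h3 h4] := pb (iter n cayley h).
by move=> e; split; lra.
Qed.

End CayleyTransform.

(** * The two implications *)

Section Assembly.
Variables (R : realType) (H : lmodType R[i]) (ip : H -> H -> R[i]).
Hypothesis hH : is_hilbert ip.
Local Notation N := (hnorm ip).
Variables (D : set H) (E : H -> H).
Hypothesis hE : linear_operator D E.

(** For h = x - E x the transform is x + E x; equality of the two norms in [ip2] says that Re <x, E
    x> vanishes. *)
Lemma invariant_maxskew ip2 : is_hilbert ip2 ->
  (forall z : R[i], 0 < complex.Re z -> in_resolvent_set ip D E z) ->
  (forall h, hnorm ip2 (cayley D E h) = hnorm ip2 h) -> maxskew ip2 D E.
Proof.
move=> hH2 hrho iso; split=> //; last first.
  by move=> z z0 h; have hz := hrho z z0; exists (resolvent D E z h); exact: (resP h hz).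
have r1 : in_resolvent_set ip D E 1 by apply: hrho; rewrite /= ltr01.
move=> x Dx; pose h := x - E x.
have xh : resolvent D E 1 h = x by have := resK r1 Dx; rewrite scale1r.
have := iso h; rewrite (cayleyE hrho) xh => /(congr1 (fun t => t ^+ 2)).
rewrite /h (hnormD_sq hH2) (hnormB_sq hH2); lra.
Qed.

Lemma integral_bounds_generate (alpha beta : R) : 0 < alpha -> 0 < beta ->
  (forall z : R[i], 0 < complex.Re z -> in_resolvent_set ip D E z) ->
  (forall h,
     ((alpha * N h ^+ 2)%:E <= limf_esup (res_integral ip D E h) 0^'+)%E /\
     (limf_esup (res_integral ip D E h) 0^'+ <= (beta * N h ^+ 2)%:E)%E) \/
  (forall h,
     ((alpha * N h ^+ 2)%:E <= limf_einf (res_integral ip D E h) 0^'+)%E /\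
     (limf_einf (res_integral ip D E h) 0^'+ <= (beta * N h ^+ 2)%:E)%E) ->
  exists T : R -> H -> H, generates ip D E T /\ similar_to_isometries ip T.
Proof.
move=> a0 b0 hrho hyp; have hpow := cayley_power_bounds hH hE hrho a0 b0 hyp.
pose c := Num.sqrt (alpha / beta); pose C := Num.sqrt (beta / alpha).
have c0 : 0 < c by rewrite sqrtr_gt0 divr_gt0.
have C0 : 0 < C by rewrite sqrtr_gt0 divr_gt0.
have c2 : c ^+ 2 = alpha / beta by rewrite sqr_sqrtr // ltW // divr_gt0.
have C2 : C ^+ 2 = beta / alpha by rewrite sqr_sqrtr // ltW // divr_gt0.
have [||ip2 [hH2 lo hi iso]] := @invariant_product _ _ _ hH _ c C (cayley_linear hH hE hrho) c0 C0.
- move=> n x; have [h1 _] := hpow n x.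
  rewrite -(ler_pXn2r (n := 2)) ?nnegrE ?hnorm_ge0 ?mulr_ge0 ?hnorm_ge0 ?sqrtr_ge0 //.
  by rewrite exprMn c2 mulrAC ler_pdivrMr // [leRHS]mulrC.
- move=> n x; have [_ h1] := hpow n x.
  rewrite -(ler_pXn2r (n := 2)) ?nnegrE ?hnorm_ge0 ?mulr_ge0 ?hnorm_ge0 ?sqrtr_ge0 //.
  by rewrite exprMn C2 mulrAC ler_pdivlMr // mulrC.
have hm := invariant_maxskew hH2 hrho iso.
have [T [gT iT]] := maxskew_generates hH2 hm.
exists T; split; first exact: (generates_equiv c0 lo hi gT).
have [Rm [Ri [k [[bR bRi] RRi RiR k0 nR]]]] := equivalent_product hH hH2 c0 C0 lo hi.
exists Rm, Ri; split=> // t x t0.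
by rewrite nR iT // -nR RRi.
Qed.

Lemma similar_bounds T : generates ip D E T -> similar_to_isometries ip T ->
  (forall z : R[i], 0 < complex.Re z -> in_resolvent_set ip D E z) /\
  exists alpha beta : R, [/\ 0 < alpha, 0 < beta & forall h,
     ((alpha * N h ^+ 2)%:E <= limf_esup (res_integral ip D E h) 0^'+)%E /\
     (limf_esup (res_integral ip D E h) 0^'+ <= (beta * N h ^+ 2)%:E)%E].
Proof.
move=> gT [Rm [Ri [[RD RZ [M hM]] [RiD RiZ [M' hM']] RRi RiR iso]]].
pose C := `|M| + 1; pose c := (`|M'| + 1)^-1.
have C0 : 0 < C by rewrite ltr_wpDl.
have c0 : 0 < c by rewrite invr_gt0 ltr_wpDl.
(* Pulling the product back along the similarity makes [T] itself isometric. *)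
pose ip2 x y := ip (Rm x) (Rm y).
have N2E x : hnorm ip2 x = N (Rm x) by [].
have hi x : hnorm ip2 x <= C * N x.
  rewrite N2E (le_trans (hM x)) // ler_wpM2r ?hnorm_ge0 // /C; have := ler_norm M; lra.
have lo x : c * N x <= hnorm ip2 x.
  rewrite N2E /c mulrC ler_pdivrMr ?ltr_wpDl // mulrC -{1}(RiR x) (le_trans (hM' _)) //.
  by rewrite ler_wpM2r ?hnorm_ge0 //; have := ler_norm M'; lra.
have hH2 : is_hilbert ip2.
  split.
  - by move=> a x y z; rewrite /ip2 RD RZ (ip_linear_l hH).
  - by move=> x y; rewrite /ip2 (ip_conj_sym hH).
  - by move=> x; exact: (ip_ge0 hH).
  - move=> x /(ip_definite hH) h; rewrite -(RiR x) h.
    by rewrite -(scale0r (0 : H)) RiZ !scale0r.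
  - move=> u hu; have [e e0|l hl] := ip_complete hH (u := u).
      have [K hK] := hu (c * e) (mulr_gt0 c0 e0); exists K => m n Km Kn.
      by rewrite -(ltr_pM2l c0) (le_lt_trans (lo _)) // hK.
    exists l => e e0; have [K hK] := hl (e / C) (divr_gt0 e0 C0); exists K => n Kn.
    by rewrite (le_lt_trans (hi _)) // mulrC -ltr_pdivlMr // hK.
(* The equivalence read backwards, in order to transfer [generates] from [ip] to [ip2]. *)
have lo' x : C^-1 * hnorm ip2 x <= N x by rewrite mulrC ler_pdivrMr // mulrC.
have hi' x : N x <= c^-1 * hnorm ip2 x by rewrite mulrC ler_pdivlMr // mulrC.
have c0' : 0 < c^-1 by rewrite invr_gt0.
have C0' : 0 < C^-1 by rewrite invr_gt0.
have g2 := generates_equiv C0' lo' hi' gT.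
have iso2 t x : 0 <= t -> hnorm ip2 (T t x) = hnorm ip2 x.
  by move=> t0; rewrite !N2E -{1}(RiR x) iso.
have hm := isometric_maxskew hH2 hE g2 iso2.
have hrho z : 0 < complex.Re z -> in_resolvent_set ip D E z.
  by move=> z0; apply: (resolvent_set_equiv c0 lo hi); exact: (maxskew_rho hH2 hm).
(* The change of norm is paid twice, in the integrand and in |h|; hence the square of c / C. *)
split=> //; pose a := pi / 64 * (c / C) ^+ 2; pose b := 9 / 2 * pi * (C / c) ^+ 2.
have pi0 := pi_gt0 R.
exists a, b; split.
- by rewrite mulr_gt0 ?exprn_gt0 ?divr_gt0.
- by rewrite mulr_gt0 ?exprn_gt0 ?divr_gt0 // mulr_gt0.
move=> h; have bnd e : 0 < e ->
    ((a * N h ^+ 2)%:E <= res_integral ip D E h e)%E /\ (res_integral ip D E h e <= (b * N h ^+ 2)%:E)%E.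
  move=> e0; have [h1 h2] := maxskew_integral_bounds hH2 hm h e0.
  have hr2 xi : in_resolvent_set ip2 D E (Complex e xi) by exact: (maxskew_rho hH2 hm).
  have hr1 xi : in_resolvent_set ip D E (Complex e xi) by exact: hrho.
  have q1 := res_integralE hH hE h e0 hr1; have q2 := res_integralE hH2 hE h e0 hr2.
  have k1 := resolvent_energy_continuous hH hE (h := h) hr1.
  have k2 := resolvent_energy_continuous hH2 hE (h := h) hr2.
  have sqle (u v : R) : 0 <= u -> u <= v -> u ^+ 2 <= v ^+ 2.
    by move=> u0 uv; rewrite ler_pXn2r // nnegrE // (le_trans u0).
  have p1 x : 0 <= e * N (resolvent D E (Complex e x) h) ^+ 2 by rewrite mulr_ge0 ?sqr_ge0 // ltW.
  have p2 x : 0 <= e * hnorm ip2 (resolvent D E (Complex e x) h) ^+ 2.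
    by rewrite mulr_ge0 ?sqr_ge0 // ltW.
  have C20 : 0 < C ^+ 2 by rewrite exprn_gt0.
  have c20 : 0 < c ^- 2 by rewrite invr_gt0 exprn_gt0.
  have le12 : (res_integral ip D E h e <= (c ^- 2)%:E * res_integral ip2 D E h e)%E.
    rewrite q1 q2; have := integral_compare k1 k2 p1 p2 (ltW c20) (lexx 0).
    rewrite mul0r adde0; apply => x; rewrite mul0r addr0 [leRHS]mulrCA ler_pM2l //.
    have := sqle _ _ (mulr_ge0 (ltW c0) (hnorm_ge0 ip _)) (lo (resolvent D E (Complex e x) h)).
    by rewrite exprMn => h3; rewrite mulrC ler_pdivlMr ?exprn_gt0 // mulrC.
  have le21 : (res_integral ip2 D E h e <= (C ^+ 2)%:E * res_integral ip D E h e)%E.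
    rewrite q1 q2; have := integral_compare k2 k1 p2 p1 (ltW C20) (lexx 0).
    rewrite mul0r adde0; apply => x; rewrite mul0r addr0 [leRHS]mulrCA ler_pM2l // -exprMn.
    exact: sqle (hnorm_ge0 ip2 _) (hi _).
  have b1 := sqle _ _ (mulr_ge0 (ltW c0) (hnorm_ge0 ip _)) (lo h).
  have b2 := sqle _ _ (hnorm_ge0 ip2 _) (hi h).
  split.
    rewrite -(@lee_pmul2l _ (C ^+ 2)%:E) // ?lte_fin //; apply: le_trans le21.
    apply: le_trans h1; rewrite -EFinM lee_fin.
    rewrite (_ : C ^+ 2 * (a * N h ^+ 2) = pi / 64 * (c * N h) ^+ 2).
      by rewrite ler_pM2l // divr_gt0.
    by rewrite /a; field; rewrite gt_eqF.
  apply: (le_trans le12); apply: (le_trans (lee_wpmul2l _ h2)); first by rewrite lee_fin ltW.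
  rewrite -EFinM lee_fin (_ : b * N h ^+ 2 = c ^- 2 * (9 / 2 * pi * (C * N h) ^+ 2)).
    by rewrite ler_pM2l // ler_pM2l // mulr_gt0.
  by rewrite /b; field; rewrite gt_eqF.
split.
  apply: limf_esup_ge; near=> t; have [] // := bnd t; near: t; exact: nbhs_right_gt.
apply: limf_esup_le; near=> t; have [] // := bnd t; near: t; exact: nbhs_right_gt.
Unshelve. all: by end_near. Qed.
End Assembly.

Theorem theoremA1 (R : realType) (H : lmodType R[i]) (ip : H -> H -> R[i])
  (hH : is_hilbert ip) (D : set H) (E : H -> H)
  (hE : linear_operator D E) :
  (exists T : R -> H -> H, generates ip D E T /\ similar_to_isometries ip T)
  <->
  ((forall z : R[i], 0 < complex.Re z -> in_resolvent_set ip D E z) /\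
   exists alpha beta : R, [/\ 0 < alpha, 0 < beta &
     ((forall h : H,
         ((alpha * hnorm ip h ^+ 2)%:E <= limf_esup (res_integral ip D E h) 0^'+)%E /\
         (limf_esup (res_integral ip D E h) 0^'+ <= (beta * hnorm ip h ^+ 2)%:E)%E)
      \/
      (forall h : H,
         ((alpha * hnorm ip h ^+ 2)%:E <= limf_einf (res_integral ip D E h) 0^'+)%E /\
         (limf_einf (res_integral ip D E h) 0^'+ <= (beta * hnorm ip h ^+ 2)%:E)%E))]).
Proof.
split=> [[T [gT sT]]|[hrho [a [b [a0 b0 h]]]]].
  have [hrho [a [b [a0 b0 h]]]] := similar_bounds hH hE gT sT.
  by split=> //; exists a, b; split=> //; left.
exact: (integral_bounds_generate hH hE a0 b0 hrho h).
Qed.
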